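(* Let $q\ge1$ and let $w$ be a probability function on $SL_q$ (satisfying Constant Exchangeability). Then $w$ satisfies ULi with SPx if and only if there exists a normalised $\sigma$-additive measure $\mu$ on $\mathcal B$ such that for every $\theta\in SL_q$, $$w(\theta)=\int_{\mathcal B} v^{\bar p,\bar\tau}_{L_q}(\theta)\,d\mu(\langle\bar p,\bar\tau\rangle).$$
   Context: For $k\ge1$, $L_k$ is the first-order language with unary predicates $P_1,\dots,P_k$, constants $a_1,a_2,\dots$, no equality or function symbols; $SL_k$ its sentences. Atoms of $L_q$: $\alpha_1,\dots,\alpha_{2^q}$, the formulas $\bigwedge_{i=1}^q\pm P_i(x)$; $\gamma_q(\alpha)$ = number of negated predicates in $\alpha$. State descriptions: $\bigwedge_{i=1}^m\alpha_{h_i}(a_i)$. A probability function on $SL_q$ is $w:SL_q\to[0,1]$ with $w(\top)=1$, $w(\phi\vee\theta)=w(\phi)+w(\theta)$ if $\phi\models\neg\theta$, and $w(\exists x\phi(x))=\lim_n w(\bigvee_{i\le n}\phi(a_i))$; it is determined by its values on state descriptions. All probability functions are assumed to satisfy Ex: invariance under permutations of the constants. Px: invariance under permutations of the predicate symbols. P-spectrum of $\Theta=\bigwedge_k\alpha_{h_k}(a_k)$: for each $i\in\{0,\dots,q\}$, $M_i$ is the multiset of sizes of the classes of ''$a_k\sim a_l\iff h_k=h_l$'' on the constants whose atom has exactly $i$ negations; the P-spectrum is $\langle M_0,\dots,M_q\rangle$. SPx: $w(\Theta)=w(\Phi)$ whenever $\Theta,\Phi$ are state descriptions for the same constants with the same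 P-spectrum. ULi with SPx: there is a family of probability functions $w^{\mathcal L}$, one for each finite unary language $\mathcal L$ (with constants $a_1,a_2,\dots$), each satisfying Ex, Px and SPx, with $w^{L_q}=w$ and $w^{\mathcal L'}\restriction S\mathcal L=w^{\mathcal L}$ whenever $\mathcal L\subseteq\mathcal L'$. $\mathcal B$ is the set of pairs $\langle\bar p,\bar\tau\rangle$, $\bar p=\langle p_0,p_1,p_2,\dots\rangle$, $\bar\tau=\langle\tau_0,\tau_1,\tau_2,\dots\rangle$, with $p_i\ge0$, $p_1\ge p_2\ge p_3\ge\cdots$, $\sum_{i\ge0}p_i=1$, $\tau_j\in[0,1]$ for $j\ge1$, and $\tau_0$ a normalised $\sigma$-additive (Borel) measure on $[0,1]$. For $\langle\bar p,\bar\tau\rangle\in\mathcal B$, a state description $\Theta=\bigwedge_{i=1}^m\alpha_{h_i}(a_i)$ of $L_q$ and $\vec c=\langle c_1,\dots,c_m\rangle\in\mathbb N^m$ define $j^{\bar p,\bar\tau}_{L_q}$ recursively: $j(\top,\langle\rangle)=1$ and, writing $\Theta^-=\bigwedge_{i=1}^{m-1}\alpha_{h_i}(a_i)$, $j(\Theta,\vec c)=j(\Theta^-,\langle c_1,..,c_{m-1}\rangle)\,p_{c_m}\,b_{h_m,c_m}$ if $c_m=0$ or $c_l\ne c_m$ for all $l<m$; $j(\Theta,\vec c)=j(\Theta^-,\langle c_1,..,c_{m-1}\rangle)\,p_{c_m}$ if $c_m\neq0$ and $c_l=c_m$ for some $l<m$ with $h_l=h_m$; and $j(\Theta,\vec c)=0$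 otherwise; here $b_{h,c}=\tau_c^{\gamma_q(\alpha_h)}(1-\tau_c)^{q-\gamma_q(\alpha_h)}$ if $c>0$ and $b_{h,0}=\int_{[0,1]}x^{\gamma_q(\alpha_h)}(1-x)^{q-\gamma_q(\alpha_h)}\,d\tau_0(x)$. Then $v^{\bar p,\bar\tau}_{L_q}(\Theta)=\sum_{\vec c\in\mathbb N^m}j^{\bar p,\bar\tau}_{L_q}(\Theta,\vec c)$; this extends uniquely to a probability function on $SL_q$ (defined analogously on every $L_k$), and each $v^{\bar p,\bar\tau}$ satisfies Ex, SPx, ULi (via the family $v^{\bar p,\bar\tau}_{L_k}$) and Weak Irrelevance. *)

(* Defs.v *)
From HB Require Import structures.
From mathcomp Require Import all_boot all_order all_algebra.
From mathcomp Require Import all_classical all_reals all_analysis.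
From Stdlib Require Import ClassicalEpsilon.

Set Implicit Arguments.
Unset Strict Implicit.
Unset Printing Implicit Defensive.

Import Order.TTheory GRing.Theory Num.Theory.
Import numFieldNormedType.Exports.
Local Open Scope ring_scope.
Local Open Scope classical_set_scope.

(*  Predicate symbols are drawn from the pool P_0, P_1, ... (nat);      *)
(*  constants a_0, a_1, ... (the paper's a_1, a_2, ... shifted by one); *)
(*  bound variables are de Bruijn indices.                               *)

Inductive term := TVar of nat | TConst of nat.

Inductive fml :=
| FTop
| FPred of nat & term
| FNeg of fml
| FAnd of fml & fml
| FOr of fml & fml
| FImp of fml & fml
| FEx of fml
| FAll of fml.

(* Tarskian semantics over an arbitrary (nonempty, since constants exist)
   domain D. *)
Definition eval_term (D : Type) (ci : nat -> D) (env : nat -> D) (t : term) :=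
  match t with TVar n => env n | TConst c => ci c end.

Definition cons_env (D : Type) (d : D) (env : nat -> D) : nat -> D :=
  fun n => if n is n'.+1 then env n' else d.

Fixpoint sat (D : Type) (ci : nat -> D) (pi : nat -> D -> Prop)
    (env : nat -> D) (f : fml) : Prop :=
  match f with
  | FTop => True
  | FPred i t => pi i (eval_term ci env t)
  | FNeg g => ~ sat ci pi env g
  | FAnd g h => sat ci pi env g /\ sat ci pi env h
  | FOr g h => sat ci pi env g \/ sat ci pi env h
  | FImp g h => sat ci pi env g -> sat ci pi env h
  | FEx g => exists d : D, sat ci pi (cons_env d env) g
  | FAll g => forall d : D, sat ci pi (cons_env d env) g
  end.

Definition valid (f : fml) : Prop :=
  forall (D : Type) (ci : nat -> D) (pi : nat -> D -> Prop) (env : nat -> D),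
    sat ci pi env f.

Definition entails (f g : fml) : Prop :=
  forall (D : Type) (ci : nat -> D) (pi : nat -> D -> Prop) (env : nat -> D),
    sat ci pi env f -> sat ci pi env g.

Fixpoint closed_at (k : nat) (f : fml) : bool :=
  match f with
  | FTop => true
  | FPred _ (TVar n) => (n < k)%N
  | FPred _ (TConst _) => true
  | FNeg g => closed_at k g
  | FAnd g h | FOr g h | FImp g h => closed_at k g && closed_at k h
  | FEx g | FAll g => closed_at k.+1 g
  end.

Fixpoint preds_in (L : seq nat) (f : fml) : bool :=
  match f with
  | FTop => true
  | FPred i _ => i \in L
  | FNeg g => preds_in L g
  | FAnd g h | FOr g h | FImp g h => preds_in L g && preds_in L h
  | FEx g | FAll g => preds_in L g
  end.

Definition sentence (L : seq nat) (f : fml) : bool :=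
  closed_at 0 f && preds_in L f.

Definition inst_term (d c : nat) (t : term) : term :=
  match t with
  | TVar n => if n == d then TConst c else if (d < n)%N then TVar n.-1 else TVar n
  | TConst e => TConst e
  end.

Fixpoint inst_at (d c : nat) (f : fml) : fml :=
  match f with
  | FTop => FTop
  | FPred i t => FPred i (inst_term d c t)
  | FNeg g => FNeg (inst_at d c g)
  | FAnd g h => FAnd (inst_at d c g) (inst_at d c h)
  | FOr g h => FOr (inst_at d c g) (inst_at d c h)
  | FImp g h => FImp (inst_at d c g) (inst_at d c h)
  | FEx g => FEx (inst_at d.+1 c g)
  | FAll g => FAll (inst_at d.+1 c g)
  end.

Fixpoint bigor (phi : fml) (n : nat) : fml :=
  match n with
  | 0 => inst_at 0 0 phi
  | n'.+1 => FOr (bigor phi n') (inst_at 0 n phi)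
  end.

Definition rename_term (s : nat -> nat) (t : term) : term :=
  match t with TVar n => TVar n | TConst c => TConst (s c) end.

Fixpoint rename_const (s : nat -> nat) (f : fml) : fml :=
  match f with
  | FTop => FTop
  | FPred i t => FPred i (rename_term s t)
  | FNeg g => FNeg (rename_const s g)
  | FAnd g h => FAnd (rename_const s g) (rename_const s h)
  | FOr g h => FOr (rename_const s g) (rename_const s h)
  | FImp g h => FImp (rename_const s g) (rename_const s h)
  | FEx g => FEx (rename_const s g)
  | FAll g => FAll (rename_const s g)
  end.

Fixpoint rename_pred (s : nat -> nat) (f : fml) : fml :=
  match f with
  | FTop => FTop
  | FPred i t => FPred (s i) t
  | FNeg g => FNeg (rename_pred s g)
  | FAnd g h => FAnd (rename_pred s g) (rename_pred s h)
  | FOr g h => FOr (rename_pred s g) (rename_pred s h)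
  | FImp g h => FImp (rename_pred s g) (rename_pred s h)
  | FEx g => FEx (rename_pred s g)
  | FAll g => FAll (rename_pred s g)
  end.

(* The language L_q = {P_1,...,P_q}, here predicate indices 0..q-1. *)
Definition Lq (q : nat) : seq nat := iota 0 q.

Section Prob.
Variable R : realType.

(* w is a probability function on SL (values outside SL are irrelevant) *)
Definition probfun (L : seq nat) (w : fml -> R) : Prop :=
  [/\ (forall f, sentence L f -> 0 <= w f <= 1),
      (forall f, sentence L f -> valid f -> w f = 1),
      (forall f g, sentence L f -> sentence L g -> entails f (FNeg g) ->
         w (FOr f g) = w f + w g) &
      (forall phi, closed_at 1 phi -> preds_in L phi ->
         (fun n => w (bigor phi n)) @ \oo --> w (FEx phi))].

Definition ExP (L : seq nat) (w : fml -> R) : Prop :=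
  forall s : nat -> nat, bijective s ->
  forall f, sentence L f -> w (rename_const s f) = w f.

Definition PxP (L : seq nat) (w : fml -> R) : Prop :=
  forall s : nat -> nat, bijective s -> (forall i, (s i \in L) = (i \in L)) ->
  forall f, sentence L f -> w (rename_pred s f) = w f.

(* Atoms of L are sign vectors a : seq bool indexed along undup L
   (true = P, false = not P).  A state description for a_0,...,a_(m-1)
   is given by the list h of the atoms of the constants. *)
Definition atom_form (L : seq nat) (a : seq bool) (c : nat) : fml :=
  foldr FAnd FTop
    [seq (if ib.2 then FPred ib.1 (TConst c) else FNeg (FPred ib.1 (TConst c)))
    | ib <- zip (undup L) a].

Definition sd (L : seq nat) (h : seq (seq bool)) : fml :=
  foldr FAnd FTop [seq atom_form L (nth [::] h k) k | k <- iota 0 (size h)].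

Definition wf_sd (L : seq nat) (h : seq (seq bool)) : bool :=
  all (fun a => size a == size (undup L)) h.

Definition natoms_neg (a : seq bool) : nat := count negb a.

Definition Mspec (i : nat) (h : seq (seq bool)) : seq nat :=
  [seq count (pred1 a) h | a <- undup h & natoms_neg a == i].

Definition same_spectrum (h h' : seq (seq bool)) : Prop :=
  forall i, perm_eq (Mspec i h) (Mspec i h').

Definition SPxP (L : seq nat) (w : fml -> R) : Prop :=
  forall h h', wf_sd L h -> wf_sd L h' -> size h = size h' ->
  same_spectrum h h' -> w (sd L h) = w (sd L h').

Definition ULi_SPx (q : nat) (w : fml -> R) : Prop :=
  exists W : seq nat -> fml -> R,
    [/\ (forall L, [/\ probfun L (W L), ExP L (W L), PxP L (W L) & SPxP L (W L)]),
        (forall f, sentence (Lq q) f -> W (Lq q) f = w f) &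
        (forall L L' f, {subset L <= L'} -> sentence L f -> W L' f = W L f)].

(* raw parameters <p, tau>; tau0 is a probability measure on (Borel) R,
   required below to be concentrated on [0,1] *)
Record Braw := mkB { bp : nat -> R; btau : nat -> R; btau0 : probability R R }.

HB.instance Definition _ := gen_eqMixin Braw.
HB.instance Definition _ := gen_choiceMixin Braw.
HB.instance Definition _ := isPointed.Build Braw
  (mkB (fun _ => 0) (fun _ => 0) (\d_(0 : R) : probability R R)).

Definition inB (b : Braw) : Prop :=
  [/\ (forall i, 0 <= bp b i),
      (forall i, (0 < i)%N -> bp b i.+1 <= bp b i),
      (fun n => \sum_(i < n) bp b i) @ \oo --> (1 : R),
      (forall j, (0 < j)%N -> 0 <= btau b j <= 1) &
      btau0 b `[0%R, 1%R]%classic = 1%E].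

Definition Bgen : set (set Braw) :=
  [set S | (exists i (A : set R), measurable A /\ S = (fun b => bp b i) @^-1` A)
        \/ (exists j (A : set R), measurable A /\ S = (fun b => btau b j) @^-1` A)
        \/ (exists (E A : set R), measurable E /\ measurable A /\
              S = (fun b => fine (btau0 b E)) @^-1` A)].

Definition Bmeas := g_sigma_algebraType Bgen.

Section V.
Variables (q : nat) (b : Braw).

Definition bcoef (a : seq bool) (c : nat) : R :=
  let g := natoms_neg a in
  if (0 < c)%N then btau b c ^+ g * (1 - btau b c) ^+ (q - g)
  else fine (\int[btau0 b]_(x in `[0%R, 1%R]%classic)
               EFin ((x ^+ g * (1 - x) ^+ (q - g))%R)).

Definition jfac (h : seq (seq bool)) (c : seq nat) (k : nat) : R :=
  let ck := nth 0%N c k in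
  let hk := nth [::] h k in
  if (ck == 0%N) || all (fun l => nth 0%N c l != ck) (iota 0 k)
  then bp b ck * bcoef hk ck
  else if has (fun l => (nth 0%N c l == ck) && (nth [::] h l == hk)) (iota 0 k)
  then bp b ck
  else 0.

Fixpoint jrec (h : seq (seq bool)) (c : seq nat) (n : nat) : R :=
  if n is n'.+1 then jrec h c n' * jfac h c n' else 1.

Definition vsd (h : seq (seq bool)) : R :=
  fine (\esum_(c in [set c : seq nat | size c = size h]) EFin (jrec h c (size h))).

(* the unique extension of vsd to a probability function on SL_q *)
Definition vfun : fml -> R :=
  epsilon (inhabits (fun _ => 0))
    (fun v => probfun (Lq q) v /\
       forall h, wf_sd (Lq q) h -> v (sd (Lq q) h) = vsd h).

End V.
End Prob.

(* Main.v *)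
(* From right to left: given <p, tau>, the family v^{p,tau} is the law of one random
   structure for all languages at once.  Every constant draws a colour i with weight
   p_i, constants of the same colour i > 0 share an atom whose signs are negative
   with probability tau_i, and each constant of colour 0 (dust) draws its own atom.
   These laws satisfy SPx and restrict to sublanguages, hence so do
   their mixtures.

   From left to right: let X be the random table of the truth values of N^3
   predicates on N constants under the given family.  By SPx its distribution does
   not change when the atoms of the table are permuted within a fixed number of
   negations.  So, up to an error O(1/N), a class of equal constants may be read on
   its own window of fresh predicates, and w(Theta) is the expectation of the j-sum
   of Theta for the class frequencies p_i and the proportions tau_i of negations in
   the rows of X.  A monotone coupling (the Skorokhod representation, with Helly
   selection) realises these tables on [0,1[ so that along a subsequence all p_i,
   tau_i, moments sum_i p_i tau_i^a (1 - tau_i)^b and tail distribution functions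
   sum_{i > K} p_i [tau_i <= r] converge pointwise.  The mass escaping to classes of
   vanishing frequency becomes the dust parameters p_0, tau_0, and mu is the
   distribution of the limit parameters. *)

Require Import Defs.
From HB Require Import structures.
From mathcomp Require Import all_boot all_order all_algebra.
From mathcomp Require Import all_classical all_reals all_analysis.
From mathcomp Require Import measurable_realfun.
From mathcomp Require Import ring lra zify.
Set Implicit Arguments.
Unset Strict Implicit.
Unset Printing Implicit Defensive.

Import Order.TTheory GRing.Theory Num.Theory.
Import numFieldNormedType.Exports.
Local Open Scope ring_scope.
Local Open Scope classical_set_scope.

(** * Words and the semantics of sentences *)

(** What SPx offers is that different rows of a table may be moved by different column permutations,
    as long as distinct rows stay distinct. Reading each class on its own window is such a move, and
    it fails exactly when two distinct rows collide. For each of the N^2 pairs of rows a collision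
    has probability of order 1/M, where M is the number of predicates; M = N^3 makes the total
    O(1/N).

    The sigma-algebra on the parameters is only generated by their coordinates, so no limit of
    measures on that space is taken. Instead the finite tables are made to converge at every sample
    point, and the limit parameters are measurable as pointwise limits.

    In both directions a probability function is handled through its values on state descriptions,
    which determine it because existential sentences are limits of disjunctions. As [vfun] is chosen
    by epsilon, it is replaced by a concrete version [law], equal to it on B. *)

Fixpoint words (T : Type) (A : seq T) (n : nat) : seq (seq T) :=
  if n is n'.+1 then [seq x :: s | x <- A, s <- words A n'] else [:: [::]].

Section BigWords.
Variables (T : Type) (V : nmodType).
Implicit Types (A : seq T) (F : seq T -> V).

Lemma sum_words0 A F : \sum_(s <- words A 0) F s = F [::].
Proof. by rewrite big_seq1. Qed.

Lemma sum_wordsS A n F :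
  \sum_(s <- words A n.+1) F s = \sum_(x <- A) \sum_(s <- words A n) F (x :: s).
Proof. exact: big_allpairs_dep. Qed.

Lemma sum_words_cat A m n F :
  \sum_(s <- words A (m + n)) F s =
  \sum_(s <- words A m) \sum_(t <- words A n) F (s ++ t).
Proof.
elim: m F => [|m IH] F; first by rewrite sum_words0.
by rewrite addSn !sum_wordsS; apply: eq_bigr => x _; rewrite IH.
Qed.

Lemma sum_words1 A F : \sum_(s <- words A 1) F s = \sum_(x <- A) F [:: x].
Proof. by rewrite sum_wordsS; apply: eq_bigr => x _; rewrite sum_words0. Qed.

Lemma sum_words_rcons A n F :
  \sum_(s <- words A n.+1) F s =
  \sum_(s <- words A n) \sum_(x <- A) F (rcons s x).
Proof.
rewrite -addn1 sum_words_cat; apply: eq_bigr => s _.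
by rewrite sum_words1; apply: eq_bigr => x _; rewrite cats1.
Qed.

End BigWords.

Section WordsEq.
Variable T : eqType.
Implicit Types (A : seq T).

Lemma mem_words A n (s : seq T) :
  (s \in words A n) = (size s == n) && all (mem A) s.
Proof.
elim: n s => [|n IH] [|x s] //=.
  by apply/negP => /allpairsP[[y t] [_ _]].
rewrite eqSS; apply/allpairsP/idP => [[[y t] /= [yA]]|].
  by rewrite IH => /andP[/eqP<- ht] [-> ->]; rewrite eqxx yA.
move=> /andP[/eqP sn /andP[xA sA]]; exists (x, s); split => //=.
by rewrite IH sn eqxx.
Qed.

Lemma uniq_words A n : uniq A -> uniq (words A n).
Proof.
move=> uA; elim: n => [//|n IH] /=.
by apply: allpairs_uniq => // -[x s] [y t] _ _ /= [-> ->].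
Qed.

Lemma size_words A n (s : seq T) : s \in words A n -> size s = n.
Proof. by rewrite mem_words => /andP[/eqP]. Qed.

End WordsEq.

Notation bitwords := (words [:: true; false]).

Lemma mem_bitwords n (s : seq bool) : (s \in bitwords n) = (size s == n).
Proof.
by rewrite mem_words; case: eqP => //= _; apply/allP => -[] _; rewrite !inE.
Qed.

(** The semantic side of [inst_at]: de Bruijn index [d] receives [x] and larger indices shift down,
    matching the renumbering in [inst_term]. *)
Definition insert_env (D : Type) (d : nat) (x : D) (env : nat -> D) : nat -> D :=
  fun n => if (n < d)%N then env n else if n == d then x else env n.-1.

Section Semantics.
Variables (D : Type) (ci : nat -> D) (pi : nat -> D -> Prop).

Lemma insert_env0 (x : D) env : insert_env 0 x env = cons_env x env.
Proof. by apply/funext => -[|n]. Qed.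

Lemma insert_envS d (x y : D) env :
  insert_env d.+1 x (cons_env y env) = cons_env y (insert_env d x env).
Proof.
apply/funext => -[|n] //; rewrite /insert_env /= ltnS eqSS.
case: ltngtP => // dn; by case: n dn.
Qed.

Lemma sat_inst f d c env :
  sat ci pi env (inst_at d c f) <-> sat ci pi (insert_env d (ci c) env) f.
Proof.
elim: f d env => [|i t|g IH|g IHg h IHh|g IHg h IHh|g IHg h IHh|g IH|g IH] d env /=.
- by [].
- case: t => [n|e] //=; rewrite /insert_env.
  by case: ltngtP.
- by rewrite IH.
- by rewrite IHg IHh.
- by rewrite IHg IHh.
- by rewrite IHg IHh.
- by split=> -[x hx]; exists x; move: hx; rewrite IH insert_envS.
- by split=> H x; move: (H x); rewrite IH insert_envS.
Qed.

Lemma sat_inst0 f c env :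
  sat ci pi env (inst_at 0 c f) <-> sat ci pi (cons_env (ci c) env) f.
Proof. by rewrite sat_inst insert_env0. Qed.

Lemma sat_bigor f n env :
  sat ci pi env (bigor f n) <->
  exists2 c, (c <= n)%N & sat ci pi env (inst_at 0 c f).
Proof.
elim: n => [|n IH] /=.
  by split => [H|[c]]; [exists 0%N|rewrite leqn0 => /eqP ->].
rewrite IH; split=> [[[c cn H]|H]|[c]].
- by exists c => //; exact: leqW.
- by exists n.+1.
- by rewrite leq_eqVlt => /orP[/eqP -> H|cn H]; [right|left; exists c].
Qed.

Lemma sat_closed_ext f k env env' : closed_at k f ->
  (forall n, (n < k)%N -> env n = env' n) ->
  sat ci pi env f <-> sat ci pi env' f.
Proof.
elim: f k env env' => [|i t|g IH|g IHg h IHh|g IHg h IHh|g IHg h IHh|g IH|g IH]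
  k env env' //=.
- by case: t => [n|e] //= nk ->.
- by move=> cg E; rewrite (IH k env env').
- by move=> /andP[cg ch] E; rewrite (IHg k env env')// (IHh k env env').
- by move=> /andP[cg ch] E; rewrite (IHg k env env')// (IHh k env env').
- by move=> /andP[cg ch] E; rewrite (IHg k env env')// (IHh k env env').
- move=> cg E; have E' x n : (n < k.+1)%N -> cons_env x env n = cons_env x env' n.
    by case: n => //= n /E.
  by split=> -[x hx]; exists x; move: hx; rewrite (IH _ _ _ cg (E' x)).
- move=> cg E; have E' x n : (n < k.+1)%N -> cons_env x env n = cons_env x env' n.
    by case: n => //= n /E.
  by split=> H x; move: (H x); rewrite (IH _ _ _ cg (E' x)).
Qed.

Lemma sat_sentence_env f env env' : closed_at 0 f ->
  sat ci pi env f <-> sat ci pi env' f.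
Proof. by move=> cf; apply: (sat_closed_ext cf). Qed.

End Semantics.

Lemma closed_inst f d c : closed_at d.+1 f -> closed_at d (inst_at d c f).
Proof.
elim: f d => [|i t|g IH|g IHg h IHh|g IHg h IHh|g IHg h IHh|g IH|g IH] d //=.
- case: t => [n|e] //=.
  by rewrite ltnS; case: ltngtP => //= dn _.
- exact: IH.
- by move=> /andP[/IHg -> /IHh ->].
- by move=> /andP[/IHg -> /IHh ->].
- by move=> /andP[/IHg -> /IHh ->].
- exact: IH.
- exact: IH.
Qed.

Lemma preds_inst L f d c : preds_in L (inst_at d c f) = preds_in L f.
Proof. by elim: f d => //= g IHg h IHh d; rewrite IHg IHh. Qed.

Lemma sentence_inst L f c : closed_at 1 f -> preds_in L f ->
  sentence L (inst_at 0 c f).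
Proof. by move=> cf pf; rewrite /sentence closed_inst// preds_inst. Qed.

Lemma sentence_bigor L f n : closed_at 1 f -> preds_in L f ->
  sentence L (bigor f n).
Proof.
move=> cf pf; elim: n => [|n] /=; first exact: sentence_inst.
rewrite /sentence /= => /andP[-> ->] /=.
by rewrite closed_inst// preds_inst.
Qed.

Lemma sentence_neg L f : sentence L (FNeg f) = sentence L f.
Proof. by []. Qed.

Lemma sentence_and L f g : sentence L (FAnd f g) = sentence L f && sentence L g.
Proof. by rewrite /sentence /= andbACA. Qed.

Lemma sentence_or L f g : sentence L (FOr f g) = sentence L f && sentence L g.
Proof. by rewrite /sentence /= andbACA. Qed.

Lemma sentence_imp L f g : sentence L (FImp f g) = sentence L f && sentence L g.
Proof. by rewrite /sentence /= andbACA. Qed.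

Lemma sentence_sub (L L' : seq nat) f : {subset L <= L'} ->
  sentence L f -> sentence L' f.
Proof.
move=> LL' /andP[cf pf]; rewrite /sentence cf /=.
elim: f pf {cf} => //= [i t|g IHg h IHh|g IHg h IHh|g IHg h IHh];
  first exact: LL'.
all: by move=> /andP[/IHg -> /IHh ->].
Qed.

Definition literal (i : nat) (b : bool) (c : nat) : fml :=
  if b then FPred i (TConst c) else FNeg (FPred i (TConst c)).

(** [atom_form] over an arbitrary list of predicates, so that inductions can run along that list
    instead of the fixed [undup L]. *)
Definition conj_at (us : seq nat) (a : seq bool) (c : nat) : fml :=
  foldr FAnd FTop [seq literal ib.1 ib.2 c | ib <- zip us a].

Lemma atom_formE L a c : atom_form L a c = conj_at (undup L) a c.
Proof. by []. Qed.

Definition iff_bool (P : Prop) (b : bool) : Prop := if b then P else ~ P.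

Lemma iff_boolE (P : Prop) (b : bool) : iff_bool P b <-> (P <-> b).
Proof. by case: b => /=; intuition. Qed.

Lemma sat_literal (D : Type) (ci : nat -> D) pi env i b c :
  sat ci pi env (literal i b c) <-> (pi i (ci c) <-> b).
Proof. by rewrite -iff_boolE; case: b. Qed.

Lemma sat_conj_at (D : Type) (ci : nat -> D) pi env us a c :
  size a = size us ->
  sat ci pi env (conj_at us a c) <->
  forall j, (j < size us)%N -> (pi (nth 0%N us j) (ci c) <-> nth false a j).
Proof.
elim: us a => [|i us IH] [|b a] //= [sa].
rewrite -/(conj_at us a c) sat_literal (IH _ sa); split.
  by move=> [H0 H] [|j] //; exact: H.
by move=> H; split; [exact: (H 0%N)|move=> j js; exact: (H j.+1)].
Qed.

Lemma sat_atom_form (D : Type) (ci : nat -> D) pi env L a c :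
  size a = size (undup L) ->
  sat ci pi env (atom_form L a c) <->
  forall i, i \in L -> (pi i (ci c) <-> nth false a (index i (undup L))).
Proof.
move=> sa; rewrite atom_formE sat_conj_at//; split => [H i iL|H j js].
  have iu : i \in undup L by rewrite mem_undup.
  by have := H _ (etrans (index_mem _ _) iu); rewrite nth_index.
have := H (nth 0%N (undup L) j); rewrite index_uniq ?undup_uniq//; apply.
by rewrite -mem_undup mem_nth.
Qed.

Definition table_pred (L : seq nat) (h : seq (seq bool)) (i c : nat) : bool :=
  nth false (nth [::] h c) (index i (undup L)).

Lemma sat_sd_atoms (D : Type) (ci : nat -> D) pi env L h :
  sat ci pi env (sd L h) <->
  forall c, (c < size h)%N -> sat ci pi env (atom_form L (nth [::] h c) c).
Proof.
rewrite /sd; have -> : (forall c, (c < size h)%N ->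
    sat ci pi env (atom_form L (nth [::] h c) c)) <->
    (forall c, c \in iota 0 (size h) ->
    sat ci pi env (atom_form L (nth [::] h c) c)).
  by split=> H c; have := H c; rewrite mem_iota add0n.
elim: (iota 0 _) => [|c s IH] /=; first by split.
rewrite IH; split=> [[H0 H] k|H].
  by rewrite inE => /orP[/eqP ->|/H].
by split; [apply: H; rewrite mem_head|move=> k ks; apply: H; rewrite inE ks orbT].
Qed.

Lemma sat_sd (D : Type) (ci : nat -> D) pi env L h : wf_sd L h ->
  sat ci pi env (sd L h) <->
  forall c i, (c < size h)%N -> i \in L -> (pi i (ci c) <-> table_pred L h i c).
Proof.
move=> wf; rewrite sat_sd_atoms; split=> H c.
  move=> i ch iL; have /H := ch; rewrite sat_atom_form; first exact.
  by apply/eqP/(allP wf)/mem_nth.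
move=> ch; rewrite sat_atom_form; last by apply/eqP/(allP wf)/mem_nth.
by move=> i; exact: H.
Qed.

Lemma sentence_literal L i b c : i \in L -> sentence L (literal i b c).
Proof. by case: b => iL; rewrite /sentence /= iL. Qed.

Lemma sentence_conj_at L us a c : all (mem L) us -> sentence L (conj_at us a c).
Proof.
elim: us a => [|i us IH] [|b a] //= /andP[iL usL].
rewrite /conj_at /= -/(conj_at us a c) sentence_and IH// andbT.
exact: sentence_literal.
Qed.

Lemma sentence_atom_form L a c : sentence L (atom_form L a c).
Proof. by apply: sentence_conj_at; apply/allP => i; rewrite mem_undup. Qed.

Lemma sentence_sd L h : sentence L (sd L h).
Proof.
rewrite /sd; elim: (iota 0 _) => [|c s IH] //=.
by rewrite sentence_and IH sentence_atom_form.
Qed.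

Fixpoint qfree (f : fml) : bool :=
  match f with
  | FTop | FPred _ _ => true
  | FNeg g => qfree g
  | FAnd g h | FOr g h | FImp g h => qfree g && qfree h
  | FEx _ | FAll _ => false
  end.

Fixpoint const_bound (f : fml) : nat :=
  match f with
  | FTop => 0
  | FPred _ t => if t is TConst c then c.+1 else 0
  | FNeg g | FEx g | FAll g => const_bound g
  | FAnd g h | FOr g h | FImp g h => maxn (const_bound g) (const_bound h)
  end.

(** The two structures may have different domains: an arbitrary model of a state description can
    thus be exchanged for the table itself, read as a structure on [nat]. *)
Lemma sat_qfree (D D' : Type) (ci : nat -> D) pi env
    (ci' : nat -> D') pi' env' L n f :
  qfree f -> sentence L f -> (const_bound f <= n)%N ->
  (forall c i, (c < n)%N -> i \in L -> (pi i (ci c) <-> pi' i (ci' c))) ->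
  sat ci pi env f <-> sat ci' pi' env' f.
Proof.
move=> qf sf cf E.
elim: f qf sf cf => [|i t|g IH|g IHg h IHh|g IHg h IHh|g IHg h IHh|g IH|g IH] //=.
- case: t => [//|c]; rewrite /sentence /= => _ iL cn; exact: E.
- by move=> qf sf cf; rewrite IH.
- move=> /andP[qg qh]; rewrite sentence_and geq_max => /andP[sg sh] /andP[cg ch].
  by rewrite IHg// IHh.
- move=> /andP[qg qh]; rewrite sentence_or geq_max => /andP[sg sh] /andP[cg ch].
  by rewrite IHg// IHh.
- move=> /andP[qg qh]; rewrite sentence_imp geq_max => /andP[sg sh] /andP[cg ch].
  by rewrite IHg// IHh.
Qed.

Lemma qfree_conj_at us a c : qfree (conj_at us a c).
Proof. by elim: us a => [|i us IH] [|[] a] //=; exact: IH. Qed.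

Lemma qfree_sd L h : qfree (sd L h).
Proof. by rewrite /sd; elim: (iota 0 _) => //= c s ->; rewrite qfree_conj_at. Qed.

Lemma const_bound_conj_at us a c : (const_bound (conj_at us a c) <= c.+1)%N.
Proof.
elim: us a => [|i us IH] [|b a] //=; rewrite geq_max IH andbT.
by case: b => /=.
Qed.

Lemma const_bound_sd L h : (const_bound (sd L h) <= size h)%N.
Proof.
rewrite /sd; have : {subset iota 0 (size h) <= gtn (size h)}.
  by move=> c; rewrite mem_iota add0n.
elim: (iota 0 _) => //= c s IH H; rewrite geq_max IH ?andbT.
  apply: leq_trans (const_bound_conj_at _ _ _) _.
  by apply: (H c); rewrite mem_head.
by move=> k ks; apply: H; rewrite inE ks orbT.
Qed.

(** * Probability functions are determined by state descriptions *)

Section ProbFun.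
Variables (R : realType) (L : seq nat) (w : fml -> R).
Hypothesis hw : probfun L w.

Lemma probfun_ge0 f : sentence L f -> 0 <= w f.
Proof. by case: hw => H _ _ _ /H /andP[]. Qed.

Lemma probfun_neg f : sentence L f -> w (FNeg f) = 1 - w f.
Proof.
case: hw => _ val add _ sf.
have <- : w (FOr f (FNeg f)) = 1.
  by apply: val => [|D ci pi env /=]; [rewrite sentence_or sf|exact: EM].
by rewrite add//; [ring|move=> D ci pi env /=; tauto].
Qed.

Lemma probfun_equiv f g : sentence L f -> sentence L g ->
  (forall (D : Type) (ci : nat -> D) pi env, sat ci pi env f <-> sat ci pi env g) ->
  w f = w g.
Proof.
case: (hw) => _ val add _ sf sg E.
have : w (FOr f (FNeg g)) = 1.
  apply: val => [|D ci pi env /=]; first by rewrite sentence_or sf.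
  by rewrite E; exact: EM.
rewrite add//; first by rewrite probfun_neg//; lra.
by move=> D ci pi env /=; rewrite E; tauto.
Qed.

Lemma probfun_split f g : sentence L f -> sentence L g ->
  w f = w (FAnd f g) + w (FAnd f (FNeg g)).
Proof.
case: (hw) => _ _ add _ sf sg.
have sfg : sentence L (FAnd f g) by rewrite sentence_and sf.
have sfng : sentence L (FAnd f (FNeg g)) by rewrite sentence_and sf.
rewrite -add// => [|D ci pi env /=]; last by tauto.
apply: probfun_equiv => //; first by rewrite sentence_or sfg.
by move=> D ci pi env /=; case: (EM (sat ci pi env g)); tauto.
Qed.

Lemma probfun_mono f g : sentence L f -> sentence L g -> entails f g -> w f <= w g.
Proof.
move=> sf sg E; rewrite (probfun_split sg sf) (_ : w f = w (FAnd g f)).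
  by rewrite lerDl; apply: probfun_ge0; rewrite sentence_and sg.
apply: probfun_equiv => //; first by rewrite sentence_and sg.
by move=> D ci pi env /=; have := E D ci pi env; tauto.
Qed.

Lemma probfun_entails_or f g h : sentence L f -> sentence L g -> sentence L h ->
  entails f (FOr g h) -> w f <= w g + w h.
Proof.
move=> sf sg sh E.
have sfng : sentence L (FAnd f (FNeg g)) by rewrite sentence_and sf.
rewrite (probfun_split sf sg) lerD//; apply: probfun_mono => //.
- by move=> D ci pi env [].
- by move=> D ci pi env /= [/E[]].
Qed.

Lemma probfun_contra f : sentence L f -> entails f (FNeg f) -> w f = 0.
Proof.
case: (hw) => _ val _ _ sf E.
have : w (FNeg f) = 1 by apply: val => // D ci pi env /= H; exact: (E _ _ _ _ H).
by rewrite probfun_neg//; lra.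
Qed.

Lemma probfun_conj_at f us c : sentence L f -> all (mem L) us ->
  w f = \sum_(a <- bitwords (size us)) w (FAnd f (conj_at us a c)).
Proof.
elim: us f => [|i us IH] f sf.
  move=> _; rewrite sum_words0; apply: probfun_equiv => //.
    by rewrite sentence_and sf.
  by move=> D ci pi env; rewrite /conj_at /=; tauto.
move=> /andP[iL usL]; rewrite sum_wordsS.
have iusL : all (mem L) (i :: us) by apply/andP.
have sl b : sentence L (FAnd f (literal i b c)).
  by rewrite sentence_and sf sentence_literal.
have eq1 b a : w (FAnd (FAnd f (literal i b c)) (conj_at us a c)) =
    w (FAnd f (conj_at (i :: us) (b :: a) c)).
  apply: probfun_equiv => [||D ci pi env /=].
  - by rewrite sentence_and sl sentence_conj_at.
  - by rewrite sentence_and sf; exact: sentence_conj_at.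
  - by rewrite /conj_at /=; tauto.
rewrite !big_cons big_nil addr0.
rewrite (probfun_split sf (sentence_literal true c iL)); congr (_ + _).
  by rewrite (IH _ (sl true) usL); apply: eq_bigr => a _.
have -> : w (FAnd f (FNeg (literal i true c))) = w (FAnd f (literal i false c)).
  by [].
by rewrite (IH _ (sl false) usL); apply: eq_bigr => a _.
Qed.

Notation atoms := (bitwords (size (undup L))).

Lemma probfun_tables f n : sentence L f ->
  w f = \sum_(h <- words atoms n) w (FAnd f (sd L h)).
Proof.
elim: n => [|n IH] sf.
  rewrite sum_words0; apply: probfun_equiv => //.
    by rewrite sentence_and sf sentence_sd.
  by move=> D ci pi env /=; tauto.
rewrite sum_words_rcons IH//.
rewrite [LHS]big_seq_cond [RHS]big_seq_cond; apply: eq_bigr => h.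
rewrite andbT => /size_words sh.
have sfh : sentence L (FAnd f (sd L h)) by rewrite sentence_and sf sentence_sd.
rewrite (probfun_conj_at n sfh (us := undup L)); last first.
  by apply/allP => i; rewrite mem_undup.
apply: eq_bigr => a _; apply: probfun_equiv.
- by rewrite sentence_and sfh sentence_atom_form.
- by rewrite sentence_and sf sentence_sd.
move=> D ci pi env /=; rewrite !sat_sd_atoms size_rcons sh -atom_formE.
split=> [[[Hf H] Ha]|[Hf H]].
  split=> // c; rewrite ltnS leq_eqVlt => /orP[/eqP ->|cn].
    by rewrite -[X in nth _ _ X]sh nth_rcons ltnn eqxx.
  by rewrite nth_rcons sh cn; exact: H.
split; first (split=> // c cn).
  by have := H c (leqW cn); rewrite nth_rcons sh cn.
by have := H n (ltnSn n); rewrite nth_rcons sh ltnn eqxx.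
Qed.

(** The table is completed to a structure on [nat] in which later constants satisfy no predicate.
    Quantifier-free sentences about the constants of the table do not see this default. *)
Definition table_sat (h : seq (seq bool)) (f : fml) : bool :=
  `[< sat id (fun i c => table_pred L h i c) (fun=> 0%N) f >].

Lemma words_wf_sd h n : h \in words atoms n -> wf_sd L h.
Proof.
rewrite mem_words => /andP[_ /allP H]; apply/allP => a /H.
by rewrite inE mem_bitwords.
Qed.

(** A state description of all constants below the bound decides [f], so each term of the total
    probability formula is either [w (sd L h)] or 0. *)
Lemma probfun_qfree f n : qfree f -> sentence L f -> (const_bound f <= n)%N ->
  w f = \sum_(h <- words atoms n | table_sat h f) w (sd L h).
Proof.
move=> qf sf cf; rewrite (probfun_tables n sf) [RHS]big_mkcond /=.
rewrite [LHS]big_seq_cond [RHS]big_seq_cond; apply: eq_bigr => h.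
rewrite andbT => hw'; have wfh := words_wf_sd hw'.
have sh := size_words hw'.
have sfh : sentence L (FAnd f (sd L h)) by rewrite sentence_and sf sentence_sd.
have dec (D : Type) (ci : nat -> D) pi env : sat ci pi env (sd L h) ->
    sat ci pi env f <-> table_sat h f.
  rewrite sat_sd// sh => H.
  rewrite (@sat_qfree D nat ci pi env id (fun i c => table_pred L h i c)
    (fun=> 0%N) L n f qf sf cf H).
  by split=> /asboolP.
case: ifPn => ht.
  apply: probfun_equiv (sentence_sd _ _) _ => // D ci pi env /=.
  by split=> [[]//|H]; split=> //; exact/(dec _ _ _ _ H).
apply: probfun_contra => //.
by move=> D ci pi env /= [Hf /dec]; rewrite (negbTE ht) => -[/(_ Hf)].
Qed.

Lemma probfun_sum_sd n : \sum_(h <- words atoms n) w (sd L h) = 1.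
Proof.
have <- : w FTop = 1 by case: hw => _ val _ _; apply: val.
rewrite (probfun_qfree (f := FTop) (n := n))//=.
by apply: eq_bigl => h; apply/esym/asboolP.
Qed.

Definition fxor f g := FOr (FAnd f (FNeg g)) (FAnd g (FNeg f)).

Lemma sentence_xor f g : sentence L f -> sentence L g -> sentence L (fxor f g).
Proof. by move=> sf sg; rewrite sentence_or !sentence_and !sentence_neg sf sg. Qed.

Lemma probfun_xor f g : sentence L f -> sentence L g ->
  `|w f - w g| <= w (fxor f g).
Proof.
move=> sf sg; have sx := sentence_xor sf sg.
rewrite ler_distl; apply/andP; split.
  suff: w g <= w f + w (fxor f g) by lra.
  by apply: probfun_entails_or => // D ci pi env /=; tauto.
by apply: probfun_entails_or => // D ci pi env /=; tauto.
Qed.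

End ProbFun.

(** Quantifiers count twice because a universal formula is treated as the negation of an existential
    one: the instances of [FNeg g] must still be smaller than [FAll g]. *)
Fixpoint fsize (f : fml) : nat :=
  match f with
  | FTop | FPred _ _ => 0
  | FNeg g => (fsize g).+1
  | FEx g | FAll g => (fsize g).+2
  | FAnd g h | FOr g h | FImp g h => (fsize g + fsize h).+1
  end.

Lemma fsize_inst f d c : fsize (inst_at d c f) = fsize f.
Proof. by elim: f d => //= [g IH|g IHg h IHh|g IHg h IHh|g IHg h IHh|g IH|g IH] d;
  rewrite ?IH ?IHg ?IHh. Qed.

Section Uniqueness.
Variables (R : realType) (L : seq nat) (w w' : fml -> R).
Hypotheses (hw : probfun L w) (hw' : probfun L w').

(** The symmetric difference is measured by both functions at once, so that a single quantifier-free
    approximation is good for [w] and for [w']. *)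
Let xdist f g := w (fxor f g) + w' (fxor f g).

Let xdist_or f f1 f2 g g1 g2 :
  sentence L f -> sentence L f1 -> sentence L f2 ->
  sentence L g -> sentence L g1 -> sentence L g2 ->
  entails (fxor f g) (FOr (fxor f1 g1) (fxor f2 g2)) ->
  xdist f g <= xdist f1 g1 + xdist f2 g2.
Proof.
move=> *; rewrite /xdist addrACA lerD//.
  by apply: (probfun_entails_or hw); rewrite ?sentence_xor.
by apply: (probfun_entails_or hw'); rewrite ?sentence_xor.
Qed.

Let xdist_le f f1 g g1 :
  sentence L f -> sentence L f1 -> sentence L g -> sentence L g1 ->
  entails (fxor f g) (fxor f1 g1) -> xdist f g <= xdist f1 g1.
Proof.
move=> *; rewrite /xdist lerD//.
  by apply: (probfun_mono hw); rewrite ?sentence_xor.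
by apply: (probfun_mono hw'); rewrite ?sentence_xor.
Qed.

Let approximable f := forall e, 0 < e ->
  exists g, [/\ qfree g, sentence L g & xdist f g < e].

Let xdist0 f : sentence L f -> xdist f f = 0.
Proof.
move=> sf; rewrite /xdist (probfun_contra hw) ?(probfun_contra hw') ?addr0//.
all: by rewrite ?sentence_xor//; move=> D ci pi env /=; tauto.
Qed.

Let approximable_qfree f : sentence L f -> qfree f -> approximable f.
Proof. by move=> sf qf e e0; exists f; rewrite xdist0. Qed.

Let approximable_neg f : sentence L f -> approximable f -> approximable (FNeg f).
Proof.
move=> sf H e /H[g [qg sg lt]]; exists (FNeg g); split => //.
by apply: le_lt_trans lt; apply: xdist_le => // D ci pi env /=; tauto.
Qed.

Let approximable2 (op : fml -> fml -> fml) f g :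
  (forall f g, sentence L (op f g) = sentence L f && sentence L g) ->
  (forall f g, qfree (op f g) = qfree f && qfree g) ->
  (forall f g f' g', entails (fxor (op f g) (op f' g'))
     (FOr (fxor f f') (fxor g g'))) ->
  sentence L f -> sentence L g ->
  approximable f -> approximable g -> approximable (op f g).
Proof.
move=> sop qop xop sf sg Hf Hg e e0.
have [f' [qf' sf' lf']] : exists f', [/\ qfree f', sentence L f' & xdist f f' < e / 2].
  by apply: Hf; lra.
have [g' [qg' sg' lg']] : exists g', [/\ qfree g', sentence L g' & xdist g g' < e / 2].
  by apply: Hg; lra.
exists (op f' g'); rewrite qop qf' qg' sop sf' sg'; split => //.
have := @xdist_or (op f g) f g (op f' g') f' g'; rewrite !sop sf sg sf' sg'.
by move=> /(_ isT isT isT isT isT isT (xop _ _ _ _)); lra.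
Qed.

Let approximable_trans f : sentence L f ->
  (forall e, 0 < e -> exists g, [/\ sentence L g, approximable g & xdist f g < e]) ->
  approximable f.
Proof.
move=> sf H e e0; have [g [sg Hg lg]] : exists g,
    [/\ sentence L g, approximable g & xdist f g < e / 2] by apply: H; lra.
have [g' [qg' sg' lg']] : exists g', [/\ qfree g', sentence L g' & xdist g g' < e / 2].
  by apply: Hg; lra.
exists g'; split => //.
have := @xdist_or f f g g' g g'; rewrite sf sg sg'.
suff E : entails (fxor f g') (FOr (fxor f g) (fxor g g')).
  by move=> /(_ isT isT isT isT isT isT E); lra.
by move=> D ci pi env /=; have := EM (sat ci pi env g); tauto.
Qed.

(** By the limit axiom [FEx f] is close to a finite disjunction of its instances; one length of the
    disjunction serves both functions, since each limit is reached from some index on. *)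
Let approximable_ex f : closed_at 1 f -> preds_in L f ->
  (forall c, approximable (inst_at 0 c f)) -> approximable (FEx f).
Proof.
move=> cf pf Hi; have sE : sentence L (FEx f) by rewrite /sentence /= cf.
have sb n : sentence L (bigor f n) by exact: sentence_bigor.
have Hb n : approximable (bigor f n).
  elim: n => [|n IH] /=; first exact: Hi.
  apply: (@approximable2 FOr) => //; rewrite ?sentence_inst//.
  - by move=> ? ?; exact: sentence_or.
  - by move=> ? ? ? ? D ci pi env /=; tauto.
have wE v n : probfun L v -> v (fxor (FEx f) (bigor f n)) = v (FEx f) - v (bigor f n).
  move=> hv; rewrite (probfun_split hv sE (sb n)).
  have imp D (ci : nat -> D) pi env : sat ci pi env (bigor f n) ->
      sat ci pi env (FEx f).
    by rewrite sat_bigor => -[c _]; rewrite sat_inst0 /= => H; exists (ci c).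
  have -> : v (FAnd (FEx f) (bigor f n)) = v (bigor f n).
    apply: (probfun_equiv hv) => //; first by rewrite sentence_and sE sb.
    by move=> D ci pi env /=; have := imp D ci pi env => /=; tauto.
  have -> : v (fxor (FEx f) (bigor f n)) = v (FAnd (FEx f) (FNeg (bigor f n))).
    apply: (probfun_equiv hv); rewrite ?sentence_xor// ?sentence_and ?sentence_neg ?sE ?sb//.
    by move=> D ci pi env /=; have := imp D ci pi env => /=; tauto.
  ring.
apply: approximable_trans => // e e0.
have cvg v : probfun L v -> \forall n \near \oo, `|v (FEx f) - v (bigor f n)| < e / 2.
  by move=> [_ _ _ /(_ _ cf pf)] /cvgrPdist_lt; apply; lra.
have [n /= _ Hn] := filterI (cvg _ hw) (cvg _ hw').
have [d1 d2] := Hn n (leqnn n).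
exists (bigor f n); split => //; rewrite /xdist !wE//.
by move: d1 d2; rewrite !ltr_norml; lra.
Qed.

Let approximable_sentence f : sentence L f -> approximable f.
Proof.
have [n] := ubnP (fsize f); elim: n f => // n IH
  [|i t|g|g h|g h|g h|g|g] /= szf sf.
- exact: approximable_qfree.
- exact: approximable_qfree.
- by apply: approximable_neg => //; apply: IH => //; lia.
- move: sf; rewrite sentence_and => /andP[sg sh].
  apply: (@approximable2 FAnd) => //; try by apply: IH => //; lia.
  + by move=> ? ?; exact: sentence_and.
  + by move=> ? ? ? ? D ci pi env /=; tauto.
- move: sf; rewrite sentence_or => /andP[sg sh].
  apply: (@approximable2 FOr) => //; try by apply: IH => //; lia.
  + by move=> ? ?; exact: sentence_or.
  + by move=> ? ? ? ? D ci pi env /=; tauto.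
- move: sf; rewrite sentence_imp => /andP[sg sh].
  apply: (@approximable2 FImp) => //; try by apply: IH => //; lia.
  + by move=> ? ?; exact: sentence_imp.
  + move=> a b c d D ci pi env /=.
    by have := EM (sat ci pi env a); have := EM (sat ci pi env c); tauto.
- have /andP[cg pg] := sf; apply: approximable_ex => // c; apply: IH.
    by rewrite fsize_inst; lia.
  exact: sentence_inst.
- have /andP[cg pg] := sf.
  have sE : sentence L (FEx (FNeg g)) by [].
  (* Universal sentences are reached classically through the existential case. *)
  have H : approximable (FNeg (FEx (FNeg g))).
    apply: approximable_neg => //; apply: approximable_ex => // c.
    apply: IH; last exact: sentence_inst.
    by rewrite fsize_inst /=; lia.
  apply: approximable_trans => // e e0; exists (FNeg (FEx (FNeg g))); split => //.
  apply: le_lt_trans e0; rewrite -(xdist0 sf); apply: xdist_le => //.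
  move=> D ci pi env /= [[H1 H2]|[H1 H2]]; exfalso.
    by apply: H2 => -[d]; apply; exact: H1.
  by apply: H2 => d; case: (EM (sat ci pi (cons_env d env) g)) => // Hd;
    exfalso; apply: H1; exists d.
Qed.

(** Replacing [f] by a quantifier-free [g] moves both functions by less than [e], and on [g] they
    agree as sums over the same state descriptions. *)
Lemma probfun_unique :
  (forall h, wf_sd L h -> w (sd L h) = w' (sd L h)) ->
  forall f, sentence L f -> w f = w' f.
Proof.
move=> E f sf; apply/eqP; rewrite -subr_eq0 -normr_le0.
apply/ler_addgt0Pr => e e0; rewrite add0r.
have [g [qg sg lg]] := approximable_sentence sf e0.
have wg : w g = w' g.
  rewrite (probfun_qfree hw qg sg (leqnn _)) (probfun_qfree hw' qg sg (leqnn _)).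
  rewrite [LHS]big_seq_cond [RHS]big_seq_cond; apply: eq_bigr => h /andP[hn _].
  exact/E/(words_wf_sd hn).
have := probfun_xor hw sf sg; have := probfun_xor hw' sf sg.
move: lg; rewrite /xdist wg !ler_norml; lra.
Qed.

End Uniqueness.

(** * Random structures *)

Section RandomStructure.
Context d (T : measurableType d) (R : realType) (P : probability T R).
Variable S : T -> nat -> nat -> bool.
Hypothesis mS : forall i c, measurable [set t | S t i c].

(** The domain is [nat] and every constant denotes itself, so each element is named. This is why an
    existential sentence is the increasing union of the disjunctions [bigor]. *)
Definition models (f : fml) : set T :=
  [set t | sat id (fun i c => S t i c) (fun=> 0%N) f].

Lemma measurable_sat f env : measurable [set t | sat id (fun i c => S t i c) env f].
Proof.
elim: f env => [|i t|g IH|g IHg h IHh|g IHg h IHh|g IHg h IHh|g IH|g IH] env /=.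
- by rewrite (_ : mkset _ = setT)//; apply/seteqP; split.
- exact: mS.
- exact: measurableC (IH env).
- exact: measurableI (IHg env) (IHh env).
- exact: measurableU (IHg env) (IHh env).
- rewrite (_ : mkset _ = ~` [set t | sat id (fun i c => S t i c) env g] `|`
    [set t | sat id (fun i c => S t i c) env h]).
    exact: measurableU (measurableC (IHg env)) (IHh env).
  apply/seteqP; split=> t /=; last by move=> [].
  by move=> H; have [/H|] := EM (sat id (fun i c => S t i c) env g); [right|left].
- rewrite (_ : mkset _ = \bigcup_n [set t | sat id (fun i c => S t i c) (cons_env n env) g]).
    exact: bigcup_measurable.
  by apply/seteqP; split=> [t [n ?]|t [n _ ?]]; exists n.
- rewrite (_ : mkset _ = \bigcap_n [set t | sat id (fun i c => S t i c) (cons_env n env) g]).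
    exact: bigcap_measurable.
  by apply/seteqP; split=> t /= Ht n; [move=> _|]; exact: Ht.
Qed.

Lemma measurable_models f : measurable (models f).
Proof. exact: measurable_sat. Qed.

Definition prob_of (f : fml) : R := fine (P (models f)).

Lemma prob_ofE f : (prob_of f)%:E = P (models f).
Proof. by rewrite fineK// fin_num_measure//; exact: measurable_models. Qed.

Lemma random_probfun L : probfun L prob_of.
Proof.
split.
- move=> f _; rewrite -!lee_fin prob_ofE measure_ge0 probability_le1//.
  exact: measurable_models.
- move=> f _ vf; rewrite /prob_of (_ : models f = setT) ?probability_setT//.
  by apply/seteqP; split=> // t _; exact: vf.
- move=> f g _ _ E; apply/eqP; rewrite -eqe EFinD !prob_ofE; apply/eqP.
  rewrite -measureU//; try exact: measurable_models.
  by apply/seteqP; split=> // t /= [/E].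
move=> f cf _; have -> : prob_of (FEx f) = fine (P (\bigcup_n models (bigor f n))).
  rewrite /prob_of; congr (fine (P _)); apply/seteqP; split=> t.
    move=> [c Hc]; exists c => //; rewrite /models /= sat_bigor; exists c => //.
    by rewrite sat_inst0.
  by move=> [n _]; rewrite /models /= sat_bigor => -[c _]; rewrite sat_inst0; exists c.
apply: fine_cvg; rewrite fineK; last first.
  rewrite fin_num_measure//; apply: bigcup_measurable => n _.
  exact: measurable_models.
apply: nondecreasing_cvg_mu.
- by move=> n; exact: measurable_models.
- by apply: bigcup_measurable => n _; exact: measurable_models.
- move=> m n mn; apply/subsetPset => t; rewrite /models /= !sat_bigor => -[c cm ?].
  by exists c => //; exact: leq_trans mn.
Qed.

End RandomStructure.

(** * The uniform distribution on [0, 1[ as a probability measure on the line *)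

Section Unif.
Variable R : realType.

Let mI : measurable (`[0, 1[%classic : set (measurableTypeR R)) := measurable_itv _.

Definition unif : set R -> \bar R := fun A => lebesgue_measure (A `&` `[0, 1[).

Let unif0 : unif set0 = 0%E.
Proof. exact: (measure0 (mrestr (@lebesgue_measure R) mI)). Qed.

Let unif_ge0 A : (0 <= unif A)%E.
Proof. exact: (measure_ge0 (mrestr (@lebesgue_measure R) mI)). Qed.

Let unif_sigma_additive : semi_sigma_additive unif.
Proof. exact: (@measure_semi_sigma_additive _ _ _ (mrestr (@lebesgue_measure R) mI)). Qed.

HB.instance Definition _ := isMeasure.Build _ _ _ unif
  unif0 unif_ge0 unif_sigma_additive.

Let unif_setT : unif setT = 1%E.
Proof.
by rewrite /unif setTI lebesgue_measure_itv/= lte_fin ltr01 oppr0 adde0.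
Qed.

HB.instance Definition _ := @Measure_isProbability.Build _ _ R unif unif_setT.

Lemma unif_itv (a b : R) : 0 <= a -> a <= b -> b <= 1 ->
  unif `[a, b[%classic = (b - a)%:E.
Proof.
move=> a0 ab b1; rewrite /unif.
rewrite (_ : _ `&` _ = `[a, b[%classic).
  rewrite lebesgue_measure_itv/= lte_fin.
  by move: ab; rewrite le_eqVlt => /orP[/eqP ->|->//]; rewrite ltxx subrr.
apply/seteqP; split=> x /=; rewrite !in_itv/=; first by case.
move=> /andP[ax xb]; split.
  by apply/andP.
by apply/andP; split; [exact: le_trans ax|exact: lt_le_trans b1].
Qed.

Lemma unif_ext (A B : set R) : (forall x, 0 <= x < 1 -> A x <-> B x) -> unif A = unif B.
Proof.
move=> AB; rewrite /unif; congr (lebesgue_measure _).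
by apply/seteqP; split=> x /= [Ax /[dup]]; rewrite in_itv/= => /AB ABx x01;
  split=> //; exact/ABx.
Qed.

End Unif.

(** * Consistent word weights on the unit interval *)

Lemma nil_words (T : eqType) (A : seq T) n : ([::] \in words A n.+1) = false.
Proof. by rewrite mem_words. Qed.

Lemma rcons_words (T : eqType) (A : seq T) n h a :
  (rcons h a \in words A n.+1) = (h \in words A n) && (a \in A).
Proof. by rewrite !mem_words size_rcons eqSS all_rcons; case: (_ == n); rewrite //= andbC. Qed.

Lemma split_interval (R : realType) (E : Type) (A : seq E) (F : E -> R) (x u : R) :
  x <= u < x + \sum_(a <- A) F a ->
  exists A1 a A2, A = A1 ++ a :: A2 /\
    x + \sum_(b <- A1) F b <= u < x + \sum_(b <- A1) F b + F a.
Proof.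
elim: A x => [|a A IH] x.
  by rewrite big_nil addr0 => /andP[/le_lt_trans H /H]; rewrite ltxx.
rewrite big_cons addrA => /andP[xu ux].
have [lt|ge] := ltP u (x + F a).
  by exists [::], a, A; rewrite big_nil addr0 xu.
have [|A1 [b [A2 [-> H]]]] := IH (x + F a); first by rewrite ge.
by exists (a :: A1), b, A2; rewrite big_cons addrA.
Qed.

(* The unit interval is cut into consecutive cells, one for each word of
   length n, so that a uniform point of it draws a random sequence of letters
   with prescribed word probabilities m. *)
Section Tree.
Context d (T : measurableType d) (R : realType) (Q : nat).
Variable m : T -> seq (seq bool) -> R.
Notation A := (bitwords Q).
Hypothesis m_meas : forall h, measurable_fun setT (m ^~ h).
Hypothesis m_ge0 : forall t h, 0 <= m t h.
Hypothesis m_nil : forall t, m t [::] = 1.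
Hypothesis m_rcons : forall t n h, h \in words A n ->
  m t h = \sum_(a <- A) m t (rcons h a).

(** Offset of the cell of [p ++ h] inside the cell of [p]: at each letter, the mass of the siblings
    listed before it. *)
Fixpoint cell_lo_from (t : T) (p h : seq (seq bool)) : R :=
  if h is a :: h' then
    \sum_(b <- take (index a A) A) m t (rcons p b) + cell_lo_from t (rcons p a) h'
  else 0.

Definition cell_lo t h := cell_lo_from t [::] h.

Definition in_cell h (tu : T * R) : bool :=
  cell_lo tu.1 h <= tu.2 < cell_lo tu.1 h + m tu.1 h.

Lemma cell_lo_rcons t h a :
  cell_lo t (rcons h a) =
  cell_lo t h + \sum_(b <- take (index a A) A) m t (rcons h b).
Proof.
suff H p : cell_lo_from t p (rcons h a) = cell_lo_from t p h +
    \sum_(b <- take (index a A) A) m t (rcons (p ++ h) b) by exact: H.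
elim: h p => [|c h IH] p /=; first by rewrite cats0 addr0 add0r.
by rewrite IH addrA cat_rcons.
Qed.

Let uA : uniq A. Proof. exact: uniq_words. Qed.

Lemma in_cell_rcons n h a t u : h \in words A n -> a \in A ->
  in_cell (rcons h a) (t, u) -> in_cell h (t, u).
Proof.
move=> hn aA /andP[/= lo hi]; apply/andP => /=; split.
  apply: le_trans lo; rewrite cell_lo_rcons lerDl.
  by apply: sumr_ge0 => b _; exact: m_ge0.
apply: lt_le_trans hi _; rewrite cell_lo_rcons (m_rcons _ hn) -addrA lerD2l.
rewrite -[in X in _ <= X](cat_take_drop (index a A) A) big_cat /= lerD2l.
rewrite (drop_nth [::]) ?index_mem// nth_index// big_cons lerDl.
by apply: sumr_ge0 => b _; exact: m_ge0.
Qed.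

Lemma in_cell_next n h t u : h \in words A n -> in_cell h (t, u) ->
  exists2 a, a \in A & in_cell (rcons h a) (t, u).
Proof.
move=> hn; rewrite /in_cell /= (m_rcons _ hn) => /split_interval.
move=> [A1 [a [A2 [AE H]]]]; exists a; first by rewrite AE mem_cat mem_head orbT.
rewrite cell_lo_rcons AE index_cat /= eqxx addn0.
have -> : a \in A1 = false.
  apply/negbTE; move: uA; rewrite AE cat_uniq => /and3P[_ /hasPn /(_ a) + _].
  by apply; exact: mem_head.
by rewrite take_size_cat.
Qed.

Lemma in_cell_disj n h a b t u : h \in words A n -> a \in A -> b \in A ->
  in_cell (rcons h a) (t, u) -> in_cell (rcons h b) (t, u) -> a = b.
Proof.
wlog ab : a b / (index a A <= index b A)%N => [H|hn aA bA].
  have [ab|ab] := leqP (index a A) (index b A); first exact: H.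
  by move=> hn aA bA Ha Hb; apply/esym/H => //; exact: ltnW.
move=> /andP[/= _ hi] /andP[/= lo _].
move: ab; rewrite leq_eqVlt => /orP[/eqP E|lt].
  by rewrite -(nth_index [::] aA) E nth_index.
have := le_lt_trans lo hi; rewrite !cell_lo_rcons -addrA ltrD2l ltNge.
move=> /negP[].
rewrite -[in X in _ <= X](cat_take_drop (index a A) (take (index b A) A)).
rewrite big_cat /= take_takel ?(ltnW lt)// lerD2l.
rewrite (drop_nth [::]); last first.
  by rewrite size_take; case: ifP => //; rewrite index_mem bA.
rewrite nth_take// nth_index// big_cons lerDl.
by apply: sumr_ge0 => c _; exact: m_ge0.
Qed.

Lemma in_cell_exists n t u : 0 <= u < 1 ->
  exists2 h, h \in words A n & in_cell h (t, u).
Proof.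
move=> u01; elim: n => [|n [h hn hu]].
  exists [::]; first exact: mem_head.
  by rewrite /in_cell /= /cell_lo /= m_nil add0r.
have [a aA au] := in_cell_next hn hu; exists (rcons h a) => //.
by rewrite rcons_words hn.
Qed.

Lemma in_cell_inj n h h' t u : h \in words A n -> h' \in words A n ->
  in_cell h (t, u) -> in_cell h' (t, u) -> h = h'.
Proof.
elim: n h h' => [|n IH] h h'; first by rewrite !inE => /eqP -> /eqP ->.
case/lastP: h => [|h a]; first by rewrite nil_words.
case/lastP: h' => [|h' a']; first by rewrite nil_words => _.
rewrite !rcons_words => /andP[hn aA] /andP[hn' aA'] ha ha'.
have E := IH _ _ hn hn' (in_cell_rcons hn aA ha) (in_cell_rcons hn' aA' ha').
by rewrite -E in ha' *; rewrite (in_cell_disj hn aA aA' ha ha').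
Qed.

Lemma in_cell_take n h t u c : h \in words A n -> in_cell h (t, u) ->
  (c <= n)%N -> in_cell (take c h) (t, u).
Proof.
elim: n h => [|n IH] h; first by move=> hn hu; rewrite leqn0 => /eqP ->;
  move: hn hu; rewrite inE => /eqP ->.
move=> hn hu; rewrite leq_eqVlt => /orP[/eqP ->|cn].
  by rewrite take_oversize// (size_words hn).
move: hn hu; case/lastP: h => [|h a]; first by rewrite nil_words.
rewrite rcons_words => /andP[hn aA] hu.
rewrite -cats1 takel_cat ?(size_words hn)//.
by apply: IH => //; exact: in_cell_rcons hn aA hu.
Qed.

(** The signs of constant [c] are read on the cell of length [c + 1] that contains the point. Cells
    are nested, so longer words give the same value, and one point of the interval determines an
    infinite structure. *)
Definition tree_bit (tu : T * R) (j c : nat) : bool :=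
  has (fun h => in_cell h tu && nth false (nth [::] h c) j) (words A c.+1).

Lemma tree_bitE n h t u j c : h \in words A n -> in_cell h (t, u) -> (c < n)%N ->
  tree_bit (t, u) j c = nth false (nth [::] h c) j.
Proof.
move=> hn hu cn.
have tn : take c.+1 h \in words A c.+1.
  move: hn; rewrite !mem_words => /andP[/eqP sh ha].
  by rewrite size_takel ?sh// eqxx; apply/allP => a /mem_take; exact: (allP ha).
have tu := in_cell_take hn hu cn.
rewrite /tree_bit; apply/hasP/idP => [[h' hn' /andP[hu' +]]|H].
  by rewrite -(in_cell_inj tn hn' tu hu') nth_take.
by exists (take c.+1 h) => //; rewrite tu nth_take.
Qed.

Lemma tree_bit_word n h t u : h \in words A n -> 0 <= u < 1 ->
  (forall c j, (c < n)%N -> (j < Q)%N ->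
    tree_bit (t, u) j c = nth false (nth [::] h c) j) <-> in_cell h (t, u).
Proof.
move=> hn u01; split=> [H|hu c j cn jQ]; last exact: tree_bitE hu cn.
have [h' hn' hu'] := in_cell_exists n t u01.
suff -> : h = h' by [].
have sz k (l : seq (seq bool)) : l \in words A n -> (k < n)%N -> size (nth [::] l k) = Q.
  move=> ln kn; apply/eqP; rewrite -mem_bitwords.
  move: ln; rewrite mem_words => /andP[/eqP sl /allP]; apply.
  by rewrite mem_nth// sl.
apply: (@eq_from_nth _ [::]); first by rewrite !(@size_words _ A n).
move=> c; rewrite (size_words hn) => cn.
apply: (@eq_from_nth _ false); first by rewrite !sz.
by move=> j; rewrite sz// => jQ; rewrite -H// (tree_bitE _ hn' hu').
Qed.

Lemma measurable_in_cell h : measurable [set tu | in_cell h tu].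
Proof.
have mlo : measurable_fun setT (fun tu : T * R => cell_lo tu.1 h).
  rewrite /cell_lo; elim: h [::] => [|a h IH] p /=; first exact: measurable_cst.
  apply: measurable_funD => //; apply: measurable_sum => b.
  exact: measurableT_comp (m_meas _) measurable_fst.
have mm : measurable_fun setT (fun tu : T * R => m tu.1 h).
  exact: measurableT_comp (m_meas _) measurable_fst.
have m2 : measurable_fun setT (fun tu : T * R => tu.2) by exact: measurable_snd.
rewrite (_ : mkset _ =
  (fun tu => (cell_lo tu.1 h <= tu.2) && (tu.2 < cell_lo tu.1 h + m tu.1 h)) @^-1` [set true]).
  rewrite -[X in measurable X]setTI; apply: measurable_and => //.
    exact: measurable_fun_ler.
  by apply: measurable_fun_ltr => //; exact: measurable_funD.
by apply/seteqP; split.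
Qed.

Lemma measurable_tree_bit j c : measurable [set tu | tree_bit tu j c].
Proof.
rewrite /tree_bit; elim: (words A c.+1) => [|h s IH] /=.
  by rewrite (_ : mkset _ = set0)//; apply/seteqP; split.
rewrite (_ : mkset _ = [set tu | in_cell h tu && nth false (nth [::] h c) j] `|`
  [set tu | has (fun h => in_cell h tu && nth false (nth [::] h c) j) s]).
  apply: measurableU => //; case: (nth _ _ _).
    under eq_set do rewrite andbT; exact: measurable_in_cell.
  by under eq_set do rewrite andbF; rewrite (_ : mkset _ = set0)//; apply/seteqP; split.
by apply/seteqP; split=> t /= => [/orP[]|[->|->]]; rewrite ?orbT//; [left|right].
Qed.

Lemma in_cell_lt1 n h t u : h \in words A n -> in_cell h (t, u) -> u < 1.
Proof.
move=> hn /(in_cell_take hn)/(_ (leq0n n)); rewrite take0 => /andP[_] /=.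
by rewrite /cell_lo /= m_nil add0r.
Qed.

Lemma unif_tree_word n h t : h \in words A n ->
  unif [set u : R | forall c j, (c < n)%N -> (j < Q)%N ->
    tree_bit (t, u) j c = nth false (nth [::] h c) j] = (m t h)%:E.
Proof.
move=> hn; have lo0 : 0 <= cell_lo t h.
  rewrite /cell_lo; elim: h [::] {hn} => [|a h IH] p //=.
  by rewrite addr_ge0// sumr_ge0.
have [m0|mp] := eqVneq (m t h) 0.
  rewrite m0; transitivity (unif (set0 : set R)); last exact: measure0.
  apply: unif_ext => u u01; apply: iff_trans (tree_bit_word t hn u01) _.
  by rewrite /in_cell /= m0 addr0; split=> // /andP[/le_lt_trans H /H]; rewrite ltxx.
have mgt : 0 < m t h by rewrite lt_def mp m_ge0.
transitivity (unif `[cell_lo t h, cell_lo t h + m t h[%classic).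
  apply: unif_ext => u u01; apply: iff_trans (tree_bit_word t hn u01) _.
  by rewrite /in_cell /= in_itv.
rewrite unif_itv ?lerDl ?m_ge0//; first by congr EFin; ring.
(* A cell reaching beyond 1 would contain the maximum of 1 and its left endpoint, whereas every cell
   lies below 1. *)
have [//|lt1] := leP (cell_lo t h + m t h) 1.
have : in_cell h (t, Num.max 1 (cell_lo t h)).
  by rewrite /in_cell /= le_max lexx orbT gt_max lt1 ltrDl.
by move=> /(in_cell_lt1 hn); rewrite gt_max ltxx.
Qed.

End Tree.

(** * Colour sums *)

Section ColourSum.
Variables (R : realType) (T : eqType).
Implicit Types (u : seq (nat * T)) (a : T) (h : seq T).

Definition colour_wt (beta : T -> nat -> R) u (i : nat) a : R :=
  if i \in unzip1 u then ((i, a) \in u)%:R else beta a i.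

(* The probability of the word h when each letter independently gets a colour:
   i in 1..K with weight p i, the first letter of colour i being a with
   probability beta a i and later ones repeating it, or dust (no colour), where
   d a is the weight of "dust and letter a".  The list u records the colours
   already used and their letters. *)
Fixpoint colour_sum (K : nat) (p : nat -> R) (beta : T -> nat -> R) (d : T -> R)
    u h : R :=
  if h is a :: h' then
    d a * colour_sum K p beta d u h' +
    \sum_(i <- iota 1 K) p i * colour_wt beta u i a *
      colour_sum K p beta d (rcons u (i, a)) h'
  else 1.

Lemma mem_unzip1P u i : reflect (exists a, (i, a) \in u) (i \in unzip1 u).
Proof.
apply: (iffP mapP) => [[[j a] ju /= ->]|[a ua]]; first by exists a.
by exists (i, a).
Qed.

Lemma colour_wt_mem beta u u' i a :
  (forall b, ((i, b) \in u) = ((i, b) \in u')) ->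
  colour_wt beta u i a = colour_wt beta u' i a.
Proof.
move=> E; rewrite /colour_wt E; suff -> : (i \in unzip1 u) = (i \in unzip1 u') by [].
by apply/mem_unzip1P/mem_unzip1P => -[b ub]; exists b; rewrite ?E// -E.
Qed.

Section FixedWeights.
Variables (K : nat) (p : nat -> R) (beta : T -> nat -> R) (d : T -> R).
Notation V := (colour_sum K p beta d).
Notation wt := (colour_wt beta).

Lemma colour_sum_mem u u' h :
  (forall i a, (0 < i <= K)%N -> ((i, a) \in u) = ((i, a) \in u')) ->
  V u h = V u' h.
Proof.
elim: h u u' => [//|a h IH] u u' E /=; rewrite (IH _ _ E); congr (_ + _).
rewrite [LHS]big_seq_cond [RHS]big_seq_cond; apply: eq_bigr => i.
rewrite andbT mem_iota add1n ltnS => iK.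
rewrite (@colour_wt_mem beta u u' i a) => [|b]; last exact: E.
congr (_ * _); apply: IH => j b jK; rewrite !mem_rcons !inE E//.
Qed.

(** Exchangeability at its smallest. Different colours do not interact; two draws of one colour
    count only if both letters match a recorded one or, for a fresh colour, each other. *)
Let wt_swap u i j a b :
  wt u i a * wt (rcons u (i, a)) j b = wt u j b * wt (rcons u (j, b)) i a.
Proof.
have [->|ij] := eqVneq i j; last first.
  rewrite (@colour_wt_mem beta _ u j b) => [|c]; last first.
    by rewrite mem_rcons inE xpair_eqE eq_sym (negbTE ij).
  rewrite (@colour_wt_mem beta (rcons u (j, b)) u i a) => [|c]; first by rewrite mulrC.
  by rewrite mem_rcons inE xpair_eqE (negbTE ij).
rewrite /colour_wt /unzip1 !map_rcons -/(unzip1 u) !mem_rcons !inE !eqxx /=.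
rewrite !xpair_eqE !eqxx /=.
have [ju|ju] := boolP (j \in unzip1 u).
  by have [<-|ab] := eqVneq a b; rewrite //= mulrC.
have nu c : (j, c) \in u = false.
  by apply/negbTE; apply: contra ju => jc; apply/mem_unzip1P; exists c.
by rewrite !nu !orbF; have [<-|ab] := eqVneq a b; rewrite ?mulr1 ?mulr0.
Qed.

Lemma colour_sum_swap u a b h : V u (a :: b :: h) = V u (b :: a :: h).
Proof.
rewrite /= !mulrDr -!addrA; congr (_ + _); first by rewrite mulrCA.
have split2 c e : \sum_(i <- iota 1 K) p i * wt u i c *
    (d e * V (rcons u (i, c)) h + \sum_(j <- iota 1 K)
      p j * wt (rcons u (i, c)) j e * V (rcons (rcons u (i, c)) (j, e)) h) =
  d e * (\sum_(i <- iota 1 K) p i * wt u i c * V (rcons u (i, c)) h) +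
  \sum_(i <- iota 1 K) \sum_(j <- iota 1 K)
    p i * p j * (wt u i c * wt (rcons u (i, c)) j e) *
      V (rcons (rcons u (i, c)) (j, e)) h.
  rewrite mulr_sumr -big_split /=; apply: eq_bigr => i _.
  rewrite mulrDr mulrCA; congr (_ + _); rewrite mulr_sumr.
  by apply: eq_bigr => j _; ring.
rewrite !split2 addrCA; congr (_ + (_ + _)); rewrite exchange_big /=.
apply: eq_bigr => i _; apply: eq_bigr => j _.
rewrite wt_swap [p j * p i]mulrC; congr (_ * _).
by apply: colour_sum_mem => k c _; rewrite !mem_rcons !inE !mem_rcons !inE orbCA.
Qed.

Lemma colour_sum_cons u a h h' : (forall u, V u h = V u h') ->
  V u (a :: h) = V u (a :: h').
Proof. by move=> E /=; rewrite E; congr (_ + _); apply: eq_bigr => i _; rewrite E. Qed.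

Lemma colour_sum_perm u h h' : perm_eq h h' -> V u h = V u h'.
Proof.
have move1 s a t v : V v (s ++ a :: t) = V v (a :: s ++ t).
  elim: s v => [//|c s IH] v.
  by rewrite cat_cons (colour_sum_cons _ _ IH) colour_sum_swap.
elim: h h' u => [|a h IH] h' u hh'.
  by have /perm_size/esym/size0nil -> := hh'.
have ah' : a \in h' by rewrite -(perm_mem hh') mem_head.
move: hh'; case/splitPr: ah' => s t hh'; rewrite move1.
apply: colour_sum_cons => v; apply: IH.
by rewrite -(perm_cons a) (perm_trans hh')// -[a :: t]cat1s perm_catCA.
Qed.

Definition single_valued u := forall i a b, (i, a) \in u -> (i, b) \in u -> a = b.

(** Recording a second letter for a colour has weight zero, so the invariant holds on every branch
    of [colour_sum] that counts. *)
Lemma single_valued_rcons u i a : single_valued u ->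
  colour_wt beta u i a != 0 -> single_valued (rcons u (i, a)).
Proof.
move=> su; rewrite /colour_wt => w0 j b c; rewrite !mem_rcons !inE !xpair_eqE.
have nu e : ((j, e) \in u) -> j == i -> e = a.
  move=> je /eqP ji; rewrite ji in je; move: w0; rewrite ifT; last first.
    by apply/mem_unzip1P; exists e.
  case: ((i, a) \in u) / boolP => [ia _|_]; last by rewrite eqxx.
  exact: su je ia.
move=> /orP[/andP[ji /eqP ->]|jb] /orP[/andP[ji' /eqP ->]|jc] //.
- by apply/esym/(nu c jc).
- exact: (nu b jb).
- exact: su jb jc.
Qed.

Lemma colour_sum_ge0 u h : (forall i, 0 <= p i) -> (forall a i, 0 <= beta a i) ->
  (forall a, 0 <= d a) -> 0 <= V u h.
Proof.
move=> p0 b0 d0; elim: h u => [//|a h IH] u /=.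
rewrite addr_ge0 ?mulr_ge0//; apply: sumr_ge0 => i _.
by rewrite !mulr_ge0// /colour_wt; case: ifP => // _; rewrite ler0n.
Qed.

Lemma colour_wt_bounds u i a : (forall a i, 0 <= beta a i <= 1) ->
  0 <= wt u i a <= 1.
Proof. by move=> b01; rewrite /colour_wt; case: ifP => // _; case: (_ \in _); rewrite ?ler01 ?lexx. Qed.

Lemma colour_sum_le1 u h : (forall i, 0 <= p i) -> (forall a i, 0 <= beta a i <= 1) ->
  (forall a, 0 <= d a) -> (forall a, d a + \sum_(i <- iota 1 K) p i <= 1) ->
  V u h <= 1.
Proof.
move=> p0 b01 d0 s1; elim: h u => [//|a h IH] u /=.
apply: le_trans (s1 a); rewrite lerD//.
  by rewrite -[leRHS]mulr1 ler_wpM2l.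
apply: ler_sum => i _; have /andP[w0 w1] := colour_wt_bounds u i a b01.
have v0 : 0 <= V (rcons u (i, a)) h.
  by apply: colour_sum_ge0 => // b j; have /andP[] := b01 b j.
by rewrite -mulrA -[leRHS]mulr1 ler_wpM2l// mulr_ile1.
Qed.

Lemma sum_single_valued (A : seq T) u i : uniq A -> single_valued u ->
  (forall b, (i, b) \in u -> b \in A) -> i \in unzip1 u ->
  \sum_(a <- A) ((i, a) \in u)%:R = 1 :> R.
Proof.
move=> uA su uAA /mem_unzip1P[b ib].
rewrite (bigD1_seq b) ?uAA//= ib big1 ?addr0// => a ab.
by case: ((i, a) \in u) / boolP => // ia; move: ab; rewrite (su _ _ _ ia ib) eqxx.
Qed.

(** Summing out the last letter leaves the total weight of the dust and the first [K] colours. For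
    the parameters in B this factor tends to 1 as [K] grows, which yields consistency in the
    limit. *)
Lemma sum_colour_sum_rcons (A : seq T) (D : R) u h : uniq A ->
  \sum_(a <- A) d a = D ->
  (forall i, (0 < i)%N -> \sum_(a <- A) beta a i = 1) ->
  single_valued u -> (forall i b, (i, b) \in u -> b \in A) -> all (mem A) h ->
  \sum_(a <- A) V u (rcons h a) = (D + \sum_(i <- iota 1 K) p i) * V u h.
Proof.
move=> uA dA bA; elim: h u => [|c h IH] u su uAA.
  move=> _; under eq_bigr do rewrite /= mulr1.
  rewrite big_split /= dA exchange_big /= mulr1; congr (_ + _).
  rewrite [LHS]big_seq_cond [RHS]big_seq_cond; apply: eq_bigr => i.
  rewrite andbT mem_iota => /andP[i0 _].
  under eq_bigr do rewrite mulr1; rewrite -mulr_sumr /colour_wt.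
  have [iu|iu] := boolP (i \in unzip1 u); last by rewrite bA// mulr1.
  by rewrite sum_single_valued ?mulr1// => b; exact: uAA.
move=> /andP[cA hA]; rewrite [V u (c :: h)]/=.
under [LHS]eq_bigr do rewrite rcons_cons /=.
rewrite big_split /= -mulr_sumr IH// exchange_big /= mulrDr mulrCA; congr (_ + _).
rewrite mulr_sumr; apply: eq_bigr => i _; rewrite -mulr_sumr.
have [w0|w0] := eqVneq (wt u i c) 0; first by rewrite w0 mulr0 !mul0r mulr0.
rewrite IH//; first by rewrite mulrCA.
  exact: single_valued_rcons.
move=> j b; rewrite mem_rcons inE => /orP[/eqP[_ ->]//|]; exact: uAA.
Qed.

End FixedWeights.

End ColourSum.

(** Forgetting part of a letter through [rho] commutes with the recursion, because colours are drawn
    without regard to letters and the weights in a fibre add up. This is the source of consistency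
    between languages. *)
Lemma sum_colour_sum_fiber (R : realType) (T T' : eqType) (K : nat) (p : nat -> R)
    (beta : T -> nat -> R) (d : T -> R) (beta' : T' -> nat -> R) (d' : T' -> R)
    (A' : seq T') (rho : T' -> T) (u : seq (nat * T')) (h : seq T) : uniq A' ->
  (forall a, a \in h -> \sum_(a' <- A' | rho a' == a) d' a' = d a) ->
  (forall i a, (0 < i)%N -> a \in h -> \sum_(a' <- A' | rho a' == a) beta' a' i = beta a i) ->
  single_valued u -> (forall i b, (i, b) \in u -> b \in A') ->
  \sum_(h' <- words A' (size h) | map rho h' == h) colour_sum K p beta' d' u h' =
  colour_sum K p beta d [seq (x.1, rho x.2) | x <- u] h.
Proof.
move=> uA; elim: h u => [|a h IH] u dA bA su uAA.
  by rewrite /= big_mkcond big_seq1.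
have dA' c : c \in h -> \sum_(a' <- A' | rho a' == c) d' a' = d c.
  by move=> ch; apply: dA; rewrite inE ch orbT.
have bA' i c : (0 < i)%N -> c \in h -> \sum_(a' <- A' | rho a' == c) beta' a' i = beta c i.
  by move=> i0 ch; apply: bA => //; rewrite inE ch orbT.
have {}IH v := IH v dA' bA'.
rewrite big_mkcond sum_wordsS.
transitivity (\sum_(a' <- A' | rho a' == a)
    \sum_(h' <- words A' (size h) | map rho h' == h) colour_sum K p beta' d' u (a' :: h')).
  rewrite [RHS]big_mkcond; apply: eq_bigr => a' _.
  under eq_bigr do rewrite /= eqseq_cons.
  case: (rho a' == a) => /=; first by rewrite -big_mkcond.
  by rewrite big1_eq.
transitivity (\sum_(a' <- A' | rho a' == a)
    (d' a' * colour_sum K p beta d [seq (x.1, rho x.2) | x <- u] h +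
     \sum_(i <- iota 1 K) p i * colour_wt beta' u i a' *
      colour_sum K p beta d [seq (x.1, rho x.2) | x <- rcons u (i, a')] h)).
  rewrite [LHS]big_seq_cond [RHS]big_seq_cond; apply: eq_bigr => a' /andP[aA' _] /=.
  rewrite big_split /= -mulr_sumr IH//; congr (_ + _).
  rewrite exchange_big /=; apply: eq_bigr => i _; rewrite -mulr_sumr.
  have [w0|w0] := eqVneq (colour_wt beta' u i a') 0; first by rewrite w0 mulr0 !mul0r.
  rewrite IH//; first exact: single_valued_rcons w0.
  by move=> j b; rewrite mem_rcons inE => /orP[/eqP[_ ->]//|]; exact: uAA.
rewrite big_split /= -mulr_suml dA ?mem_head//; congr (_ + _).
rewrite exchange_big /= [LHS]big_seq_cond [RHS]big_seq_cond; apply: eq_bigr => i.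
rewrite andbT mem_iota => /andP[i0 _].
under eq_bigr => a' /eqP ra do rewrite map_rcons /= ra.
rewrite -mulr_suml -mulr_sumr; congr (_ * _ * _).
rewrite /colour_wt.
have -> : (i \in unzip1 [seq (x.1, rho x.2) | x <- u]) = (i \in unzip1 u).
  by rewrite /unzip1 -map_comp.
have [iu|iu] := boolP (i \in unzip1 u); last by rewrite bA// mem_head.
have [b ib] := mem_unzip1P _ _ iu.
have mapE : ((i, a) \in [seq (x.1, rho x.2) | x <- u]) = (rho b == a).
  apply/mapP/eqP => [[[j c] jc [ij ->]]|<-]; last by exists (i, b).
  by rewrite -ij in jc; rewrite (su _ _ _ jc ib).
rewrite mapE big_mkcond (bigD1_seq b) ?(uAA _ _ ib)//= ib big1 ?addr0.
  by case: ifP.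
move=> c cb; case: ifP => // _; case: ((i, c) \in u) / boolP => // ic.
by move: cb; rewrite (su _ _ _ ic ib) eqxx.
Qed.

(** Letters enter only through their weights and through equality. The weights of an atom depend on
    its number of negations alone, so this is the algebra behind SPx. *)
Lemma colour_sum_map (R : realType) (T T' : eqType) (K : nat) (p : nat -> R)
    (beta : T -> nat -> R) (d : T -> R) (beta' : T' -> nat -> R) (d' : T' -> R)
    (psi : T -> T') (S : seq T) (u : seq (nat * T)) (h : seq T) :
  {in S &, injective psi} ->
  {in S, forall a, d' (psi a) = d a} -> {in S, forall a, beta' (psi a) =1 beta a} ->
  {subset h <= S} -> (forall i a, (i, a) \in u -> a \in S) ->
  colour_sum K p beta' d' [seq (x.1, psi x.2) | x <- u] (map psi h) =
  colour_sum K p beta d u h.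
Proof.
move=> inj dE bE; elim: h u => [//|a h IH] u hS uS /=.
have aS : a \in S by apply: hS; exact: mem_head.
have {}IH v := IH v (fun c ch => hS c (mem_behead (ch : c \in behead (a :: h)))).
rewrite dE// IH//; congr (_ + _); apply: eq_bigr => i _.
rewrite -[rcons _ _](map_rcons (fun x => (x.1, psi x.2)) u (i, a)) IH; last first.
  by move=> j c; rewrite mem_rcons inE => /orP[/eqP[_ ->]//|]; exact: uS.
congr (_ * _ * _); rewrite /colour_wt /unzip1 -map_comp bE//.
case: ifP => // _; congr (_%:R); congr (nat_of_bool _).
apply/mapP/idP => [[[j c] jc [ij /(inj _ _ aS (uS _ _ jc)) ac]]|ia].
  by rewrite ij ac.
by exists (i, a).
Qed.

(** * Merging rare colours with the dust *)

Section Truncation.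
Variables (R : realType) (T : eqType) (K K' : nat) (p : nat -> R).
Variables (beta : T -> nat -> R) (d d' : T -> R) (delta eps : R).
Hypotheses (KK' : (K <= K')%N) (p0 : forall i, 0 <= p i).
Hypotheses (beta01 : forall a i, 0 <= beta a i <= 1).
Hypotheses (d_ge0 : forall a, 0 <= d a) (d'_ge0 : forall a, 0 <= d' a).
Hypotheses (sum_d : forall a, d a + \sum_(i <- iota 1 K) p i <= 1).
Hypotheses (sum_d' : forall a, d' a + \sum_(i <- iota 1 K') p i <= 1).
Hypotheses (p_small : forall i, (K < i)%N -> p i <= delta).
Hypothesis dd' : forall a,
  `|d' a + \sum_(i <- iota K.+1 (K' - K)) p i * beta a i - d a| <= eps.

Notation V := (colour_sum K p beta d).
Notation V' := (colour_sum K' p beta d').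

(* Colours beyond K are unlikely to be used twice, so they may be merged with
   the dust. *)
Lemma colour_sum_trunc u h : `|V' u h - V u h| <=
  (size h)%:R * ((size u + size h)%:R * delta + eps).
Proof.
have V0 v g : 0 <= V v g.
  by apply: colour_sum_ge0 => // a i; have /andP[] := beta01 a i.
have V1 v g : V v g <= 1 by apply: colour_sum_le1.
have eps0 (a : T) : 0 <= eps by exact: le_trans (normr_ge0 _) (dd' a).
have delta0 : 0 <= delta by exact: le_trans (p0 K.+1) (p_small (ltnSn K)).
have iotaE : iota 1 K' = iota 1 K ++ iota K.+1 (K' - K).
  by rewrite -{1}(subnKC KK') iotaD add1n.
elim: h u => [|a h IH] u; first by rewrite /= subrr normr0 mul0r.
set B := (size h)%:R * ((size u + (size h).+1)%:R * delta + eps).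
have IHu : `|V' u h - V u h| <= B.
  apply: le_trans (IH u) _; rewrite /B ler_wpM2l// lerD2r ler_wpM2r// ler_nat.
  by rewrite leq_add2l.
have IHi i : `|V' (rcons u (i, a)) h - V (rcons u (i, a)) h| <= B.
  by apply: le_trans (IH _) _; rewrite /B size_rcons addSnnS.
(* Only colours recorded in [u] can have a weight different from [beta]: at most [size u] of them,
   each of frequency at most [delta]. *)
have tail_wt : \sum_(i <- iota K.+1 (K' - K)) p i * `|colour_wt beta u i a - beta a i| <=
    (size u)%:R * delta.
  have wi i : `|colour_wt beta u i a - beta a i| <= \sum_(x <- u) (x.1 == i)%:R.
    rewrite /colour_wt; have [iu|_] := boolP (i \in unzip1 u); last first.
      by rewrite subrr normr0 sumr_ge0// => x _; rewrite ler0n.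
    have [b ib] := mem_unzip1P _ _ iu.
    rewrite (big_rem _ ib) /= eqxx -[leLHS]addr0 lerD//.
      have /andP[b0 b1] := beta01 a i; case: (_ \in _).
        by rewrite ger0_norm ?subr_ge0// lerBlDr lerDl.
      by rewrite sub0r normrN ger0_norm.
    by rewrite sumr_ge0// => x _; rewrite ler0n.
  apply: (@le_trans _ _ (\sum_(x <- u) \sum_(i <- iota K.+1 (K' - K)) (x.1 == i)%:R * delta)).
    rewrite exchange_big /= big_seq_cond [leRHS]big_seq_cond; apply: ler_sum => i.
    rewrite andbT mem_iota => /andP[Ki _]; rewrite -mulr_suml mulrC.
    apply: ler_pM => //; exact: p_small.
  have -> : (size u)%:R * delta = \sum_(x <- u) delta.
    by rewrite big_const_seq count_predT iter_addr addr0 mulr_natl.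
  apply: ler_sum => x _; rewrite -mulr_suml -[leRHS]mul1r ler_wpM2r//.
  have [xi|xi] := boolP (x.1 \in iota K.+1 (K' - K)).
    rewrite (bigD1_seq _ xi (iota_uniq _ _)) /= eqxx big1 ?addr0// => i.
    by rewrite eq_sym => /negbTE ->.
  rewrite big1_seq// => i /andP[_ ii]; case: eqP => // xE.
  by move: xi; rewrite xE ii.
rewrite [V' u (a :: h)]/= [V u (a :: h)]/= iotaE big_cat /=.
have VK i : (K < i)%N -> V (rcons u (i, a)) h = V u h.
  move=> Ki; apply: colour_sum_mem => j b /andP[_ jK].
  by rewrite mem_rcons inE xpair_eqE; case: eqP => // ji; rewrite -ji ltnNge jK in Ki.
(* Here [t1], [t2] and [t3] carry the error of the shorter word, [t4] the reuse of a colour beyond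
   [K], and [t5] the discrepancy between the merged tail and the dust [d]. *)
pose t1 := d' a * (V' u h - V u h).
pose t2 := \sum_(i <- iota 1 K) p i * colour_wt beta u i a *
  (V' (rcons u (i, a)) h - V (rcons u (i, a)) h).
pose t3 := \sum_(i <- iota K.+1 (K' - K)) p i * colour_wt beta u i a *
  (V' (rcons u (i, a)) h - V (rcons u (i, a)) h).
pose t4 := \sum_(i <- iota K.+1 (K' - K)) p i * (colour_wt beta u i a - beta a i) * V u h.
pose t5 := (d' a + \sum_(i <- iota K.+1 (K' - K)) p i * beta a i - d a) * V u h.
rewrite (_ : _ - _ = t1 + t2 + t3 + t4 + t5); last first.
  have e2 : t2 = \sum_(i <- iota 1 K) p i * colour_wt beta u i a * V' (rcons u (i, a)) h -
      \sum_(i <- iota 1 K) p i * colour_wt beta u i a * V (rcons u (i, a)) h.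
    by rewrite -sumrB; apply: eq_bigr => i _; rewrite mulrBr.
  have e34 : t3 + t4 = \sum_(i <- iota K.+1 (K' - K)) p i * colour_wt beta u i a *
      V' (rcons u (i, a)) h - (\sum_(i <- iota K.+1 (K' - K)) p i * beta a i) * V u h.
    rewrite mulr_suml -sumrB -big_split /= [LHS]big_seq_cond [RHS]big_seq_cond.
    apply: eq_bigr => i; rewrite andbT mem_iota => /andP[Ki _].
    by rewrite VK//; ring.
  by rewrite -[t1 + t2 + t3 + t4]addrA e34 e2 /t1 /t5; ring.
have wt01 i := colour_wt_bounds u i a beta01.
have n1 : `|t1| <= d' a * B by rewrite normrM ger0_norm// ler_wpM2l.
have n23 : `|t2| + `|t3| <= (\sum_(i <- iota 1 K') p i) * B.
  rewrite iotaE big_cat /= mulrDl lerD// mulr_suml; apply: le_trans (ler_norm_sum _ _ _) _;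
  apply: ler_sum => i _; rewrite !normrM [`|p i|]ger0_norm// -mulrA ler_wpM2l//;
  have /andP[w0 w1] := wt01 i; rewrite ger0_norm// -[leRHS]mul1r;
  by apply: ler_pM.
have n4 : `|t4| <= (size u)%:R * delta.
  apply: le_trans tail_wt; apply: le_trans (ler_norm_sum _ _ _) _.
  apply: ler_sum => i _; rewrite !normrM [`|p i|]ger0_norm// -mulrA ler_wpM2l//.
  by rewrite [`|V u h|]ger0_norm// -[leRHS]mulr1 ler_wpM2l.
have n5 : `|t5| <= eps.
  by rewrite normrM [`|V u h|]ger0_norm// -[leRHS]mulr1 ler_pM.
have B0 : 0 <= B by rewrite /B mulr_ge0// addr_ge0 ?mulr_ge0// (eps0 a).
apply: (@le_trans _ _ (B + (size u)%:R * delta + eps)); last first.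
  have -> : (size h).+1%:R = (size h)%:R + 1 :> R by rewrite natr1.
  rewrite /B mulrDl mul1r -addrA lerD2l.
  by rewrite lerD2r ler_wpM2r// ler_nat leq_addr.
have a1 := ler_normD (t1 + t2 + t3 + t4) t5.
have a2 := ler_normD (t1 + t2 + t3) t4.
have a3 := ler_normD (t1 + t2) t3.
have a4 := ler_normD t1 t2.
have : d' a * B + (\sum_(i <- iota 1 K') p i) * B <= B.
  by rewrite -mulrDl -[leRHS]mul1r ler_wpM2r.
clearbody t1 t2 t3 t4 t5 B; clear -n1 n23 n4 n5 a1 a2 a3 a4; lra.
Qed.

End Truncation.

(** * The probabilities of state descriptions *)

Lemma cvg_sumr (R : realType) (I : Type) (r : seq I) (P : pred I)
    (f : I -> nat -> R) (l : I -> R) : (forall i, P i -> f i @ \oo --> l i) ->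
  (fun n => \sum_(i <- r | P i) f i n) @ \oo --> \sum_(i <- r | P i) l i.
Proof.
move=> fl; elim: r => [|i r IH].
  by rewrite big_nil; under eq_fun do rewrite big_nil; exact: cvg_cst.
rewrite big_cons; under eq_fun do rewrite big_cons.
by case: ifP => // Pi; apply: cvgD => //; exact: fl.
Qed.

(** Probability of the signs [a] when each is negative, independently, with probability [y]. *)
Definition atom_wt (R : realType) (y : R) (a : seq bool) : R :=
  y ^+ natoms_neg a * (1 - y) ^+ (size a - natoms_neg a).

Section AtomWeights.
Variable R : realType.
Implicit Types (y : R) (a : seq bool).

Lemma atom_wt_prod y a : atom_wt y a = \prod_(x <- a) (if x then 1 - y else y).
Proof.
rewrite /atom_wt /natoms_neg; elim: a => [|x a IH]; first by rewrite big_nil expr0 mul1r.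
rewrite big_cons -IH /=; have := count_size negb a; case: x => /= ca.
  by rewrite add0n subSn// exprS mulrCA.
by rewrite add1n exprS subSS mulrA.
Qed.

Lemma atom_wt_bounds y a : 0 <= y <= 1 -> 0 <= atom_wt y a <= 1.
Proof.
move=> /andP[y0 y1]; rewrite /atom_wt.
have z0 : 0 <= 1 - y by lra.
have z1 : 1 - y <= 1 by lra.
by rewrite mulr_ge0 ?exprn_ge0//= mulr_ile1 ?exprn_ge0// exprn_ile1.
Qed.

(** Reads the signs of the predicates [us] off an atom over [us']. With a permuted list for [us] it
    also expresses a renaming of predicates. *)
Definition restrict_atom (us us' : seq nat) (a : seq bool) : seq bool :=
  [seq nth false a (index i us') | i <- us].

(** The partial map [g] prescribes some of the signs. The sum over compatible atoms factors over the
    predicates, and a fibre of [restrict_atom] is one such prescription. *)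
Let compatible (g : nat -> option bool) (us : seq nat) (a : seq bool) :=
  all (fun ix => if g ix.1 is Some x then x == ix.2 else true) (zip us a).

Let sum_compatible y g us :
  \sum_(a <- bitwords (size us) | compatible g us a) atom_wt y a =
  \prod_(i <- us) (if g i is Some x then if x then 1 - y else y else 1).
Proof.
elim: us => [|i us IH].
  by rewrite big_mkcond big_seq1 /= big_nil atom_wt_prod big_nil.
rewrite big_mkcond sum_wordsS big_cons -IH !big_cons big_nil addr0.
have E x : \sum_(a <- bitwords (size us))
    (if compatible g (i :: us) (x :: a) then atom_wt y (x :: a) else 0) =
    (if (if g i is Some b then b == x else true) then (if x then 1 - y else y) else 0) *
    \sum_(a <- bitwords (size us) | compatible g us a) atom_wt y a.
  rewrite mulr_sumr [RHS]big_mkcond; apply: eq_bigr => a _.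
  rewrite /compatible /= !atom_wt_prod big_cons.
  case: (if g i is Some b then b == x else true) => /=; last by rewrite mul0r if_same.
  by case: ifP => _ //; rewrite mulr0.
rewrite !E -mulrDl; congr (_ * _).
by case: (g i) => [[]|] /=; ring.
Qed.

Lemma sum_atom_wt_fiber y (us us' : seq nat) a : uniq us -> uniq us' ->
  {subset us <= us'} -> size a = size us ->
  \sum_(a' <- bitwords (size us') | restrict_atom us us' a' == a) atom_wt y a' =
  atom_wt y a.
Proof.
move=> uus uus' sub sa.
pose g i := if i \in us then Some (nth false a (index i us)) else None.
transitivity (\sum_(a' <- bitwords (size us') | compatible g us' a') atom_wt y a').
  rewrite big_mkcond [RHS]big_mkcond big_seq_cond [RHS]big_seq_cond.
  apply: eq_bigr => a'; rewrite andbT mem_bitwords => /eqP sa'.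
  congr (if _ then _ else _).
  apply/eqP/allP => [E [i x]|H].
    move=> /(nthP (0%N, false))[k]; rewrite size_zip sa' minnn => kus.
    rewrite nth_zip ?sa'// => -[<- <-] /=; rewrite /g; case: ifP => // iu; rewrite -E.
    rewrite /restrict_atom (nth_map 0%N) ?index_mem// nth_index//.
    by rewrite index_uniq.
  apply: (@eq_from_nth _ false); rewrite size_map// => k kus.
  rewrite (nth_map 0%N)//; set i := nth 0%N us k.
  have iu : i \in us by rewrite mem_nth.
  have iu' := sub _ iu.
  have /(_ (i, nth false a' (index i us')))/= := H; rewrite /g iu index_uniq//.
  move=> E; apply/esym/eqP/E; apply/(nthP (0%N, false)); exists (index i us').
    by rewrite size_zip sa' minnn index_mem.
  by rewrite nth_zip ?sa'// nth_index.
rewrite sum_compatible atom_wt_prod.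
transitivity (\prod_(i <- us' | i \in us) (if nth false a (index i us) then 1 - y else y)).
  by rewrite [RHS]big_mkcond; apply: eq_bigr => i _; rewrite /g; case: ifP.
rewrite -big_filter (perm_big us); last first.
  apply: uniq_perm => //; first exact: filter_uniq.
  by move=> i; rewrite mem_filter; case: (boolP (i \in us)) => //= /sub ->.
rewrite (big_nth 0%N) [RHS](big_nth false) sa.
rewrite big_nat_cond [RHS]big_nat_cond; apply: eq_bigr => i /andP[/andP[_ ius] _].
by rewrite index_uniq.
Qed.

End AtomWeights.

Section ColourParams.
Variables (R : realType) (q : nat) (b : Braw R).
Implicit Types (h : seq (seq bool)) (c : seq nat).

Definition dust_wt (a : seq bool) : R := bp b 0 * bcoef q b a 0.

(** The part of the defining series of [vsd] with colours at most [K], in the recursive form that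
    carries the used colours in a list. *)
Definition vpart (K : nat) (h : seq (seq bool)) : R :=
  colour_sum K (bp b) (bcoef q b) dust_wt [::] h.

Lemma jrec_cat h h' c c' n : size h = n -> size c = n ->
  jrec q b (h ++ h') (c ++ c') n = jrec q b h c n.
Proof.
move=> sh sc; suff H k : (k <= n)%N -> jrec q b (h ++ h') (c ++ c') k = jrec q b h c k.
  exact: H.
elim: k => //= k IH kn; rewrite IH ?(ltnW kn)//; congr (_ * _).
have E l : (l <= k)%N -> nth 0%N (c ++ c') l = nth 0%N c l /\
    nth [::] (h ++ h') l = nth [::] h l.
  by move=> lk; rewrite !nth_cat sh sc (leq_ltn_trans lk kn).
have [E1 E2] := E k (leqnn k); rewrite /jfac E1 E2.
have -> : all (fun l => nth 0%N (c ++ c') l != nth 0%N c k) (iota 0 k) =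
    all (fun l => nth 0%N c l != nth 0%N c k) (iota 0 k).
  by apply: eq_in_all => l; rewrite mem_iota => /ltnW /E[-> _].
have -> // : has (fun l => (nth 0%N (c ++ c') l == nth 0%N c k) &&
      (nth [::] (h ++ h') l == nth [::] h k)) (iota 0 k) =
    has (fun l => (nth 0%N c l == nth 0%N c k) && (nth [::] h l == nth [::] h k)) (iota 0 k).
by apply: eq_in_has => l; rewrite mem_iota => /ltnW /E[-> ->].
Qed.

(** The search of [jfac] through the earlier positions becomes a lookup in the list of pairs
    [zip c h]. *)
Lemma jrec_rcons h c a x n : size h = n -> size c = n ->
  jrec q b (rcons h a) (rcons c x) n.+1 = jrec q b h c n *
    (if x == 0%N then dust_wt a else bp b x * colour_wt (bcoef q b) (zip c h) x a).
Proof.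
move=> sh sc /=; rewrite -!cats1 jrec_cat//; congr (_ * _).
rewrite /jfac !nth_cat sh sc ltnn subnn /=.
case: eqP => [->|_] //=; rewrite /colour_wt.
have zh : unzip1 (zip c h) = c by rewrite unzip1_zip// sh sc.
have -> : all (fun l => nth 0%N (c ++ [:: x]) l != x) (iota 0 n) = (x \notin c).
  apply/allP/idP => [H|xc l].
    apply/negP => xc; have := H (index x c); rewrite mem_iota add0n.
    by rewrite -sc index_mem xc nth_cat index_mem xc nth_index// eqxx => /(_ isT).
  rewrite mem_iota add0n => /andP[_ ln]; rewrite nth_cat sc ln.
  by apply: contraNneq xc => <-; rewrite mem_nth// sc.
rewrite zh; case: (boolP (x \in c)) => //= xc.
have -> : has (fun l => (nth 0%N (c ++ [:: x]) l == x) &&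
    (nth [::] (h ++ [:: a]) l == a)) (iota 0 n) = ((x, a) \in zip c h).
  apply/hasP/idP => [[l]|].
    rewrite mem_iota add0n !nth_cat sc sh => /andP[_ ln]; rewrite ln.
    move=> /andP[/eqP <- /eqP <-]; rewrite -nth_zip ?sc ?sh// mem_nth//.
    by rewrite size_zip sc sh minnn.
  move=> /(nthP (0%N, [::]))[l]; rewrite size_zip sc sh minnn => ln.
  rewrite nth_zip ?sc ?sh// => -[E1 E2]; exists l; first by rewrite mem_iota.
  by rewrite !nth_cat sc sh ln E1 E2 !eqxx.
by case: (_ \in _); rewrite ?mulr1 ?mulr0.
Qed.

Lemma vpartE K h :
  vpart K h = \sum_(c <- words (iota 0 K.+1) (size h)) jrec q b h c (size h).
Proof.
suff H h1 c1 : size c1 = size h1 ->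
    \sum_(c <- words (iota 0 K.+1) (size h))
      jrec q b (h1 ++ h) (c1 ++ c) (size h1 + size h) =
    jrec q b h1 c1 (size h1) *
      colour_sum K (bp b) (bcoef q b) dust_wt (zip c1 h1) h.
  by have := H [::] [::] erefl; rewrite add0n mul1r => ->.
elim: h h1 c1 => [|a h IH] h1 c1 sc.
  by rewrite sum_words0 !cats0 addn0 /= mulr1.
rewrite sum_wordsS.
transitivity (\sum_(x <- iota 0 K.+1) jrec q b h1 c1 (size h1) *
    (if x == 0%N then dust_wt a else bp b x * colour_wt (bcoef q b) (zip c1 h1) x a) *
    colour_sum K (bp b) (bcoef q b) dust_wt (rcons (zip c1 h1) (x, a)) h).
  apply: eq_bigr => x _; rewrite -jrec_rcons// -zip_rcons//.
  have := IH (rcons h1 a) (rcons c1 x); rewrite !size_rcons sc => <-//.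
  by apply: eq_bigr => c _; rewrite !cat_rcons addSnnS.
rewrite /= big_cons eqxx.
under eq_bigr do rewrite -mulrA; rewrite -mulrA -mulr_sumr -mulrDr; congr (_ * (_ + _)).
  (* Dust leaves an entry of colour 0 in the list, which [colour_sum] never consults. *)
  congr (_ * _); apply: colour_sum_mem => i c /andP[i0 _].
  by rewrite mem_rcons inE xpair_eqE; case: i i0.
rewrite [LHS]big_seq_cond [RHS]big_seq_cond; apply: eq_bigr => i.
by rewrite andbT mem_iota => /andP[]; case: i.
Qed.

End ColourParams.

Lemma sum_words_sub (R : realType) (T : eqType) (A B : seq T) n (F : seq T -> R) :
  (forall s, 0 <= F s) ->
  \sum_(s <- words A n) F s <= \sum_(s <- words (A ++ B) n) F s.
Proof.
elim: n F => [|n IH] F F0; first by rewrite !sum_words0.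
rewrite !sum_wordsS big_cat /= -[leLHS]addr0 lerD//.
  by apply: ler_sum => x _; exact: IH.
by apply: sumr_ge0 => x _; apply: sumr_ge0 => s _.
Qed.

Section InB.
Variables (R : realType) (b : Braw R).
Hypothesis hb : inB b.
Implicit Types (h : seq (seq bool)) (c : seq nat) (a : seq bool).

Lemma bp_ge0 i : 0 <= bp b i. Proof. by case: hb. Qed.

Lemma bp_sum_cvg : (fun K => bp b 0 + \sum_(i <- iota 1 K) bp b i) @ \oo --> (1 : R).
Proof.
case: hb => _ _ + _ _; rewrite -(cvg_shiftS _) /=.
rewrite (_ : (fun K => _ + _) = (fun n => \sum_(i < n.+1) bp b i))//.
apply/funext => K; rewrite big_ord_recl; congr (_ + _).
rewrite (iotaDl 1 0) big_map -[in LHS](subn0 K) -/(index_iota 0 K) big_mkord.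
by apply: eq_bigr => i _; rewrite add1n.
Qed.

Lemma bp_sum_le1 K : bp b 0 + \sum_(i <- iota 1 K) bp b i <= 1.
Proof.
have nd : nondecreasing_seq (fun K => bp b 0 + \sum_(i <- iota 1 K) bp b i).
  apply/nondecreasing_seqP => n; rewrite lerD2l -[n.+1]addn1 iotaD big_cat /= lerDl.
  by rewrite big_seq1 bp_ge0.
have := nondecreasing_cvgn_le nd (cvgP _ bp_sum_cvg) K.
by rewrite (cvg_lim _ bp_sum_cvg).
Qed.

Let mI : measurable (`[0, 1]%classic : set R) := measurable_itv _.

Lemma measurable_atom_wt a : measurable_fun setT (fun y : R => atom_wt y a).
Proof.
apply: measurable_funM; first exact: measurable_funX.
apply: measurable_funX; apply: measurable_funB => //.
Qed.

Let atom_int q a :=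
  (\int[btau0 b]_(x in `[0%R, 1%R]) (x ^+ natoms_neg a * (1 - x) ^+ (q - natoms_neg a))%:E)%E.

Let atom_intE q a : size a = q ->
  atom_int q a = (\int[btau0 b]_(x in `[0%R, 1%R]) (atom_wt x a)%:E)%E.
Proof. by move=> sa; apply: eq_integral => x _; rewrite /atom_wt sa. Qed.

Let tau0_01 : btau0 b `[0, 1] = 1%E. Proof. by case: hb. Qed.

Let atom_int_ge0 q a : (0 <= atom_int q a)%E.
Proof.
apply: integral_ge0 => x /=; rewrite in_itv /= => /andP[x0 x1].
by rewrite lee_fin mulr_ge0// exprn_ge0// subr_ge0.
Qed.

Let atom_int_le1 q a : (atom_int q a <= 1)%E.
Proof.
rewrite -tau0_01 -[leRHS]mul1e -integral_cst//; apply: ge0_le_integral => //.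
- move=> x /=; rewrite in_itv /= => /andP[x0 x1].
  by rewrite lee_fin mulr_ge0// exprn_ge0// subr_ge0.
- apply/measurable_EFinP; apply: measurable_funTS; apply: measurable_funM => //.
  by apply: measurable_funX; apply: measurable_funB.
- move=> x /=; rewrite in_itv /= => /andP[x0 x1].
  have z0 : 0 <= 1 - x by lra.
  have z1 : 1 - x <= 1 by lra.
  by rewrite lee_fin mulr_ile1 ?exprn_ge0// exprn_ile1.
Qed.

Let atom_int_fin q a : atom_int q a \is a fin_num.
Proof.
rewrite ge0_fin_numE ?atom_int_ge0//.
by apply: le_lt_trans (atom_int_le1 q a) _; rewrite ltry.
Qed.

Lemma bcoef0E q a : size a = q ->
  (bcoef q b a 0)%:E = (\int[btau0 b]_(x in `[0%R, 1%R]) (atom_wt x a)%:E)%E.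
Proof.
move=> sa; by rewrite -(atom_intE sa) /bcoef /= fineK ?atom_int_fin.
Qed.

Lemma bcoefSE q a i : (0 < i)%N -> size a = q -> bcoef q b a i = atom_wt (btau b i) a.
Proof. by move=> i0 sa; rewrite /bcoef i0 /atom_wt sa. Qed.

Lemma bcoef_bounds q a i : 0 <= bcoef q b a i <= 1.
Proof.
rewrite /bcoef; case: ifP => i0.
  case: hb => _ _ _ /(_ _ i0) /andP[t0 t1] _.
  have z0 : 0 <= 1 - btau b i by lra.
  have z1 : 1 - btau b i <= 1 by lra.
  by rewrite mulr_ge0 ?exprn_ge0//= mulr_ile1 ?exprn_ge0// exprn_ile1.
rewrite fine_ge0 ?atom_int_ge0//= -lee_fin fineK ?atom_int_fin//.
exact: atom_int_le1.
Qed.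

(** For a colour this is the fibre sum of [atom_wt]; for the dust that identity is integrated
    against [btau0 b]. *)
Lemma sum_bcoef_fiber (us us' : seq nat) a i : uniq us -> uniq us' ->
  {subset us <= us'} -> size a = size us ->
  \sum_(a' <- bitwords (size us') | restrict_atom us us' a' == a)
    bcoef (size us') b a' i = bcoef (size us) b a i.
Proof.
move=> u1 u2 sub sa; have sz a' : a' \in bitwords (size us') -> size a' = size us'.
  by rewrite mem_bitwords => /eqP.
have [i0|] := boolP (0 < i)%N.
  rewrite (bcoefSE i0 sa) -(sum_atom_wt_fiber _ u1 u2 sub sa).
  rewrite [LHS]big_seq_cond [RHS]big_seq_cond; apply: eq_bigr => a' /andP[/sz sa' _].
  exact: bcoefSE.
rewrite lt0n negbK => /eqP ->; apply/EFin_inj.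
rewrite bcoef0E// -sumEFin.
transitivity (\sum_(a' <- bitwords (size us') | restrict_atom us us' a' == a)
   \int[btau0 b]_(x in `[0%R, 1%R]) (atom_wt x a')%:E)%E.
  rewrite [LHS]big_seq_cond [RHS]big_seq_cond; apply: eq_bigr => a' /andP[/sz sa' _].
  exact: bcoef0E.
rewrite -big_filter -ge0_integral_sum//.
- apply: eq_integral => x _; rewrite sumEFin big_filter.
  by rewrite (sum_atom_wt_fiber _ u1 u2 sub sa).
- by move=> a'; apply/measurable_EFinP; apply: measurable_funTS; exact: measurable_atom_wt.
- by move=> a' x /=; rewrite in_itv /= lee_fin => /(atom_wt_bounds a') /andP[].
Qed.

(** Restriction to the empty language, whose only atom has weight 1. *)
Lemma sum_bcoef q i : \sum_(a <- bitwords q) bcoef q b a i = 1.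
Proof.
have sub : {subset [::] <= iota 0 q} by [].
have := @sum_bcoef_fiber [::] (iota 0 q) [::] i isT (iota_uniq _ _) sub erefl.
rewrite size_iota => H.
have -> : \sum_(a <- bitwords q) bcoef q b a i =
    \sum_(a <- bitwords q | restrict_atom [::] (iota 0 q) a == [::]) bcoef q b a i.
  by apply: eq_bigl => a; rewrite /restrict_atom.
rewrite H /=; have [i0|] := boolP (0 < i)%N.
  by rewrite bcoefSE// atom_wt_prod big_nil.
rewrite lt0n negbK => /eqP ->; apply/EFin_inj; rewrite bcoef0E//.
transitivity (\int[btau0 b]_(x in `[0%R, 1%R]) (cst 1 x))%E.
  by apply: eq_integral => x _; rewrite atom_wt_prod big_nil.
by rewrite integral_cst// mul1e.
Qed.

Lemma dust_wt_ge0 q a : 0 <= dust_wt q b a.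
Proof. by have /andP[b0 _] := bcoef_bounds q a 0; rewrite mulr_ge0// bp_ge0. Qed.

Lemma dust_wt_le q a : dust_wt q b a <= bp b 0.
Proof. by have /andP[_ b1] := bcoef_bounds q a 0; rewrite ler_piMr// bp_ge0. Qed.

Lemma dust_sum_le1 q a K : dust_wt q b a + \sum_(i <- iota 1 K) bp b i <= 1.
Proof. by apply: le_trans (bp_sum_le1 K); rewrite lerD2r dust_wt_le. Qed.

Lemma jrec_ge0 q h c n : 0 <= jrec q b h c n.
Proof.
elim: n => //= n IH; rewrite mulr_ge0// /jfac.
have /andP[b0 _] := bcoef_bounds q (nth [::] h n) (nth 0%N c n).
by case: ifP => _; [rewrite mulr_ge0// bp_ge0|case: ifP => // _; rewrite bp_ge0].
Qed.

Lemma vpart_ge0 q K h : 0 <= vpart q b K h.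
Proof.
apply: colour_sum_ge0; [exact: bp_ge0| |exact: dust_wt_ge0].
by move=> a i; have /andP[] := bcoef_bounds q a i.
Qed.

Lemma vpart_le1 q K h : vpart q b K h <= 1.
Proof.
apply: colour_sum_le1; [exact: bp_ge0|exact: bcoef_bounds|exact: dust_wt_ge0|].
by move=> a; exact: dust_sum_le1.
Qed.

(** The terms are nonnegative and every finite set of colour sequences lies in a box of colours up
    to some [K], so the unordered sum is the limit of the sums over boxes. The properties of [vsd]
    below are obtained from the finite recursion through this limit. *)
Lemma vpart_cvg q h : (fun K => vpart q b K h) @ \oo --> vsd q b h.
Proof.
have nd : nondecreasing_seq (fun K => vpart q b K h).
  apply/nondecreasing_seqP => K; rewrite !vpartE -[K.+2]addn1 iotaD.
  by apply: sum_words_sub => c; exact: jrec_ge0.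
have cv : cvgn (fun K => vpart q b K h).
  apply: nondecreasing_is_cvgn => //; exists 1 => _ [K _ <-]; exact: vpart_le1.
suff -> : vsd q b h = limn (fun K => vpart q b K h) by [].
rewrite /vsd; set e := esum _ _.
suff -> : e = (limn (fun K => vpart q b K h))%:E by [].
pose A := [set c : seq nat | size c = size h].
have sumE K : (vpart q b K h)%:E =
    (\sum_(c \in [set` words (iota 0 K.+1) (size h)]) (jrec q b h c (size h))%:E)%E.
  by rewrite vpartE -sumEFin fsbig_seq// uniq_words// iota_uniq.
apply/eqP; rewrite eq_le; apply/andP; split.
  apply: ge_ereal_sup => _ [X [finX XA] <-].
  have [s Xs] : exists s : seq (seq nat), X = [set` s] by apply/finite_seqP.
  pose K := \max_(c <- s) \max_(x <- c) x.
  apply: (@le_trans _ _ (vpart q b K h)%:E); last first.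
    by rewrite lee_fin; exact: nondecreasing_cvgn_le.
  rewrite sumE; apply: lee_fsum_nneg_subset; first exact: finX.
  - exact: finite_seq.
  - move=> c; rewrite inE => Xc; rewrite inE /mkset mem_words (XA _ Xc) eqxx andTb.
    apply/allP => x xc; suff: x \in iota 0 K.+1 by [].
    rewrite mem_iota add0n ltnS.
    have cs : c \in s by move: Xc; rewrite Xs.
    apply: (@leq_trans (\max_(y <- c) y)).
      by rewrite (big_rem _ xc) /= leq_maxl.
    by rewrite /K (big_rem _ cs) /= leq_maxl.
  - by move=> c _; rewrite lee_fin jrec_ge0.
suff H K : ((vpart q b K h)%:E <= e)%E.
  have e0 : (0 <= e)%E by apply: esum_ge0 => c _; rewrite lee_fin jrec_ge0.
  have [eoo|eoo] := ltP e +oo%E; last by apply: le_trans eoo; rewrite leey.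
  have ef : e \is a fin_num by rewrite ge0_fin_numE.
  rewrite -(fineK ef) lee_fin; apply: limr_le => //; apply: nearW => K.
  by rewrite -lee_fin fineK.
apply: esum_ge; exists [set` words (iota 0 K.+1) (size h)]; last by rewrite sumE.
by split; [exact: finite_seq|move=> c /= /size_words].
Qed.

Lemma vsd_ge0 q h : 0 <= vsd q b h.
Proof.
have vc := @vpart_cvg q h; rewrite -(cvg_lim _ vc)//.
by apply: limr_ge; [apply/cvg_ex; eexists; exact: vc|apply: nearW => K; exact: vpart_ge0].
Qed.

Let vsd_unique q h l : (fun K => vpart q b K h) @ \oo --> l -> vsd q b h = l.
Proof. by move=> vc; rewrite -(cvg_lim _ vc)//; apply/esym/cvg_lim => //; exact: vpart_cvg. Qed.

Lemma vsd_nil q : vsd q b [::] = 1.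
Proof. by apply: vsd_unique; rewrite /vpart /=; exact: cvg_cst. Qed.

Lemma vsd_perm q h h' : perm_eq h h' -> vsd q b h = vsd q b h'.
Proof.
move=> hh'; apply: vsd_unique.
by under eq_fun do rewrite /vpart (colour_sum_perm _ _ _ _ _ hh'); exact: vpart_cvg.
Qed.

Lemma vsd_map q psi h : {in h &, injective psi} ->
  {in h, forall a, natoms_neg (psi a) = natoms_neg a} ->
  vsd q b (map psi h) = vsd q b h.
Proof.
move=> inj neg; apply: vsd_unique.
suff E K : vpart q b K (map psi h) = vpart q b K h.
  by under eq_fun do rewrite E; exact: vpart_cvg.
apply: (@colour_sum_map R _ _ K (bp b) (bcoef q b) (dust_wt q b) (bcoef q b)
  (dust_wt q b) psi h [::] h) => //.
- by move=> a ah; rewrite /dust_wt /bcoef neg.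
- by move=> a ah i; rewrite /bcoef neg.
Qed.

(** The factor left by the last letter in [sum_colour_sum_rcons] tends to the sum of all [bp b i],
    which is 1. *)
Lemma vsd_rcons q n h : h \in words (bitwords q) n ->
  vsd q b h = \sum_(a <- bitwords q) vsd q b (rcons h a).
Proof.
rewrite mem_words => /andP[_ hA].
have E K : \sum_(a <- bitwords q) vpart q b K (rcons h a) =
    (bp b 0 + \sum_(i <- iota 1 K) bp b i) * vpart q b K h.
  apply: (@sum_colour_sum_rcons R _ K (bp b) (bcoef q b) _ (bitwords q)) => //.
  - exact: uniq_words.
  - by rewrite /dust_wt -mulr_sumr sum_bcoef mulr1.
  - by move=> i _; exact: sum_bcoef.
have c1 : (fun K => \sum_(a <- bitwords q) vpart q b K (rcons h a)) @ \oo -->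
    \sum_(a <- bitwords q) vsd q b (rcons h a).
  by apply: cvg_sumr => a _; exact: vpart_cvg.
have c2 : (fun K => \sum_(a <- bitwords q) vpart q b K (rcons h a)) @ \oo --> 1 * vsd q b h.
  under eq_fun do rewrite E; apply: cvgM; [exact: bp_sum_cvg|exact: vpart_cvg].
by rewrite -(cvg_lim _ c1)// (cvg_lim _ c2)// mul1r.
Qed.

Lemma vsd_fiber (us us' : seq nat) h : uniq us -> uniq us' -> {subset us <= us'} ->
  h \in words (bitwords (size us)) (size h) ->
  \sum_(h' <- words (bitwords (size us')) (size h) | map (restrict_atom us us') h' == h)
    vsd (size us') b h' = vsd (size us) b h.
Proof.
move=> u1 u2 sub; rewrite mem_words => /andP[_ /allP hA].
have sz a : a \in h -> size a = size us.
  by move=> /hA; rewrite /= mem_bitwords => /eqP.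
have E K : \sum_(h' <- words (bitwords (size us')) (size h) |
      map (restrict_atom us us') h' == h) vpart (size us') b K h' = vpart (size us) b K h.
  rewrite (@sum_colour_sum_fiber R _ _ K (bp b) (bcoef (size us) b)
     (dust_wt (size us) b))//.
  - exact: uniq_words.
  - by move=> a /sz sa; rewrite /dust_wt -mulr_sumr sum_bcoef_fiber.
  - by move=> i a _ /sz sa; rewrite sum_bcoef_fiber.
rewrite -(@vsd_unique (size us) h (\sum_(h' <- words (bitwords (size us')) (size h) |
  map (restrict_atom us us') h' == h) vsd (size us') b h'))//.
under eq_fun do rewrite -E.
by apply: cvg_sumr => h' _; exact: vpart_cvg.
Qed.

End InB.

(** * Measurability of the parameters *)

Section MeasurableB.
Variable R : realType.
Notation BM := (Bmeas R).

Lemma measurable_bp i : measurable_fun setT (fun b : BM => bp b i).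
Proof.
move=> _ A mA; rewrite setTI; apply: sub_sigma_algebra.
by left; exists i, A.
Qed.

Lemma measurable_btau i : measurable_fun setT (fun b : BM => btau b i).
Proof.
move=> _ A mA; rewrite setTI; apply: sub_sigma_algebra.
by right; left; exists i, A.
Qed.

Lemma measurable_btau0 E : measurable E -> measurable_fun setT (fun b : BM => btau0 b E).
Proof.
move=> mE; rewrite (_ : (fun _ => _) = (fun b : BM => (fine (btau0 b E))%:E)).
  apply/measurable_EFinP => _ A mA; rewrite setTI; apply: sub_sigma_algebra.
  by right; right; exists E, A.
by apply/funext => b; rewrite fineK// fin_num_measure.
Qed.

Lemma measurable_to_Bmeas d (T : measurableType d) (f : T -> BM) :
  (forall i, measurable_fun setT (fun t => bp (f t) i)) ->
  (forall i, measurable_fun setT (fun t => btau (f t) i)) ->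
  (forall E, measurable E -> measurable_fun setT (fun t => btau0 (f t) E)) ->
  measurable_fun setT f.
Proof.
move=> m1 m2 m3; apply: (measurability (@Bgen R : set (set BM)) erefl).
move=> _ [_ [[i [A [mA ->]]]|[[i [A [mA ->]]]|[E [A [mE [mA ->]]]]]] <-].
- exact: m1.
- exact: m2.
- rewrite -[X in measurable X]/(setT `&` (fun t => fine (btau0 (f t) E)) @^-1` A).
  by apply: measurableT_comp => //; exact: m3.
Qed.

Definition inBset : set BM := [set b | inB b].

(** Each clause becomes a countable combination of measurable conditions. By monotonicity,
    convergence of the partial sums to 1 means that all are at most 1 and that, for each [k], some
    partial sum exceeds 1 - 1/(k+1). *)
Let inBsetE : inBset =
  (\bigcap_i [set b : BM | 0 <= bp b i]) `&`
  (\bigcap_i [set b : BM | bp b i.+2 <= bp b i.+1]) `&`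
  (\bigcap_n [set b : BM | \sum_(i < n) bp b i <= 1]) `&`
  (\bigcap_k \bigcup_n [set b : BM | 1 - k.+1%:R^-1 < \sum_(i < n) bp b i]) `&`
  (\bigcap_i [set b : BM | 0 <= btau b i.+1]) `&`
  (\bigcap_i [set b : BM | btau b i.+1 <= 1]) `&`
  [set b : BM | fine (btau0 b `[0%R, 1%R]) = 1].
Proof.
apply/seteqP; split=> b.
  move=> hb; case: (hb) => p0 pd ps t01 t1.
  have nd : nondecreasing_seq (fun n => \sum_(i < n) bp b i).
    by apply/nondecreasing_seqP => n; rewrite big_ord_recr lerDl.
  do !split.
  - by move=> i _; exact: p0.
  - by move=> i _; exact: pd.
  - move=> n _ /=; have := nondecreasing_cvgn_le nd (cvgP _ ps) n.
    by rewrite (cvg_lim _ ps).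
  - move=> k _; have k0 : (0 : R) < k.+1%:R^-1 by rewrite invr_gt0.
    move/cvgrPdist_lt : ps => /(_ _ k0)[n _ /(_ n (leqnn n)) /=].
    rewrite ltr_norml => /andP[_ H]; exists n => //=.
    by rewrite ltrBlDr addrC -ltrBlDr.
  - by move=> i _ /=; have /andP[] := t01 i.+1 isT.
  - by move=> i _ /=; have /andP[] := t01 i.+1 isT.
  - by rewrite /= t1.
move=> [[[[[[p0 pd] p1] ps] t0] t1] t2].
split.
- by move=> i; exact: p0.
- by case=> // i _; exact: pd.
- have nd : nondecreasing_seq (fun n => \sum_(i < n) bp b i).
    by apply/nondecreasing_seqP => n; rewrite big_ord_recr lerDl; exact: p0.
  apply/cvgrPdist_lt => e e0.
  have [k ke] : exists k, k.+1%:R^-1 < e.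
    have [k _ /(_ k (leqnn k))] := near_infty_natSinv_lt (PosNum e0).
    by move=> ?; exists k.
  have [n _ /= Hn] := ps k Logic.I.
  exists n => // m /= nm; rewrite ger0_norm ?subr_ge0; last exact: p1.
  apply: le_lt_trans ke; rewrite lerBlDr.
  move: Hn; rewrite ltrBlDr => /ltW/le_trans; apply.
  by rewrite addrC lerD2l; exact: nd.
- by case=> // i _; rewrite (t0 i Logic.I) (t1 i Logic.I).
- by rewrite -(@fineK _ (btau0 b _)) ?fin_num_measure//; congr EFin; exact: t2.
Qed.

Lemma measurable_inB : measurable inBset.
Proof.
have mle (f g : BM -> R) : measurable_fun setT f -> measurable_fun setT g ->
    measurable [set b | f b <= g b].
  move=> mf mg; have := measurable_fun_ler mf mg => /(_ measurableT [set true]).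
  by rewrite setTI; apply.
have mlt (f g : BM -> R) : measurable_fun setT f -> measurable_fun setT g ->
    measurable [set b | f b < g b].
  move=> mf mg; have := measurable_fun_ltr mf mg => /(_ measurableT [set true]).
  by rewrite setTI; apply.
have msum n : measurable_fun setT (fun b : BM => \sum_(i < n) bp b i).
  by apply: measurable_sum => i; exact: measurable_bp.
rewrite inBsetE; repeat apply: measurableI.
- by apply: bigcap_measurable => // i _; apply: mle => //; exact: measurable_bp.
- by apply: bigcap_measurable => // i _; apply: mle; exact: measurable_bp.
- by apply: bigcap_measurable => // i _; exact: mle.
- apply: bigcap_measurable => // k _; apply: bigcup_measurable => n _.
  by apply: mlt.
- by apply: bigcap_measurable => // i _; apply: mle => //; exact: measurable_btau.
- by apply: bigcap_measurable => // i _; apply: mle => //; exact: measurable_btau.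
- have m : measurable_fun setT (fun b : BM => fine (btau0 b `[0%R, 1%R])).
    apply: measurableT_comp => //; apply: measurable_btau0; exact: measurable_itv.
  by have := m measurableT [set 1] (measurable_set1 _); rewrite setTI.
Qed.

Definition B_default : BM :=
  mkB (fun i => (i == 0%N)%:R) (fun=> 0) (\d_(0 : R) : probability R R).

Lemma B_default_inB : inB B_default.
Proof.
split=> //=.
- apply: cvg_near_cst; exists 1%N => // n /= n0.
  by case: n n0 => // n _; rewrite big_ord_recl big1 ?addr0.
- by move=> j _; rewrite lexx ler01.
- by rewrite diracE mem_set//= in_itv /= lexx ler01.
Qed.

(* Outside the parameter space B the parameters are replaced by a fixed point
   of B, so that every later function is defined and measurable everywhere. *)
Definition to_B (b : BM) : BM := if `[< inB b >] then b else B_default.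

Lemma to_B_id b : inB b -> to_B b = b.
Proof. by rewrite /to_B => /asboolP ->. Qed.

Lemma to_B_inB b : inB (to_B b).
Proof. by rewrite /to_B; case: asboolP => // _; exact: B_default_inB. Qed.

Lemma measurable_to_B : measurable_fun setT to_B.
Proof.
apply: measurable_fun_ifT => //.
apply: (measurable_fun_bool true) => //; rewrite setTI.
suff -> : (fun b : BM => `[< inB b >]) @^-1` [set true] = inBset.
  exact: measurable_inB.
by apply/seteqP; split=> b /= /asboolP.
Qed.

Lemma measurable_bcoef q a c : measurable_fun setT (fun b : BM => bcoef q (to_B b) a c).
Proof.
have mB := measurable_to_B; rewrite /bcoef.
have [c0|c0] := boolP (0 < c)%N; rewrite ?c0 ?(negbTE c0) /=.
  have mt : measurable_fun setT (fun b : BM => btau (to_B b) c).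
    exact: (measurableT_comp (measurable_btau c) mB).
  apply: measurable_funM; apply: measurable_funX => //.
  exact: measurable_funB.
apply: (@measurableT_comp _ _ _ _ _ _ fine) => //.
pose f (x : R) := (x ^+ natoms_neg a * (1 - x) ^+ (q - natoms_neg a))%:E.
under eq_fun => b do rewrite integral_mkcond.
(* The dust measure is a kernel from parameters to the line: its values on measurable sets are among
   the generators of the sigma-algebra. *)
apply: (@measurable_fun_integral_kernel _ _ BM R R (fun b => btau0 (to_B b))).
- move=> U mU; exact: (measurableT_comp (measurable_btau0 mU) mB).
- move=> x; rewrite patchE; case: ifPn => // /set_mem /=.
  rewrite in_itv /= => /andP[x0 x1].
  by rewrite lee_fin mulr_ge0// exprn_ge0// subr_ge0.
- apply/(measurable_restrictT _ _).1; first exact: measurable_itv.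
  apply/measurable_EFinP; apply: measurable_funTS; apply: measurable_funM => //.
  by apply: measurable_funX; apply: measurable_funB.
Qed.

Lemma measurable_vsd q h : measurable_fun setT (fun b : BM => vsd q (to_B b) h).
Proof.
apply: (@measurable_fun_cvg _ _ _ _ (fun K b => vpart q (to_B b) K h)); last first.
  by move=> b _; apply: vpart_cvg; exact: to_B_inB.
move=> K; rewrite /vpart; elim: h [::] => [|a h IH] u //=.
have mp i : measurable_fun setT (fun b : BM => bp (to_B b) i).
  exact: (measurableT_comp (measurable_bp i) measurable_to_B).
apply: measurable_funD.
  apply: measurable_funM => //; apply: measurable_funM => //.
  exact: measurable_bcoef.
apply: measurable_sum => i; apply: measurable_funM => //; apply: measurable_funM => //.
rewrite /colour_wt; have [iu|iu] := boolP (i \in unzip1 u); last exact: measurable_bcoef.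
exact: measurable_cst.
Qed.

End MeasurableB.

(** * Laws and mixtures *)

(** In a language without equality, truth passes along a surjection when the predicates are pulled
    back. It serves for a permutation of [nat]. *)
Lemma sat_transport (D D' : Type) (g : D' -> D) (ci : nat -> D') pi env f :
  (forall y, exists x, g x = y) ->
  sat (g \o ci) pi (g \o env) f <-> sat ci (fun i x => pi i (g x)) env f.
Proof.
move=> gs; have cons_g x e : cons_env (g x) (g \o e) = g \o cons_env x e.
  by apply/funext => -[].
elim: f env => [|i [n|c]|h IH|h IH h' IH'|h IH h' IH'|h IH h' IH'|h IH|h IH] env //=.
- by rewrite IH.
- by rewrite IH IH'.
- by rewrite IH IH'.
- by rewrite IH IH'.
- split=> [[y]|[x]].
    by have [x <-] := gs y; rewrite cons_g IH; exists x.
  by rewrite -IH -cons_g; exists (g x).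
- split=> H x.
    by rewrite -IH -cons_g; exact: H.
  by have [y <-] := gs x; rewrite cons_g IH; exact: H.
Qed.

Lemma sat_rename_const (D : Type) (ci : nat -> D) pi env s f :
  sat ci pi env (rename_const s f) <-> sat (ci \o s) pi env f.
Proof.
elim: f env => [|i [n|c]|h IH|h IH h' IH'|h IH h' IH'|h IH h' IH'|h IH|h IH] env //=.
- by rewrite IH.
- by rewrite IH IH'.
- by rewrite IH IH'.
- by rewrite IH IH'.
- by split=> -[x] /IH; exists x.
- by split=> H x; apply/IH; exact: H.
Qed.

Lemma sat_rename_pred (D : Type) (ci : nat -> D) pi env s f :
  sat ci pi env (rename_pred s f) <-> sat ci (fun i => pi (s i)) env f.
Proof.
elim: f env => [|i [n|c]|h IH|h IH h' IH'|h IH h' IH'|h IH h' IH'|h IH|h IH] env //=.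
- by rewrite IH.
- by rewrite IH IH'.
- by rewrite IH IH'.
- by rewrite IH IH'.
- by split=> -[x] /IH; exists x.
- by split=> H x; apply/IH; exact: H.
Qed.

Lemma sentence_rename_const L s f : sentence L (rename_const s f) = sentence L f.
Proof.
rewrite /sentence; congr (_ && _); last by elim: f => //= h -> h' ->.
by elim: f 0%N => [|i [n|c]|h IH|h IH h' IH'|h IH h' IH'|h IH h' IH'|h IH|h IH] k //=;
  rewrite ?IH ?IH'.
Qed.

Lemma qfree_rename_const s f : qfree (rename_const s f) = qfree f.
Proof. by elim: f => //= h -> h' ->. Qed.

Lemma sentence_rename_pred L s f : (forall i, (s i \in L) = (i \in L)) ->
  sentence L (rename_pred s f) = sentence L f.
Proof.
move=> sL; rewrite /sentence; congr (_ && _).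
  by elim: f 0%N => [|i [n|c]|h IH|h IH h' IH'|h IH h' IH'|h IH h' IH'|h IH|h IH] k //=;
    rewrite ?IH ?IH'.
by elim: f => //= h -> h' ->.
Qed.

Lemma qfree_rename_pred s f : qfree (rename_pred s f) = qfree f.
Proof. by elim: f => //= h -> h' ->. Qed.

Lemma const_bound_rename_pred s f : const_bound (rename_pred s f) = const_bound f.
Proof.
by elim: f => [|i [n|c]|g IH|g IH g' IH'|g IH g' IH'|g IH g' IH'|g IH|g IH] //=;
  rewrite IH IH'.
Qed.

Lemma sat_rename_const_bij (pi : nat -> nat -> Prop) env s f :
  bijective s -> closed_at 0 f ->
  sat id pi env (rename_const s f) <-> sat id (fun i c => pi i (s c)) env f.
Proof.
move=> [s' sK s'K] cf; rewrite sat_rename_const.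
rewrite -(@sat_transport nat nat s id pi env f) => [|y]; last by exists (s' y).
exact: sat_sentence_env.
Qed.

(** * Marginals of [vsd] and the random structure realising it *)

Section VsdWindow.
Variables (R : realType) (b : Braw R) (q : nat).
Hypothesis hb : inB b.
Notation A := (bitwords q).

Lemma sum_vsd_cat n k h : h \in words A n ->
  \sum_(t <- words A k) vsd q b (h ++ t) = vsd q b h.
Proof.
move=> hn; elim: k => [|k IH]; first by rewrite sum_words0 cats0.
rewrite sum_words_rcons -IH [LHS]big_seq_cond [RHS]big_seq_cond.
apply: eq_bigr => t; rewrite andbT => tk.
rewrite (@vsd_rcons _ _ hb q (n + k)).
  by apply: eq_bigr => a _; rewrite rcons_cat.
move: hn tk; rewrite !mem_words size_cat all_cat.
by move=> /andP[/eqP -> ->] /andP[/eqP -> ->]; rewrite eqxx.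
Qed.

(** Moving the constants of [C] to the front does not change [vsd]; the other constants are then
    summed out. *)
Lemma sum_vsd_window N C h : uniq C -> all (gtn N) C -> h \in words A (size C) ->
  \sum_(g <- words A N | [seq nth [::] g c | c <- C] == h) vsd q b g = vsd q b h.
Proof.
move=> uC CN hn.
pose s := C ++ [seq c <- iota 0 N | c \notin C].
have ps : perm_eq s (iota 0 N).
  apply: uniq_perm; [|exact: iota_uniq|].
    rewrite cat_uniq uC filter_uniq ?iota_uniq// andbT /=; apply/hasPn => c.
    by rewrite mem_filter => /andP[].
  move=> c; rewrite mem_cat mem_filter mem_iota add0n /=.
  by case: (boolP (c \in C)) => //= /(allP CN).
pose phi g : seq (seq bool) := [seq nth [::] g c | c <- s].
have sz g : g \in words A N -> size g = N by exact: size_words.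
have pphi g : g \in words A N -> perm_eq (phi g) g.
  move=> /sz sg; rewrite -[X in perm_eq _ X](mkseq_nth [::]) sg.
  exact: perm_map.
pose F g := if take (size C) g == h then vsd q b g else 0.
have ss : size s = N by rewrite (perm_size ps) size_iota.
transitivity (\sum_(g <- words A N) F (phi g)).
  rewrite big_mkcond big_seq_cond [RHS]big_seq_cond; apply: eq_bigr => g.
  rewrite andbT => gN; rewrite /F -(vsd_perm hb _ (pphi g gN)); congr (if _ == _ then _ else _).
  by rewrite /phi /s map_cat take_size_cat ?size_map.
have phiN g : g \in words A N -> phi g \in words A N.
  move=> gN; move: (gN); rewrite !mem_words => /andP[_ gA].
  by rewrite size_map ss eqxx (perm_all _ (pphi g gN)).
have phi_inj : {in words A N &, injective phi}.
  move=> g g' gN gN' /eq_in_map E; apply: (@eq_from_nth _ [::]); first by rewrite !sz.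
  by move=> c; rewrite sz// => cN; apply: E; rewrite (perm_mem ps) mem_iota.
have uphi : uniq (map phi (words A N)).
  by rewrite map_inj_in_uniq//; do 2! apply: uniq_words.
have pw : perm_eq (map phi (words A N)) (words A N).
  apply: uniq_perm => //; first by do 2! apply: uniq_words.
  apply: (uniq_min_size uphi _ _).2; last by rewrite size_map.
  by move=> _ /mapP[g gN ->]; exact: phiN.
rewrite -(big_map phi xpredT F) (perm_big _ pw) /=.
have CleN : (size C <= N)%N by rewrite -ss /s size_cat leq_addr.
rewrite -(subnKC CleN) sum_words_cat (bigD1_seq h)//=; last by do 2! apply: uniq_words.
rewrite [X in _ + X]big1_seq ?addr0 => [|g /andP[gh gC]].
  rewrite -(sum_vsd_cat (N - size C) hn); apply: eq_bigr => t _.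
  by rewrite /F take_size_cat ?eqxx// (size_words hn).
by rewrite big1// => t _; rewrite /F take_size_cat ?(size_words gC)// (negbTE gh).
Qed.

End VsdWindow.

Section Law.
Variables (R : realType) (L : seq nat).
Notation us := (undup L).
Notation Q := (size (undup L)).
Notation A := (bitwords (size (undup L))).
Notation BM := (Bmeas R).

Let m (b : BM) h := vsd Q (to_B b) h.

Let m_meas h : measurable_fun setT (m ^~ h). Proof. exact: measurable_vsd. Qed.
Let m_ge0 b h : 0 <= m b h. Proof. exact/vsd_ge0/to_B_inB. Qed.
Let m_nil b : m b [::] = 1. Proof. exact/vsd_nil/to_B_inB. Qed.
Let m_rcons b n h : h \in words A n -> m b h = \sum_(a <- A) m b (rcons h a).
Proof. by move=> hn; apply: vsd_rcons hn; exact: to_B_inB. Qed.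

(** One structure measurable jointly in the parameter and the uniform point: fixing the parameter
    gives [law], randomising it gives [mixture]. *)
Definition law_struct (bu : BM * R) (i c : nat) : bool :=
  tree_bit Q (fun b h => vsd Q (to_B b) h) bu (index i us) c.

Lemma measurable_law_struct i c : measurable [set bu | law_struct bu i c].
Proof. exact: (@measurable_tree_bit _ BM R Q m m_meas (index i us) c). Qed.

Lemma measurable_law_section b i c : measurable [set u | law_struct (b, u) i c].
Proof.
have := measurable_xsection b (measurable_law_struct i c).
congr (measurable _); apply/seteqP; split=> u; rewrite /xsection /= inE.
all: by [].
Qed.

(** A concrete version of [vfun], available for every parameter thanks to [to_B] and measurable in
    it. *)
Definition law (b : BM) : fml -> R := prob_of (@unif R) (fun u => law_struct (b, u)).

Lemma law_probfun b L' : probfun L' (law b).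
Proof. by apply: random_probfun => i c; exact: measurable_law_section. Qed.

Lemma law_sd b h : wf_sd L h -> law b (sd L h) = vsd Q (to_B b) h.
Proof.
move=> wf; have hn : h \in words A (size h).
  rewrite mem_words eqxx; apply/allP => a /(allP wf).
  by rewrite /= mem_bitwords.
apply/EFin_inj; rewrite -[RHS]/((m b h)%:E) -(@unif_tree_word _ BM R Q m m_ge0 m_nil m_rcons (size h) h b hn).
rewrite /law prob_ofE; last by move=> i c; exact: measurable_law_section.
congr (unif _); apply/seteqP; split=> u; rewrite /models /= sat_sd//.
  move=> H c j cn jQ; have jL : nth 0%N us j \in L by rewrite -mem_undup mem_nth.
  have := H c _ cn jL; rewrite /law_struct /table_pred index_uniq ?undup_uniq//.
  by move=> E; apply/idP/idP => /E.
by move=> H c i cn iL; rewrite /law_struct H// index_mem mem_undup.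
Qed.

Lemma law_qfree b f N : qfree f -> sentence L f -> (const_bound f <= N)%N ->
  law b f = \sum_(g <- words A N | table_sat L g f) vsd Q (to_B b) g.
Proof.
move=> qf sf cf; rewrite (probfun_qfree (law_probfun b L) qf sf cf).
rewrite [LHS]big_seq_cond [RHS]big_seq_cond; apply: eq_bigr => g /andP[gN _].
by rewrite law_sd//; exact: words_wf_sd gN.
Qed.

Lemma law_unique b w : probfun L w ->
  (forall h, wf_sd L h -> w (sd L h) = vsd Q (to_B b) h) ->
  forall f, sentence L f -> w f = law b f.
Proof.
move=> hw wE; apply: (probfun_unique hw (law_probfun b L)) => h wf.
by rewrite wE// law_sd.
Qed.

(** By uniqueness only state descriptions matter. A renamed one speaks of the constants [s 0],
    [s 1], and so on, and its probability is the marginal of [vsd] on that window. *)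
Lemma law_rename_const b s f : bijective s -> sentence L f ->
  law b (rename_const s f) = law b f.
Proof.
move=> bs sf.
pose w := prob_of (@unif R) (fun u i c => law_struct (b, u) i (s c)).
have wE g : closed_at 0 g -> w g = law b (rename_const s g).
  move=> cg; rewrite /w /law /prob_of; congr (fine (unif _)).
  apply/seteqP; split=> u; rewrite /models /=.
    by rewrite (sat_rename_const_bij _ _ bs cg).
  by rewrite -(sat_rename_const_bij (fun i c => law_struct (b, u) i c) _ bs cg).
rewrite -wE; last by case/andP: sf.
apply: law_unique sf; first by apply: random_probfun => i c; exact: measurable_law_section.
move=> h wf; have [cS _] := andP (sentence_sd L h); rewrite wE//.
pose C := map s (iota 0 (size h)).
pose N := maxn (const_bound (rename_const s (sd L h))) (\max_(c <- C) c).+1.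
have hn : h \in words A (size C).
  rewrite mem_words size_map size_iota eqxx; apply/allP => a /(allP wf).
  by rewrite /= mem_bitwords.
have uC : uniq C by rewrite map_inj_uniq ?iota_uniq//; exact: bij_inj.
have CN : all (gtn N) C.
  apply/allP => c cC; rewrite /= /N leq_max ltnS (big_rem _ cC) /= leq_maxl orbT//.
rewrite (@law_qfree b _ N); first last.
- by rewrite leq_maxl.
- by rewrite sentence_rename_const sentence_sd.
- by rewrite qfree_rename_const qfree_sd.
rewrite -(sum_vsd_window (to_B_inB b) uC CN hn).
rewrite big_seq_cond [RHS]big_seq_cond; apply: eq_bigl => g.
case: (boolP (g \in words A N)) => //= gN.
have sz k (l : seq (seq bool)) c : l \in words A k -> (c < k)%N -> size (nth [::] l c) = Q.
  move=> lk ck; apply/eqP; rewrite -mem_bitwords.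
  by move: lk; rewrite mem_words => /andP[/eqP sl /allP]; apply; rewrite mem_nth// sl.
rewrite size_map size_iota in hn.
have sN c : (c < size h)%N -> (s c < N)%N.
  by move=> ch; apply: (allP CN); rewrite map_f// mem_iota.
apply/asboolP/eqP; rewrite (sat_rename_const_bij _ _ bs cS) sat_sd// => H.
  apply: (@eq_from_nth _ [::]); rewrite !size_map size_iota// => c ch.
  rewrite (nth_map 0%N) ?size_map ?size_iota// (nth_map 0%N) ?size_iota// nth_iota// add0n.
  apply: (@eq_from_nth _ false); first by rewrite (sz N g)// ?(sz _ _ _ hn)// sN.
  rewrite (sz N g) ?sN// => j jQ.
  have jL : nth 0%N us j \in L by rewrite -mem_undup mem_nth.
  have := H c _ ch jL; rewrite /table_pred index_uniq ?undup_uniq//.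
  by move=> E; apply/idP/idP => /E.
move=> c i ch iL; rewrite /table_pred -H (nth_map 0%N) ?size_map ?size_iota//.
by rewrite (nth_map 0%N) ?size_iota// nth_iota.
Qed.

End Law.

(** The tables over [L'] satisfying a state description over [L] are those that [restrict_atom] maps
    to it; their weights add up by [vsd_fiber]. *)
Lemma law_sub (R : realType) (L L' : seq nat) (b : Bmeas R) f :
  {subset L <= L'} -> sentence L f -> law L' b f = law L b f.
Proof.
move=> LL'; apply: law_unique; first exact: law_probfun.
move=> h wf; have sL' : sentence L' (sd L h) by apply: sentence_sub LL' (sentence_sd L h).
rewrite (law_qfree b (qfree_sd L h) sL' (const_bound_sd L h)).
have sub : {subset undup L <= undup L'} by move=> i; rewrite !mem_undup; exact: LL'.
have hn : h \in words (bitwords (size (undup L))) (size h).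
  rewrite mem_words eqxx; apply/allP => a /(allP wf).
  by rewrite /= mem_bitwords.
rewrite -(vsd_fiber (to_B_inB b) (undup_uniq L) (undup_uniq L') sub hn).
rewrite big_seq_cond [RHS]big_seq_cond; apply: eq_bigl => g.
case: (boolP (g \in words _ _)) => //= gN; have sg := size_words gN.
apply/asboolP/eqP; rewrite sat_sd// => H.
  apply: (@eq_from_nth _ [::]); rewrite size_map// sg => c ch.
  rewrite (nth_map [::]) ?sg//.
  have sc : size (nth [::] h c) = size (undup L) by apply/eqP/(allP wf)/mem_nth.
  apply: (@eq_from_nth _ false); rewrite size_map ?sc// => j jQ.
  have ju : nth 0%N (undup L) j \in undup L by exact: mem_nth.
  rewrite (nth_map 0%N)//; have := H c (nth 0%N (undup L) j) ch.
  rewrite -(mem_undup L) ju /table_pred (index_uniq _ _ (undup_uniq L))//.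
  by move=> /(_ isT) E; apply/idP/idP => /E.
move=> c i ch iL; rewrite /table_pred -H (nth_map [::]) ?sg//.
by rewrite (nth_map 0%N) ?index_mem ?mem_undup// nth_index ?mem_undup.
Qed.

(** The renamed state description is a restriction along the permuted list [map s (undup L)], so the
    fibre sum for sublanguages applies again. *)
Lemma law_rename_pred (R : realType) (L : seq nat) (b : Bmeas R) s f :
  bijective s -> (forall i, (s i \in L) = (i \in L)) -> sentence L f ->
  law L b (rename_pred s f) = law L b f.
Proof.
move=> bs sL sf.
pose w := prob_of (@unif R) (fun u i c => law_struct L (b, u) (s i) c).
have wE g : w g = law L b (rename_pred s g).
  rewrite /w /law /prob_of; congr (fine (unif _)).
  by apply/seteqP; split=> u; rewrite /models /= sat_rename_pred.
rewrite -wE; apply: law_unique sf.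
  by apply: random_probfun => i c; exact: measurable_law_section.
move=> h wf; rewrite wE.
have sS : sentence L (rename_pred s (sd L h)) by rewrite sentence_rename_pred ?sentence_sd.
have qS : qfree (rename_pred s (sd L h)) by rewrite qfree_rename_pred qfree_sd.
have cS : (const_bound (rename_pred s (sd L h)) <= size h)%N.
  by rewrite const_bound_rename_pred const_bound_sd.
rewrite (law_qfree b qS sS cS).
have us : uniq (map s (undup L)) by rewrite map_inj_uniq ?undup_uniq//; exact: bij_inj.
have sub : {subset map s (undup L) <= undup L}.
  by move=> _ /mapP[i + ->]; rewrite !mem_undup sL.
have hn : h \in words (bitwords (size (map s (undup L)))) (size h).
  rewrite mem_words eqxx size_map; apply/allP => a /(allP wf).
  by rewrite /= mem_bitwords.
have := vsd_fiber (to_B_inB b) us (undup_uniq L) sub hn; rewrite size_map => <-.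
rewrite big_seq_cond [RHS]big_seq_cond; apply: eq_bigl => g.
case: (boolP (g \in words _ _)) => //= gN; have sg := size_words gN.
apply/asboolP/eqP; rewrite sat_rename_pred sat_sd// => H.
  apply: (@eq_from_nth _ [::]); rewrite size_map// sg => c ch.
  rewrite (nth_map [::]) ?sg//.
  have sc : size (nth [::] h c) = size (undup L) by apply/eqP/(allP wf)/mem_nth.
  apply: (@eq_from_nth _ false); rewrite !size_map ?sc// => j jQ.
  have ju : nth 0%N (undup L) j \in undup L by exact: mem_nth.
  rewrite (nth_map 0%N) ?size_map// (nth_map 0%N)//.
  have := H c (nth 0%N (undup L) j) ch.
  rewrite -(mem_undup L) ju /table_pred (index_uniq _ _ (undup_uniq L))//.
  by move=> /(_ isT) E; apply/idP/idP => /E.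
move=> c i ch iL; rewrite /table_pred -H (nth_map [::]) ?sg//.
have iu : (index i (undup L) < size (undup L))%N by rewrite index_mem mem_undup.
by rewrite (nth_map 0%N) ?size_map// (nth_map 0%N)// nth_index ?mem_undup.
Qed.

(** Equal spectra mean that the distinct atoms of both sides carry the same multiset of pairs
    (number of negations, multiplicity). A matching of these pairs is the renaming [psi]. *)
Lemma same_spectrum_perm (h h' : seq (seq bool)) : same_spectrum h h' ->
  exists psi, [/\ {in h &, injective psi},
    {in h, forall a, natoms_neg (psi a) = natoms_neg a} & perm_eq (map psi h) h'].
Proof.
move=> hh'.
pose key (g : seq (seq bool)) a := (natoms_neg a, count (pred1 a) g).
have count_key g i k : count_mem (i, k) (map (key g) (undup g)) = count_mem k (Mspec i g).
  rewrite /Mspec !count_map count_filter; apply: eq_count => a /=.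
  by rewrite xpair_eqE andbC.
have pk : perm_eq (map (key h) (undup h)) (map (key h') (undup h')).
  by apply/allP => -[i k] _ /=; rewrite !count_key; apply/eqP/permP/hh'.
have [Is pIs E] := perm_iotaP (0%N, 0%N) pk.
pose s := [seq nth [::] (undup h') i | i <- Is].
have sIs : size Is = size (undup h').
  by rewrite (perm_size pIs) size_iota size_map.
have ps : perm_eq s (undup h').
  rewrite -[X in perm_eq _ X](mkseq_nth [::]); apply: perm_map.
  by rewrite size_map in pIs.
have us : uniq s by rewrite (perm_uniq ps) undup_uniq.
have ss : size s = size (undup h).
  by have := congr1 size E; rewrite !size_map.
pose psi a := nth [::] s (index a (undup h)).
have keyE a : a \in h -> key h' (psi a) = key h a.
  move=> ah; have ia : (index a (undup h) < size (undup h))%N by rewrite index_mem mem_undup.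
  have := congr1 (fun t => nth (0%N, 0%N) t (index a (undup h))) E.
  rewrite /= (nth_map [::])// nth_index ?mem_undup// => ->.
  have iI : (index a (undup h) < size Is)%N by rewrite sIs -(perm_size ps) ss.
  rewrite /psi /s !(nth_map 0%N)// (nth_map [::])//.
  have := mem_nth 0%N iI.
  by rewrite (perm_mem pIs) mem_iota size_map.
have inj : {in h &, injective psi}.
  move=> a c ah ch /eqP; rewrite /psi nth_uniq ?ss ?index_mem ?mem_undup//.
  by move=> /eqP /(congr1 (nth [::] (undup h))); rewrite !nth_index ?mem_undup.
have psih' a : a \in h -> psi a \in h'.
  by move=> ah; rewrite -mem_undup -(perm_mem ps) mem_nth// ss index_mem mem_undup.
exists psi; split => //.
  by move=> a ah; have [] := keyE a ah.
have surj x : x \in h' -> exists2 a, a \in h & psi a = x.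
  rewrite -mem_undup -(perm_mem ps) => /(nthP [::])[i]; rewrite ss => iu <-.
  exists (nth [::] (undup h) i); first by rewrite -mem_undup mem_nth.
  by rewrite /psi index_uniq ?undup_uniq.
apply/allP => x; rewrite mem_cat => hx /=; apply/eqP; rewrite count_map.
have [a ah <-] : exists2 a, a \in h & psi a = x.
  by case/orP: hx => [/mapP[a ah ->]|/surj//]; exists a.
have [_ ->] := keyE a ah; apply: eq_in_count => c ch /=.
by apply/eqP/eqP => [/inj ->|->].
Qed.

Lemma vsd_spectrum (R : realType) (b : Braw R) q h h' : inB b ->
  same_spectrum h h' -> vsd q b h = vsd q b h'.
Proof.
move=> hb /same_spectrum_perm[psi [inj neg p]].
by rewrite -(vsd_perm hb q p) vsd_map.
Qed.

Lemma undup_Lq q : undup (Lq q) = Lq q.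
Proof. exact/undup_id/iota_uniq. Qed.

(** [law] witnesses that the extension chosen by epsilon exists, and uniqueness identifies the two
    on sentences. *)
Lemma vfun_law (R : realType) (q : nat) (b : Bmeas R) f : inB b ->
  sentence (Lq q) f -> vfun q b f = law (Lq q) b f.
Proof.
move=> hb sf.
have sQ : size (undup (Lq q)) = q by rewrite undup_Lq size_iota.
have spec : exists v, probfun (Lq q) v /\
    forall h, wf_sd (Lq q) h -> v (sd (Lq q) h) = vsd q b h.
  exists (law (Lq q) b); split; first exact: law_probfun.
  by move=> h wf; rewrite law_sd// sQ to_B_id.
have [vp vE] := ClassicalEpsilon.epsilon_spec (inhabits (fun=> 0 : R)) _ spec.
apply: (law_unique vp _ sf) => h wf.
by rewrite vE// sQ to_B_id.
Qed.

(** * Mixtures over the parameters *)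

Section Mixture.
Variables (R : realType) (mu : probability (Bmeas R) R) (L : seq nat).

Let P : probability (Bmeas R * R)%type R := (mu \x (@unif R))%E.

(** Randomising the parameter inside one structure makes the mixture a probability function at once,
    without exchanging limits and integrals. *)
Definition mixture : fml -> R := prob_of P (law_struct L).

Lemma mixture_probfun L' : probfun L' mixture.
Proof. by apply: random_probfun => i c; exact: measurable_law_struct. Qed.

Lemma mixtureE f : (mixture f)%:E = (\int[mu]_b (law L b f)%:E)%E.
Proof.
rewrite /mixture prob_ofE; last by move=> i c; exact: measurable_law_struct.
rewrite /P /product_measure1 /=; apply: eq_integral => b _.
rewrite /law prob_ofE; last by move=> i c; exact: measurable_law_section.
congr (unif _); apply/seteqP; split=> u; rewrite /xsection /= inE.
all: by [].
Qed.

Lemma measurable_law f : measurable_fun setT (fun b : Bmeas R => (law L b f)%:E).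
Proof.
have mM : measurable (models (@law_struct R L) f).
  by apply: measurable_models => i c; exact: measurable_law_struct.
have := measurable_fun_xsection (@unif R) mM; congr measurable_fun.
apply/funext => b; rewrite /= /law prob_ofE; last by move=> i c; exact: measurable_law_section.
congr (unif _); apply/seteqP; split=> u; rewrite /xsection /= inE.
all: by [].
Qed.

End Mixture.

Section IntegralOffNull.
Context d (T : measurableType d) (R : realType).
Variables (mu : {measure set T -> \bar R}) (D : set T).
Hypotheses (mD : measurable D) (D0 : mu (~` D) = 0%E).
Import HBNNSimple.
Local Open Scope ereal_scope.

Let integral_le (f g : T -> \bar R) : (forall x, 0 <= f x) -> (forall x, 0 <= g x) ->
  (forall x, D x -> f x = g x) -> \int[mu]_x f x <= \int[mu]_x g x.
Proof.
move=> f0 g0 fg; rewrite !ge0_integralTE//; apply: ge_ereal_sup => _ [h /= hf <-].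
have pE x : proj_nnsfun h mD x = if x \in D then h x else 0%R.
  by rewrite -mrestrict patchE.
have -> : sintegral mu h = sintegral mu (proj_nnsfun h mD).
  rewrite -!integralT_nnsfun.
  rewrite (@ge0_negligible_integral _ _ _ _ setT (~` D))//; last 3 first.
  - exact: measurableC.
  - exact/measurable_EFinP.
  - by move=> x _; rewrite lee_fin.
  rewrite setTD setCK integral_mkcond; apply: eq_integral => x _.
  by rewrite patchE pE; case: ifP.
apply: ereal_sup_ubound; exists (proj_nnsfun h mD) => // x.
rewrite pE; have [xD|//] := boolP (x \in D).
by rewrite -fg//; exact: set_mem.
Qed.

(** Stated for arbitrary functions, since [vfun] is uncontrolled outside [inB]. The integral of a
    nonnegative function is a supremum over simple functions below it, and cutting these down to [D]
    leaves their integrals unchanged. *)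
Lemma integral_eq_off_null (f g : T -> \bar R) : (forall x, D x -> f x = g x) ->
  \int[mu]_x f x = \int[mu]_x g x.
Proof.
move=> fg; rewrite integralE [RHS]integralE; congr (_ - _); apply/eqP;
  rewrite eq_le; apply/andP; split; apply: integral_le => // x Dx;
  by rewrite ?funeposE ?funenegE fg.
Qed.

End IntegralOffNull.

(** The invariances and the restriction property hold for [law] at every single parameter, so they
    pass to the mixtures of all languages under the same [mu]. *)
Lemma ULi_of_mixture (R : realType) (q : nat) (w : fml -> R)
    (mu : probability (Bmeas R) R) : mu (@inBset R) = 1%E ->
  (forall f, sentence (Lq q) f -> (w f)%:E = (\int[mu]_b (vfun q b f)%:E)%E) ->
  ULi_SPx q w.
Proof.
move=> muB wE.
have muB0 : mu (~` @inBset R) = 0%E.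
  by rewrite probability_setC ?muB ?subee//; exact: measurable_inB.
have mixE L f g L' : (forall b : Bmeas R, law L b f = law L' b g) ->
    mixture mu L f = mixture mu L' g.
  move=> E; apply/EFin_inj; rewrite !mixtureE.
  by apply: eq_integral => b _; congr EFin; exact: E.
exists (mixture mu); split.
- move=> L; split.
  + exact: mixture_probfun.
  + by move=> s bs f sf; apply: mixE => b; exact: law_rename_const.
  + by move=> s bs sL f sf; apply: mixE => b; exact: law_rename_pred.
  + move=> h h' wf wf' _ hh'; apply: mixE => b; rewrite !law_sd//.
    by apply: vsd_spectrum => //; exact: to_B_inB.
- move=> f sf; apply/EFin_inj; rewrite wE// mixtureE.
  apply/esym/(integral_eq_off_null (@measurable_inB R) muB0) => b hb.
  by rewrite vfun_law.
- by move=> L L' f LL' sf; apply: mixE => b; exact: law_sub.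
Qed.

(** * Tables under spectrum exchangeability *)

Definition transpose (T : eqType) (x y z : T) : T :=
  if z == x then y else if z == y then x else z.

Lemma transposeK (T : eqType) (x y : T) : involutive (transpose x y).
Proof.
move=> z; rewrite /transpose; have [->|zx] := eqVneq z x.
  by rewrite eqxx; case: eqVneq.
have [->|zy] := eqVneq z y; first by rewrite eqxx.
by rewrite (negbTE zx) (negbTE zy).
Qed.

(** The bijection for the tails is composed with the transposition that corrects the image of the
    first element; it fixes the values already placed. *)
Lemma bijection_extend (T : eqType) (s t : seq T) : uniq s -> uniq t ->
  size s = size t -> exists2 p : T -> T, bijective p & map p s = t.
Proof.
elim: s t => [|x s IH] [|y t] //=; first by exists id => //; exists id.
move=> /andP[xs us] /andP[yt ut] [/(IH _ us ut)[p bp pst]].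
exists (transpose (p x) y \o p).
  by apply: bij_comp => //; exact: inv_bij (@transposeK _ _ _).
rewrite /= {1}/transpose eqxx; congr (_ :: _).
rewrite -pst; apply/eq_in_map => z zs; rewrite /= /transpose.
rewrite (inj_eq (bij_inj bp)) ifN; last by apply: contraNneq xs => <-.
by rewrite ifN//; apply: contraNneq yt => <-; rewrite -pst map_f.
Qed.

Lemma same_spectrum_of_perm (h h' : seq (seq bool)) :
  perm_eq h h' -> same_spectrum h h'.
Proof.
move=> hh' i; rewrite /Mspec.
have -> : [seq count (pred1 a) h' | a <- undup h' & natoms_neg a == i] =
    [seq count (pred1 a) h | a <- undup h' & natoms_neg a == i].
  by apply: eq_map => a; apply/permP; rewrite perm_sym.
apply: perm_map; apply: perm_filter; apply: uniq_perm; rewrite ?undup_uniq//.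
by move=> a; rewrite !mem_undup (perm_mem hh').
Qed.

Lemma same_spectrum_map (psi : seq bool -> seq bool) (h : seq (seq bool)) :
  {in h &, injective psi} -> {in h, forall a, natoms_neg (psi a) = natoms_neg a} ->
  same_spectrum (map psi h) h.
Proof.
move=> inj neg i; rewrite /Mspec.
have -> : undup (map psi h) = map psi (undup h).
  elim: h inj {neg} => //= a h IH inj.
  have {}IH := IH (fun x y xh yh => inj x y (mem_behead (xh : x \in behead (a :: h)))
    (mem_behead (yh : y \in behead (a :: h)))).
  have -> : (psi a \in map psi h) = (a \in h).
    apply/mapP/idP => [[c ch E]|]; last by exists a.
    by rewrite (inj a c) ?mem_head// inE ch orbT.
  by case: ifP => _ //=; rewrite IH.
rewrite filter_map -map_comp.
have -> : [seq a <- undup h | preim psi (fun a => natoms_neg a == i) a] =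
    [seq a <- undup h | natoms_neg a == i].
  by apply: eq_in_filter => a; rewrite mem_undup => ah /=; rewrite neg.
rewrite (@eq_in_map _ _ _ (fun a => count (pred1 a) h) _).1// => a.
rewrite mem_filter mem_undup => /andP[_ ah] /=; rewrite count_map.
by apply: eq_in_count => c ch /=; apply/eqP/eqP => [/inj ->|->].
Qed.

Section BadWords.
Variables (R : realType) (T : finType).

Lemma card_words m : \sum_(s <- words (enum T) m) (1 : R) = #|T|%:R ^+ m.
Proof.
elim: m => [|m IH]; first by rewrite sum_words0.
rewrite sum_wordsS; under eq_bigr do rewrite IH.
by rewrite big_const_seq count_predT iter_addr addr0 -cardE exprS mulr_natl.
Qed.

(** Birthday bound: a further letter meets one of the [m] earlier ones for at most [m] of its
    possible values. *)
Lemma sum_nonuniq_words m : (0 < #|T|)%N ->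
  \sum_(s <- words (enum T) m) (~~ uniq s)%:R <=
  (m ^ 2)%:R / #|T|%:R * #|T|%:R ^+ m :> R.
Proof.
move=> T0; set N : R := #|T|%:R; have N0 : 0 < N by rewrite ltr0n.
elim: m => [|m IH]; first by rewrite sum_words0 exp0n// !mul0r.
rewrite sum_wordsS exchange_big /=.
have H s : s \in words (enum T) m ->
    \sum_(x <- enum T) (~~ uniq (x :: s))%:R <= m%:R + N * (~~ uniq s)%:R :> R.
  move=> sm; apply: (@le_trans _ _ (\sum_(x <- enum T) ((x \in s)%:R + (~~ uniq s)%:R))).
    apply: ler_sum => x _ /=; rewrite negb_and negbK.
    by rewrite -natrD ler_nat; case: (_ \in _); case: (uniq s).
  rewrite big_split /= lerD//; last first.
    by rewrite big_const_seq count_predT iter_addr addr0 -cardE mulr_natl.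
  rewrite -(size_words sm) big_enum /= -natr_sum ler_nat -big_mkcond /= sum1_card.
  exact: card_size.
rewrite big_seq; apply: (@le_trans _ _ (\sum_(s <- words (enum T) m)
    (m%:R + N * (~~ uniq s)%:R))).
  by rewrite [leRHS]big_seq; apply: ler_sum.
rewrite big_split /= -mulr_sumr.
have -> : \sum_(s <- words (enum T) m) m%:R = m%:R * N ^+ m.
  by rewrite -card_words mulr_sumr; apply: eq_bigr => s _; rewrite mulr1.
apply: (@le_trans _ _ (m%:R * N ^+ m + N * ((m ^ 2)%:R / N * N ^+ m))).
  by rewrite lerD2l ler_wpM2l// ltW.
have -> : N * ((m ^ 2)%:R / N * N ^+ m) = (m ^ 2)%:R * N ^+ m.
  by field; rewrite gt_eqF.
have -> : (m.+1 ^ 2)%:R / N * N ^+ m.+1 = (m.+1 ^ 2)%:R * N ^+ m.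
  by rewrite exprS; field; rewrite gt_eqF.
rewrite -mulrDl; apply: ler_wpM2r; first by rewrite exprn_ge0// ltW.
rewrite -natrD ler_nat; nia.
Qed.

End BadWords.

Lemma perm_map_enum (T : finType) (f : T -> T) : bijective f ->
  perm_eq (map f (enum T)) (enum T).
Proof.
move=> bf; apply: uniq_perm; [|exact: enum_uniq|].
  by rewrite map_inj_uniq ?enum_uniq//; exact: bij_inj.
by case: bf => g fK gK y; rewrite mem_enum -[y]gK map_f// mem_enum.
Qed.

Section Tables.
Variables (R : realType) (N M : nat).
Notation row := {ffun 'I_M -> bool}.
Notation table := {ffun 'I_N -> row}.

Definition row_seq (r : row) : seq bool := [seq r j | j <- enum 'I_M].

Definition table_seq (X : table) : seq (seq bool) :=
  [seq row_seq (X i) | i <- enum 'I_N].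

Lemma size_row_seq r : size (row_seq r) = M.
Proof. by rewrite size_map size_enum_ord. Qed.

Lemma nth_row_seq (r : row) (j : 'I_M) : nth false (row_seq r) j = r j.
Proof. by rewrite (nth_map j) ?size_enum_ord// nth_ord_enum. Qed.

Lemma row_seq_inj : injective row_seq.
Proof. by move=> r r' E; apply/ffunP => j; rewrite -!nth_row_seq E. Qed.

Lemma size_table_seq X : size (table_seq X) = N.
Proof. by rewrite size_map size_enum_ord. Qed.

Lemma nth_table_seq (X : table) (i : 'I_N) : nth [::] (table_seq X) i = row_seq (X i).
Proof. by rewrite (nth_map i) ?size_enum_ord// nth_ord_enum. Qed.

Lemma same_spectrum_rows (phi : row -> row) (X : table) :
  (forall i i', phi (X i) = phi (X i') -> X i = X i') ->
  (forall r, natoms_neg (row_seq (phi r)) = natoms_neg (row_seq r)) ->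
  same_spectrum (table_seq [ffun i => phi (X i)]) (table_seq X).
Proof.
move=> inj neg.
pose unseq (a : seq bool) : row := [ffun j => nth false a (nat_of_ord j)].
have unseqK r : unseq (row_seq r) = r by apply/ffunP => j; rewrite ffunE nth_row_seq.
have -> : table_seq [ffun i => phi (X i)] =
    map (fun a => row_seq (phi (unseq a))) (table_seq X).
  by rewrite /table_seq -map_comp; apply: eq_map => i /=; rewrite ffunE unseqK.
apply: same_spectrum_map => [_ _ /mapP[i _ ->] /mapP[i' _ ->]|_ /mapP[i _ ->]].
  by rewrite !unseqK => /row_seq_inj/inj ->.
by rewrite unseqK neg.
Qed.

Lemma natoms_neg_perm (f : 'I_M -> 'I_M) (r : row) : bijective f ->
  natoms_neg (row_seq [ffun y => r (f y)]) = natoms_neg (row_seq r).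
Proof.
move=> bf; rewrite /natoms_neg /row_seq.
rewrite (eq_map (g := r \o f)) => [|y]; last by rewrite ffunE.
rewrite map_comp; apply/permP; apply: perm_map; exact: perm_map_enum.
Qed.

(* The constants with rows rho draw the atoms g when a constant reads q fresh
   predicates off the list j if its row is new, and repeats the atom of the
   earlier constant with the same row otherwise. *)
Fixpoint draws (q : nat) (u : seq (row * seq bool)) (rho : seq row)
    (g : seq (seq bool)) (j : seq 'I_M) : bool :=
  match rho, g with
  | r :: rho', a :: g' =>
      (if r \in unzip1 u then (r, a) \in u else map r (take q j) == a) &&
      draws q (rcons u (r, a)) rho' g' (drop q j)
  | _, _ => true
  end.

Definition reindex_row (f : 'I_M -> 'I_M) (r : row) : row := [ffun y => r (f y)].

Lemma draws_columns q (f : 'I_M -> 'I_M) u rho g j : bijective f ->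
  draws q [seq (reindex_row f x.1, x.2) | x <- u]
    (map (reindex_row f) rho) g j = draws q u rho g (map f j).
Proof.
move=> bf; pose phi := reindex_row f.
have inj : injective phi.
  case: bf => f' fK f'K r r' /ffunP E; apply/ffunP => y.
  by have := E (f' y); rewrite !ffunE f'K.
elim: rho u g j => [|r rho IH] u [|a g] j //=.
rewrite -(map_rcons (fun x : row * seq bool => (phi x.1, x.2)) u (r, a)) IH.
rewrite -map_drop -map_take -map_comp; congr (_ && _).
have -> : (phi r \in unzip1 [seq (phi x.1, x.2) | x <- u]) = (r \in unzip1 u).
  rewrite /unzip1 -map_comp.
  rewrite (eq_map (g := phi \o fst)) => [|x] //.
  by rewrite map_comp mem_map.
have -> : ((phi r, a) \in [seq (phi x.1, x.2) | x <- u]) = ((r, a) \in u).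
  apply/mapP/idP => [[[r' a'] ru [/inj -> ->]] //|ru]; by exists (r, a).
congr (if _ then _ else _); congr (_ == _).
by apply: eq_map => y /=; rewrite ffunE.
Qed.

Let r0 : row := [ffun=> false].

Definition window q (j : seq 'I_M) (e : nat) := take q (drop (e * q) j).

(** Every constant reads the window numbered by the first constant with the same row; the windows of
    later constants of that class are skipped. *)
Lemma draws_closed q (rho : seq row) (g : seq (seq bool)) (j : seq 'I_M) :
  size g = size rho ->
  draws q [::] rho g j =
  all (fun k => map (nth r0 rho k) (window q j (index (nth r0 rho k) rho)) == nth [::] g k)
    (iota 0 (size rho)).
Proof.
set C := fun k => _ == nth [::] g k.
suff H rho1 rho2 g1 g2 : size g1 = size rho1 -> size g2 = size rho2 ->
    rho = rho1 ++ rho2 -> g = g1 ++ g2 -> all C (iota 0 (size rho1)) ->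
    draws q (zip rho1 g1) rho2 g2 (drop (size rho1 * q) j) =
    all C (iota (size rho1) (size rho2)).
  by move=> sg; have := H [::] rho [::] g erefl sg erefl erefl isT; rewrite mul0n drop0.
elim: rho2 rho1 g1 g2 => [|r rho2 IH] rho1 g1 [|a g2] //= s1 [s2] rhoE gE.
move=> C1; rewrite drop_drop -mulSn -zip_rcons//.
have nr : nth r0 rho (size rho1) = r by rewrite rhoE nth_cat ltnn subnn.
have ng : nth [::] g (size rho1) = a by rewrite gE nth_cat -s1 ltnn subnn.
have Cn : (if r \in unzip1 (zip rho1 g1) then (r, a) \in zip rho1 g1
    else map r (take q (drop (size rho1 * q) j)) == a) = C (size rho1).
  have z1 : unzip1 (zip rho1 g1) = rho1 by rewrite unzip1_zip// s1.
  rewrite z1 /C nr ng rhoE index_cat; case: ifPn => rr; last by rewrite /= eqxx addn0.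
  set e := index r rho1; have er : (e < size rho1)%N by rewrite index_mem.
  have Ck k : (k < size rho1)%N -> nth r0 rho1 k = r -> map r (window q j e) = nth [::] g1 k.
    move=> kr kE; have /allP/(_ k) := C1; rewrite mem_iota add0n => /(_ kr)/eqP.
    by rewrite rhoE gE !nth_cat s1 kr kE index_cat rr.
  apply/(nthP (r0, [::]))/eqP => [[k]|E].
    rewrite size_zip s1 minnn => kr; rewrite nth_zip// => -[kE <-].
    exact: Ck.
  exists e; first by rewrite size_zip s1 minnn.
  by rewrite nth_zip// -E nth_index// (Ck e)// nth_index.
rewrite Cn; case: (boolP (C (size rho1))) => //= Cr.
have := IH (rcons rho1 r) (rcons g1 a) g2; rewrite !size_rcons; apply=> //.
- by rewrite s1.
- by rewrite cat_rcons.
- by rewrite cat_rcons.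
- by rewrite -addn1 iotaD all_cat C1 /= add0n Cr.
Qed.

Variable P : table -> R.
Hypothesis P_ge0 : forall X, 0 <= P X.
Hypothesis P_sum : \sum_X P X = 1.
Hypothesis P_spectrum : forall X Y,
  same_spectrum (table_seq X) (table_seq Y) -> P X = P Y.

Lemma expect_bijection (phi : table -> table) (F : table -> R) :
  bijective phi -> (forall X, P (phi X) = P X) ->
  \sum_X P X * F (phi X) = \sum_X P X * F X.
Proof.
move=> bphi Pphi; rewrite [RHS](reindex phi); last exact: onW_bij.
by apply: eq_bigr => X _; rewrite Pphi.
Qed.

Definition reindex_columns (f : 'I_M -> 'I_M) (X : table) : table :=
  [ffun i => reindex_row f (X i)].

Definition reindex_rows (f : 'I_N -> 'I_N) (X : table) : table := [ffun i => X (f i)].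

(** A column permutation preserves the number of negations in each row and the equalities between
    rows, hence the spectrum. *)
Lemma expect_columns (f : 'I_M -> 'I_M) (F : table -> R) : bijective f ->
  \sum_X P X * F (reindex_columns f X) = \sum_X P X * F X.
Proof.
move=> bf; have [f' fK f'K] := bf.
apply: (expect_bijection (phi := reindex_columns f)).
  by exists (reindex_columns f') => X;
    apply/ffunP => i; apply/ffunP => y; rewrite !ffunE ?fK ?f'K.
move=> X; apply: P_spectrum.
apply: (same_spectrum_rows (phi := reindex_row f)).
  move=> i i' /ffunP E; apply/ffunP => y.
  by have := E (f' y); rewrite !ffunE f'K.
by move=> r; exact: natoms_neg_perm.
Qed.

Lemma expect_rows (f : 'I_N -> 'I_N) (F : table -> R) : bijective f ->
  \sum_X P X * F (reindex_rows f X) = \sum_X P X * F X.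
Proof.
move=> bf; have [f' fK f'K] := bf.
apply: (expect_bijection (phi := reindex_rows f)).
  by exists (reindex_rows f') => X; apply/ffunP => i; rewrite !ffunE ?fK ?f'K.
move=> X; apply: P_spectrum; apply: same_spectrum_of_perm; rewrite /table_seq.
rewrite (eq_map (g := (row_seq \o X) \o f)) => [|i]; last by rewrite /= ffunE.
rewrite map_comp [Y in perm_eq _ Y](eq_map (g := row_seq \o X))//.
by apply: perm_map; exact: perm_map_enum.
Qed.

Definition expect_draws q (g : seq (seq bool)) (i : seq 'I_N) (j : seq 'I_M) : R :=
  \sum_X P X * (draws q [::] (map X i) g j)%:R.

(** Two lists of distinct indices of equal length are related by a permutation, here of the
    constants and of the predicates, and [P] is invariant under both. *)
Lemma expect_draws_uniq q g i i' j j' : uniq i -> uniq i' -> size i = size i' ->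
  uniq j -> uniq j' -> size j = size j' ->
  expect_draws q g i j = expect_draws q g i' j'.
Proof.
move=> ui ui' si uj uj' sj; rewrite /expect_draws.
have [f bf <-] := bijection_extend ui' ui (esym si).
have [h bh <-] := bijection_extend uj' uj (esym sj).
rewrite -(expect_columns (fun X => (draws q [::] (map X i') g j')%:R) bh).
rewrite -(expect_rows (fun X => (draws q [::]
  (map (reindex_columns h X) i') g j')%:R) bf).
apply: eq_bigr => X _; congr (_ * (nat_of_bool _)%:R).
rewrite -(draws_columns _ [::] _ _ _ bh) /= -!map_comp.
by congr draws; apply: eq_map => k /=; apply/ffunP => y; rewrite !ffunE.
Qed.

(** Constants and predicates are sampled with replacement, which makes the average a function of the
    class frequencies and negation rates of the table. *)
Definition avg_draws q (g : seq (seq bool)) (X : table) : R :=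
  (\sum_(i <- words (enum 'I_N) (size g)) \sum_(j <- words (enum 'I_M) (size g * q))
    (draws q [::] (map X i) g j)%:R) / (N%:R ^+ size g * M%:R ^+ (size g * q)).

Lemma expect_draws_bounds q g i j : 0 <= expect_draws q g i j <= 1.
Proof.
rewrite /expect_draws; apply/andP; split.
  by apply: sumr_ge0 => X _; rewrite mulr_ge0.
rewrite -[leRHS]P_sum; apply: ler_sum => X _.
by rewrite -[leRHS]mulr1 ler_wpM2l// lern1; case: (draws _ _ _ _ _).
Qed.

(** Samples without repetition all have the same expectation; the others are rare by the birthday
    bound and cost at most 1 each. *)
Lemma expect_avg_draws q g i0 j0 : (0 < N)%N -> (0 < M)%N -> uniq i0 -> uniq j0 ->
  size i0 = size g -> size j0 = (size g * q)%N ->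
  `|\sum_X P X * avg_draws q g X - expect_draws q g i0 j0| <=
  (size g ^ 2)%:R / N%:R + ((size g * q) ^ 2)%:R / M%:R.
Proof.
move=> N0 M0 ui0 uj0 si0 sj0; set m := size g; set l := (m * q)%N.
have NR : (0 : R) < N%:R by rewrite ltr0n.
have MR : (0 : R) < M%:R by rewrite ltr0n.
set D := N%:R ^+ m * M%:R ^+ l : R.
have D0 : 0 < D by rewrite mulr_gt0// exprn_gt0.
have cN : \sum_(i <- words (enum 'I_N) m) (1 : R) = N%:R ^+ m by rewrite card_words card_ord.
have cM : \sum_(j <- words (enum 'I_M) l) (1 : R) = M%:R ^+ l by rewrite card_words card_ord.
have cD : \sum_(i <- words (enum 'I_N) m) \sum_(j <- words (enum 'I_M) l) 1 = D.
  by under eq_bigr do rewrite cM -[M%:R ^+ l]mul1r; rewrite -mulr_suml cN.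
have -> : \sum_X P X * avg_draws q g X - expect_draws q g i0 j0 =
    (\sum_(i <- words (enum 'I_N) m) \sum_(j <- words (enum 'I_M) l)
      (expect_draws q g i j - expect_draws q g i0 j0)) / D.
  have -> : \sum_(i <- words (enum 'I_N) m) \sum_(j <- words (enum 'I_M) l)
      (expect_draws q g i j - expect_draws q g i0 j0) =
      \sum_(i <- words (enum 'I_N) m) \sum_(j <- words (enum 'I_M) l) expect_draws q g i j -
      expect_draws q g i0 j0 * D.
    rewrite -cD mulr_sumr -sumrB; apply: eq_bigr => i _.
    by rewrite mulr_sumr -sumrB; apply: eq_bigr => j _; rewrite mulr1.
  rewrite mulrBl mulfK ?gt_eqF//; congr (_ - _).
  under eq_bigr do rewrite /avg_draws mulrA; rewrite -mulr_suml; congr (_ / _).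
  under eq_bigr do rewrite mulr_sumr; rewrite exchange_big; apply: eq_bigr => i _.
  by under eq_bigr do rewrite mulr_sumr; rewrite exchange_big.
rewrite normrM normfV [`|D|]gtr0_norm// ler_pdivrMr//.
apply: (@le_trans _ _ (\sum_(i <- words (enum 'I_N) m) \sum_(j <- words (enum 'I_M) l)
    ((~~ uniq i)%:R + (~~ uniq j)%:R))).
  apply: le_trans (ler_norm_sum _ _ _) _; rewrite big_seq [leRHS]big_seq.
  apply: ler_sum => i im; apply: le_trans (ler_norm_sum _ _ _) _.
  rewrite big_seq [leRHS]big_seq; apply: ler_sum => j jl.
  have [ui|nui] := boolP (uniq i); last first.
    have /andP[a0 a1] := expect_draws_bounds q g i j.
    have /andP[b0 b1] := expect_draws_bounds q g i0 j0.
    apply: (@le_trans _ _ 1); last by rewrite lerDl.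
    by rewrite ler_norml; apply/andP; split; lra.
  have [uj|nuj] := boolP (uniq j); last first.
    have /andP[a0 a1] := expect_draws_bounds q g i j.
    have /andP[b0 b1] := expect_draws_bounds q g i0 j0.
    apply: (@le_trans _ _ 1); last by rewrite add0r.
    by rewrite ler_norml; apply/andP; split; lra.
  rewrite (@expect_draws_uniq q g i i0 j j0) ?subrr ?normr0 ?addr0//.
    by rewrite si0 (size_words im).
  by rewrite sj0 (size_words jl).
have -> : \sum_(i <- words (enum 'I_N) m) \sum_(j <- words (enum 'I_M) l)
    ((~~ uniq i)%:R + (~~ uniq j)%:R) =
    (\sum_(i <- words (enum 'I_N) m) (~~ uniq i)%:R) * M%:R ^+ l +
    N%:R ^+ m * \sum_(j <- words (enum 'I_M) l) (~~ uniq j)%:R :> R.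
  rewrite -cM -cN !mulr_suml -big_split /=; apply: eq_bigr => i _.
  by rewrite mulr_sumr mul1r -big_split; apply: eq_bigr => j _; rewrite /= mulr1.
have u1 := @sum_nonuniq_words R 'I_N m; rewrite card_ord in u1.
have u2 := @sum_nonuniq_words R 'I_M l; rewrite card_ord in u2.
rewrite mulrDl lerD//.
  rewrite /D mulrA; apply: ler_wpM2r; first by rewrite exprn_ge0// ltW.
  exact: u1.
rewrite /D [leRHS]mulrCA; apply: ler_wpM2l; first by rewrite exprn_ge0// ltW.
exact: u2.
Qed.

(** * Giving each class of constants its own window of predicates *)

Section Swap.
Variables (q m : nat).
Hypothesis qM : ((m.+1 * q) < M)%N.
Variable i0 : seq 'I_N.
Hypothesis i0_size : size i0 = m.

Let col (k : nat) : 'I_M := insubd (Ordinal (leq_ltn_trans (leq0n _) qM)) k.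

Let val_col k : (k < M)%N -> val (col k) = k.
Proof. by move=> kM; rewrite val_insubd kM. Qed.

(** Exchanges the initial block of [q] columns with block [e + 1], for [e < m]. The value [e = m] is
    the rank of a row not met among [i0] and moves nothing. *)
Let swap_nat (e k : nat) : nat :=
  if (e < m)%N then
    if (k < q)%N then (e.+1 * q + k)%N
    else if (e.+1 * q <= k < e.+2 * q)%N then (k - e.+1 * q)%N else k
  else k.

Let swap_nat_lt e k : (k < M)%N -> (swap_nat e k < M)%N.
Proof.
move=> kM; rewrite /swap_nat; case: ifP => // em; case: ifP => kq.
  have : (e.+2 * q <= m.+1 * q)%N by rewrite leq_mul2r ltnS em orbT.
  by have := qM; rewrite !mulSn; lia.
case: ifP => // _; lia.
Qed.

Let swap_natK e k : swap_nat e (swap_nat e k) = k.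
Proof.
rewrite /swap_nat; have [em|_] := boolP (e < m)%N; last by [].
rewrite !mulSn; case: (ltnP k q) => kq.
  have h1 : (q + e * q + k < q)%N = false by lia.
  have h2 : (q + e * q <= q + e * q + k < q + (q + e * q))%N by lia.
  by rewrite h1 h2; lia.
case: (boolP (q + e * q <= k < q + (q + e * q))%N) => h.
  have h1 : (k - (q + e * q) < q)%N by lia.
  by rewrite h1; lia.
have h1 : (k < q)%N = false by lia.
by rewrite h1 (negbTE h).
Qed.

Let swap_col (e : nat) (y : 'I_M) : 'I_M := Ordinal (swap_nat_lt e (ltn_ord y)).

Let swap_colK e : involutive (swap_col e).
Proof. by move=> y; apply: val_inj => /=; exact: swap_natK. Qed.

Let swap_col_far e (y : 'I_M) : (m.+1 * q <= y)%N -> swap_col e y = y.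
Proof.
move=> yq; apply: val_inj; rewrite /= /swap_nat; case: ifP => // em.
have h : (e.+2 * q <= m.+1 * q)%N by rewrite leq_mul2r ltnS em orbT.
have h1 : (y < q)%N = false by apply/negbTE; rewrite -leqNgt; apply: leq_trans yq; rewrite mulSn leq_addr.
have h2 : (e.+1 * q <= y < e.+2 * q)%N = false by lia.
by rewrite h1 h2.
Qed.

Let swap_row (e : nat) (r : row) : row := [ffun y => r (swap_col e y)].

Let swap_rowK e : involutive (swap_row e).
Proof. by move=> r; apply/ffunP => y; rewrite !ffunE swap_colK. Qed.

Let rank (X : table) (i : 'I_N) : nat := index (X i) (map X i0).

Let swapped (X : table) : table := [ffun i => swap_row (rank X i) (X i)].

(** Classes moved by different permutations may become equal, which would change the spectrum;
    [good] excludes this. *)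
Let good (X : table) : bool :=
  [forall i : 'I_N, forall i' : 'I_N, (swapped X i == swapped X i') ==> (X i == X i')].

Let goodP X : reflect (forall i i', swapped X i = swapped X i' -> X i = X i') (good X).
Proof.
apply: (iffP forallP) => [H i i' /eqP E|H i].
  by have /forallP/(_ i') := H i; rewrite E /= => /eqP.
by apply/forallP => i'; apply/implyP => /eqP/H ->.
Qed.

Let swapped_eq (X : table) i i' : X i = X i' -> swapped X i = swapped X i'.
Proof. by move=> E; rewrite !ffunE /rank E. Qed.

Let rank_swapped (X : table) i : good X -> rank (swapped X) i = rank X i.
Proof.
move=> /goodP gX; rewrite /rank /index !find_map; apply: eq_find => k /=.
apply/eqP/eqP => [/gX //|]; exact: swapped_eq.
Qed.

Let swappedK X : good X -> swapped (swapped X) = X.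
Proof.
move=> gX; apply/ffunP => i; rewrite [LHS]ffunE rank_swapped// ffunE.
exact: swap_rowK.
Qed.

Let good_swapped X : good X -> good (swapped X).
Proof.
by move=> gX; apply/goodP => i i'; rewrite swappedK//; exact: swapped_eq.
Qed.

(** SPx is used here beyond exchangeability of predicates: the column permutation in [phi] depends
    on the row. *)
Let P_swapped X : good X -> P (swapped X) = P X.
Proof.
move=> gX; apply: P_spectrum.
pose phi (r : row) := swap_row (index r (map X i0)) r.
have -> : swapped X = [ffun i => phi (X i)] by apply/ffunP => i; rewrite !ffunE.
apply: same_spectrum_rows => [i i' E|r].
  by apply: (goodP _ gX); rewrite !ffunE.
by apply: natoms_neg_perm; exact: inv_bij (@swap_colK _).
Qed.

Let w0 : seq 'I_M := map col (iota 0 q).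
Let j0 : seq 'I_M := map col (iota q (m * q)).

Let window_j0 e : (e < m)%N -> window q j0 e = map (swap_col e) w0.
Proof.
move=> em; rewrite /window /j0 /w0 -map_drop -map_take drop_iota take_iota.
have eq : (e.+1 * q <= m * q)%N by rewrite leq_mul2r em orbT.
have -> : minn q (m * q - e * q) = q by apply/minn_idPl; rewrite mulSn in eq; lia.
rewrite -map_comp [X in iota X _](_ : _ = e.+1 * q + 0)%N; last by rewrite mulSn addn0; lia.
rewrite iotaDl -map_comp.
apply/eq_in_map => k; rewrite mem_iota add0n => /andP[_ kq] /=.
have kM : (k < M)%N by apply: leq_trans kq _; apply: ltnW; apply: leq_ltn_trans qM; rewrite mulSn leq_addr.
have kM' : (e.+1 * q + k < M)%N.
  by have := qM; rewrite mulSn in eq *; rewrite mulSn; lia.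
by apply: val_inj; rewrite [LHS](val_col kM') /= /swap_nat (val_col kM) em kq.
Qed.

(** On good tables [swapped] is an involution preserving [P], and it turns reading the common block
    [w0] into reading the separate windows of [j0]. On the other tables the two indicators differ by
    at most 1. *)
Lemma expect_draws_swap (g : seq (seq bool)) : size g = m ->
  `|\sum_X P X * (all2 (fun i a => map (X i) w0 == a) i0 g)%:R -
    expect_draws q g i0 j0| <= \sum_(X | ~~ good X) P X.
Proof.
move=> sg; rewrite /expect_draws.
pose F1 X := P X * (all2 (fun i a => map (X i) w0 == a) i0 g)%:R.
pose F2 X := P X * (draws q [::] (map X i0) g j0)%:R.
rewrite -[X in `|X - _|]/(\sum_X F1 X) -[X in `|_ - X|]/(\sum_X F2 X).
rewrite (bigID good) [X in _ - X](bigID good) /=.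
have -> : \sum_(X | good X) F1 X = \sum_(X | good X) F2 X.
  rewrite [RHS](reindex_onto swapped swapped) /=; last by move=> X /swappedK.
  rewrite (eq_bigl good) => [|X]; last first.
    apply/andP/idP => [[gX /eqP <-]|gX]; first exact: good_swapped.
    by rewrite good_swapped// swappedK.
  apply: eq_bigr => X gX; rewrite /F1 /F2 P_swapped//; congr (_ * (nat_of_bool _)%:R).
  rewrite draws_closed ?size_map ?i0_size//.
  rewrite all2E sg i0_size eqxx /=.
  have [i0nil|[i _]] : i0 = [::] \/ exists i, i \in i0.
  - by case: (i0) => [|i s]; [left|right; exists i; exact: mem_head].
  - have m0 : m = 0%N by rewrite -i0_size i0nil.
    by rewrite i0nil m0; case: (g).
  have step k : (k < m)%N ->
      map (nth r0 (map (swapped X) i0) k) (window q j0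
        (index (nth r0 (map (swapped X) i0) k) (map (swapped X) i0))) =
      map (X (nth i i0 k)) w0.
    move=> km; rewrite (nth_map i) ?i0_size//.
    have -> : index (swapped X (nth i i0 k)) (map (swapped X) i0) = rank X (nth i i0 k).
      exact: rank_swapped.
    rewrite window_j0; last first.
      by rewrite /rank -[in leqRHS]i0_size -(size_map X) index_mem map_f// mem_nth// i0_size.
    by rewrite -map_comp; apply: eq_map => y /=; rewrite !ffunE swap_colK.
  apply/(all_nthP (i, [::]))/allP => H k.
  - rewrite mem_iota add0n => /andP[_ km]; rewrite step//.
    have := H k; rewrite size_zip sg i0_size minnn => /(_ km).
    by rewrite nth_zip ?sg.
  - rewrite size_zip sg i0_size minnn => km; rewrite nth_zip ?sg//= -step//.
    by apply: H; rewrite mem_iota.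
rewrite opprD addrACA subrr add0r -sumrB; apply: le_trans (ler_norm_sum _ _ _) _.
apply: ler_sum => X _; rewrite /F1 /F2 -mulrBr normrM ger0_norm//.
rewrite -[leRHS]mulr1 ler_wpM2l//.
by case: (all2 _ _ _); case: (draws _ _ _ _ _);
  rewrite ?subrr ?subr0 ?sub0r ?normrN ?normr1 ?normr0 ?ler01.
Qed.

(** In a bad table two different rows become equal. The swaps fix the columns from [K] on, so the
    rows agree there and differ at some column [l] below [K]. Each such event has probability at
    most 1/(M - K), and there are N^2 pairs of rows and [K] columns. *)
Lemma bad_tables : \sum_(X | ~~ good X) P X <=
  (N ^ 2 * (m.+1 * q))%:R / (M - m.+1 * q)%:R.
Proof.
set K := (m.+1 * q)%N.
pose agree (i i' : 'I_N) (l : 'I_M) (X : table) :=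
  (X i l != X i' l) && [forall y : 'I_M, (K <= y)%N ==> (y != l) ==> (X i y == X i' y)].
pose near (l : 'I_M) := (l < K)%N.
have agree_le i i' (l : 'I_M) : near l ->
    \sum_X P X * (agree i i' l X)%:R <= (M - K)%:R^-1.
  move=> lK; have MK : (0 : R) < (M - K)%:R by rewrite ltr0n subn_gt0.
  (* Transposing [l] with a far column [c] leads to the event that [c] is the only far column of
     disagreement. These events are disjoint for different [c], and there are M - K of them. *)
  have H (c : 'I_M) : (K <= c)%N ->
      \sum_X P X * (agree i i' l X)%:R <= \sum_X P X * (agree i i' c X)%:R.
    move=> Kc; have bt : bijective (transpose l c) by exact: inv_bij (@transposeK _ _ _).
    rewrite -(expect_columns (fun X => (agree i i' c X)%:R) bt).
    apply: ler_sum => X _; rewrite ler_wpM2l// ler_nat.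
    case: (boolP (agree i i' l X)) => // /andP[d /forallP A].
    suff -> : agree i i' c (reindex_columns (transpose l c) X) by [].
    have cl : (c == l) = false by apply/negbTE/eqP => cl; move: (lK : (l < K)%N); rewrite -cl ltnNge Kc.
    rewrite /agree !ffunE /transpose cl eqxx d /=; apply/forallP => y.
    apply/implyP => Ky; apply/implyP => yc; rewrite !ffunE (negbTE yc).
    have yl : (y == l) = false by apply/negbTE/eqP => yl; move: (lK : (l < K)%N); rewrite -yl ltnNge Ky.
    by rewrite yl; have := A y; rewrite Ky yl.
  have : \sum_(c : 'I_M | (K <= c)%N) \sum_X P X * (agree i i' l X)%:R <= 1.
    apply: (@le_trans _ _ (\sum_(c : 'I_M | (K <= c)%N) \sum_X P X * (agree i i' c X)%:R)).
      exact: ler_sum.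
    rewrite exchange_big /= -[leRHS]P_sum; apply: ler_sum => X _.
    rewrite -mulr_sumr -[leRHS]mulr1 ler_wpM2l// -natr_sum lern1.
    case: (boolP [exists c : 'I_M, (K <= c)%N && agree i i' c X]) => [/existsP[c /andP[Kc Ac]]|].
      rewrite (bigD1 c)//= Ac big1 // => y /andP[Ky yc].
      case: (boolP (agree i i' y X)) => // /andP[_ /forallP/(_ c)].
      by rewrite Kc eq_sym yc /=; have /andP[/negbTE -> _] := Ac.
    move=> /existsPn H'; rewrite big1// => c Kc.
    by have := H' c; rewrite Kc /= => /negbTE ->.
  set S := \sum_X _; rewrite sumr_const => le1.
  have cardE : #|[pred c : 'I_M | (K <= c)%N]| = (M - K)%N.
    rewrite -sum1_card -(big_mkord (fun c => K <= c)%N (fun=> 1%N)) /=.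
    rewrite (@big_cat_nat _ _ _ K) //=; last exact: ltnW.
    rewrite big_nat_cond big1 ?add0n; last by move=> c /andP[/andP[_ cK]]; rewrite leqNgt cK.
    by rewrite big_nat_cond (eq_bigl (fun c => (K <= c < M)%N)) -?big_nat ?sum_nat_const_nat ?muln1//;
      move=> c; case: (K <= c)%N; rewrite ?andbT ?andbF.
  move: le1; rewrite (_ : #|_| = (M - K)%N); last by rewrite -cardE; apply: eq_card.
  by rewrite -(mulr_natr S) -ler_pdivlMr// mul1r.
have bad_agree X : ~~ good X -> (1 <= \sum_(i : 'I_N) \sum_(i' : 'I_N)
    \sum_(l : 'I_M | near l) (agree i i' l X)%:R :> R).
  rewrite negb_forall => /existsP[i]; rewrite negb_forall => /existsP[i'].
  rewrite negb_imply => /andP[/eqP sE /eqP nE].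
  have far (y : 'I_M) : (K <= y)%N -> X i y = X i' y.
    move=> Ky; have /ffunP/(_ y) := sE; rewrite !ffunE.
    by rewrite !swap_col_far.
  have [l lK dl] : exists2 l, near l & X i l != X i' l.
    apply/exists_inP; rewrite -negb_forall_in; apply/negP => /forall_inP H.
    apply: nE; apply/ffunP => y; have [yK|Ky] := ltnP y K; last exact: far.
    by apply/eqP/H.
  rewrite (bigD1 i)//= (bigD1 i')//= (bigD1 l)//=.
  have -> : agree i i' l X.
    rewrite /agree dl; apply/forallP => y; apply/implyP => Ky; apply/implyP => _.
    by rewrite far.
  rewrite -!addrA lerDl !addr_ge0//; repeat (apply: sumr_ge0 => *; rewrite ?ler0n//).
apply: (@le_trans _ _ (\sum_(i : 'I_N) \sum_(i' : 'I_N) \sum_(l : 'I_M | near l)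
    \sum_X P X * (agree i i' l X)%:R)).
  apply: (@le_trans _ _ (\sum_X P X * (\sum_(i : 'I_N) \sum_(i' : 'I_N)
      \sum_(l : 'I_M | near l) (agree i i' l X)%:R))).
    rewrite [leRHS](bigID good) /= -[leLHS]add0r lerD//.
      apply: sumr_ge0 => X _; rewrite mulr_ge0//.
      by do 3! (apply: sumr_ge0 => ? _).
    by apply: ler_sum => X bX; rewrite -[leLHS]mulr1 ler_wpM2l// bad_agree.
  under eq_bigr do rewrite mulr_sumr.
  rewrite exchange_big; apply: ler_sum => i _.
  under eq_bigr do rewrite mulr_sumr.
  rewrite exchange_big; apply: ler_sum => i' _.
  under eq_bigr do rewrite mulr_sumr.
  by rewrite exchange_big.
apply: (@le_trans _ _ (\sum_(i : 'I_N) \sum_(i' : 'I_N) \sum_(l : 'I_M | near l)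
    (M - K)%:R^-1)).
  by apply: ler_sum => i _; apply: ler_sum => i' _; apply: ler_sum => l; exact: agree_le.
have cardK : #|near| = K.
  rewrite -sum1_card -(big_ord_widen M (fun=> 1%N) (ltnW qM)).
  by rewrite sum1_card card_ord.
rewrite !sumr_const !card_ord (_ : #|_| = K); last by rewrite -[RHS]cardK; apply: eq_card.
by rewrite -!mulrnA mulr_natl (_ : (K * (N * N))%N = (N ^ 2 * K)%N)//; nia.
Qed.

Lemma window_avg_draws (g : seq (seq bool)) (w : seq 'I_M) : (0 < N)%N ->
  uniq i0 -> size g = m -> map val w = iota 0 q ->
  `|\sum_X P X * (all2 (fun i a => map (X i) w == a) i0 g)%:R -
    \sum_X P X * avg_draws q g X| <=
  (N ^ 2 * (m.+1 * q))%:R / (M - m.+1 * q)%:R +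
  ((m ^ 2)%:R / N%:R + ((m * q) ^ 2)%:R / M%:R).
Proof.
move=> N0 ui0 sg wE.
have M0 : (0 < M)%N by exact: leq_ltn_trans qM.
have qleM k : (k < q + m * q)%N -> (k < M)%N.
  by move=> kq; apply: ltn_trans qM; rewrite mulSn.
have -> : w = w0.
  apply: (inj_map val_inj); rewrite wE /w0 -map_comp -[LHS]map_id.
  apply/eq_in_map => k; rewrite mem_iota add0n => /andP[_ kq] /=.
  by rewrite val_col// qleM// ltn_addr.
have uj0 : uniq j0.
  rewrite map_inj_in_uniq ?iota_uniq// => k k'; rewrite !mem_iota => /andP[_ kl] /andP[_ kl'] E.
  by rewrite -(val_col (qleM _ kl)) -(val_col (qleM _ kl')) E.
have sj0 : size j0 = (m * q)%N by rewrite size_map size_iota.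
have := @expect_avg_draws q g i0 j0 N0 M0 ui0 uj0; rewrite sg => /(_ i0_size sj0) H1.
have H2 := le_trans (expect_draws_swap sg) bad_tables.
rewrite -(subrKA (expect_draws q g i0 j0)); apply: le_trans (ler_normD _ _) _.
by apply: lerD => //; rewrite distrC.
Qed.

End Swap.

End Tables.

(** * Class frequencies of a table *)

Section TableParams.
Variables (R : realType) (N M : nat).
Notation row := {ffun 'I_M -> bool}.
Notation table := {ffun 'I_N -> row}.
Variable X : table.
Hypotheses (N0 : (0 < N)%N) (M0 : (0 < M)%N).

Let NR : (0 : R) < N%:R. Proof. by rewrite ltr0n. Qed.
Let MR : (0 : R) < M%:R. Proof. by rewrite ltr0n. Qed.

Let r0 : row := [ffun=> false].
Let rows : seq row := map X (enum 'I_N).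

Definition row_classes : seq row :=
  sort (fun r r' => (count_mem r' rows <= count_mem r rows)%N) (undup rows).

(* Classes of equal rows are numbered from 1 in order of decreasing size. *)
Definition row_freq (k : nat) : R :=
  if (0 < k <= size row_classes)%N
  then (count_mem (nth r0 row_classes k.-1) rows)%:R / N%:R else 0.

Definition row_neg (r : row) : R := (natoms_neg (row_seq r))%:R / M%:R.

(** Past the last class this is the rate of the default row [r0], where [row_freq] is 0. *)
Definition row_tau (k : nat) : R := row_neg (nth r0 row_classes k.-1).

Lemma row_neg_bounds r : 0 <= row_neg r <= 1.
Proof.
rewrite /row_neg divr_ge0//= ler_pdivrMr// mul1r ler_nat.
by rewrite /natoms_neg -[leqRHS](size_row_seq r) count_size.
Qed.

Lemma row_tau_bounds k : 0 <= row_tau k <= 1.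
Proof. exact: row_neg_bounds. Qed.

Lemma row_freq_ge0 k : 0 <= row_freq k.
Proof. by rewrite /row_freq; case: ifP => // _; rewrite divr_ge0. Qed.

Lemma perm_row_classes : perm_eq row_classes (undup rows).
Proof. by rewrite perm_sort. Qed.

Lemma size_row_classes : (size row_classes <= N)%N.
Proof.
rewrite (perm_size perm_row_classes); apply: leq_trans (size_undup _) _.
by rewrite size_map size_enum_ord.
Qed.

Lemma row_freq_decr k : (0 < k)%N -> row_freq k.+1 <= row_freq k.
Proof.
move=> k0; rewrite /row_freq /= k0 /=; case: ifP => [kc|_]; last first.
  by case: ifP => // _; rewrite divr_ge0.
rewrite (ltnW kc) ler_pM2r ?invr_gt0// ler_nat.
have tr : transitive (fun r r' : row => (count_mem r' rows <= count_mem r rows)%N).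
  by move=> a b c /= ab ca; exact: leq_trans ab.
have st : sorted (fun r r' : row => (count_mem r' rows <= count_mem r rows)%N) row_classes.
  by apply: sort_sorted => a b; exact: leq_total.
apply: (sorted_leq_nth tr (fun=> leqnn _) r0 st); rewrite ?inE//.
- by rewrite prednK// ltnW.
- exact: leq_pred.
Qed.

Lemma sum_row_freq (K : nat) (Phi : row -> R) : (size row_classes <= K)%N ->
  \sum_(k <- iota 1 K) row_freq k * Phi (nth r0 row_classes k.-1) =
  N%:R^-1 * \sum_(i : 'I_N) Phi (X i).
Proof.
move=> cK; rewrite -(subnKC cK) iotaD big_cat /= [X in _ + X]big1_seq ?addr0; last first.
  move=> k /andP[_]; rewrite mem_iota add1n => /andP[ck _].
  by rewrite /row_freq [(k <= _)%N]leqNgt ck andbF mul0r.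
have -> : \sum_(i : 'I_N) Phi (X i) = \sum_(r <- row_classes) Phi r *+ count_mem r rows.
  rewrite (perm_big _ perm_row_classes) /=.
  transitivity (\sum_(r <- rows) Phi r); first by rewrite big_map big_enum.
  rewrite -big_undup_iterop_count; apply: eq_bigr => r _.
  by rewrite Monoid.iteropE iter_addr addr0.
rewrite (iotaDl 1 0) big_map (big_nth r0) mulr_sumr /index_iota subn0.
rewrite [LHS]big_seq_cond [RHS]big_seq_cond; apply: eq_bigr => k.
rewrite andbT mem_iota => /andP[_ kc]; rewrite add1n /= /row_freq /= kc.
by rewrite -[Phi _ *+ _]mulr_natl mulrA [_ / _]mulrC.
Qed.

Lemma sum_row_freq1 K : (N <= K)%N -> \sum_(k <- iota 1 K) row_freq k = 1.
Proof.
move=> NK; have cK := leq_trans size_row_classes NK.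
have := sum_row_freq (fun=> 1) cK; under eq_bigr do rewrite mulr1.
by move=> ->; rewrite sumr_const card_ord mulVf// gt_eqF.
Qed.

Lemma sum_row_freq_le1 K : \sum_(k <- iota 1 K) row_freq k <= 1.
Proof.
rewrite -(sum_row_freq1 (leq_addl K N)) iotaD big_cat /= lerDl.
by apply: sumr_ge0 => k _; exact: row_freq_ge0.
Qed.

(** Columns drawn with replacement show independent signs, each negative with probability
    [row_neg r]. *)
Lemma avg_words_row (r : row) (a : seq bool) :
  \sum_(w <- words (enum 'I_M) (size a)) (map r w == a)%:R =
  M%:R ^+ size a * atom_wt (row_neg r) a :> R.
Proof.
elim: a => [|x a IH].
  by rewrite sum_words0 /= atom_wt_prod big_nil mulr1.
rewrite sum_wordsS /=.
transitivity ((\sum_(y : 'I_M) (r y == x)%:R) *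
    \sum_(w <- words (enum 'I_M) (size a)) (map r w == a)%:R : R).
  rewrite mulr_suml big_enum /=; apply: eq_bigr => y _.
  rewrite mulr_sumr; apply: eq_bigr => w _.
  by rewrite eqseq_cons -natrM mulnb.
rewrite IH !atom_wt_prod big_cons exprS.
have -> : \sum_(y : 'I_M) (r y == x)%:R = M%:R * (if x then 1 - row_neg r else row_neg r).
  have cE b : \sum_(y : 'I_M) (r y == b)%:R = (count (pred1 b) (row_seq r))%:R :> R.
    rewrite -natr_sum /row_seq count_map -big_mkcond /= sum1_card cardE size_filter.
    by congr (_%:R); rewrite enumT; apply: eq_count => y.
  have negE : row_neg r = (count (pred1 false) (row_seq r))%:R / M%:R.
    by rewrite /row_neg /natoms_neg; congr (_%:R / _); apply: eq_count => -[].
  rewrite cE; case: x; last by rewrite negE mulrC divfK// gt_eqF.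
  rewrite negE mulrBr mulr1 [X in _ - X]mulrC divfK ?gt_eqF// -[X in X%:R - _](size_row_seq r).
  rewrite -(count_predC (pred1 true)) natrD.
  rewrite (eq_count (a1 := predC (pred1 true)) (a2 := pred1 false)) ?addrK//.
  by case.
by rewrite -!mulrA; congr (_ * _); rewrite mulrCA.
Qed.

(** The colour of a sampled constant is the number of its class, and a class reads independent signs
    at its first use. In a finite table every constant has a class of positive frequency, so the
    dust weight is 0. *)
Lemma avg_draws_colour_sum q (g : seq (seq bool)) :
  all (fun a => size a == q) g ->
  avg_draws R q g X =
  colour_sum N row_freq (fun a k => atom_wt (row_tau k) a) (fun=> 0) [::] g.
Proof.
pose c (r : row) := (index r row_classes).+1.
suff H u : all (fun a => size a == q) g -> {subset unzip1 u <= row_classes} ->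
    (\sum_(i <- words (enum 'I_N) (size g)) \sum_(j <- words (enum 'I_M) (size g * q))
      (draws q u (map X i) g j)%:R) / (N%:R ^+ size g * M%:R ^+ (size g * q)) =
    colour_sum N row_freq (fun a k => atom_wt (row_tau k) a) (fun=> 0)
      [seq (c x.1, x.2) | x <- u] g :> R.
  by move=> gq; exact: (H [::] gq).
elim: g u => [|a g IH] u /=.
  by rewrite !big_seq1 ?mul0n !expr0 mul1r invr1 mulr1.
move=> /andP[/eqP aq gq] ucl; rewrite mul0r add0r.
have memX i : X i \in row_classes.
  by rewrite (perm_mem perm_row_classes) mem_undup map_f// mem_enum.
pose wt r : R := if r \in unzip1 u then ((r, a) \in u)%:R else atom_wt (row_neg r) a.
have step i : (\sum_(is_ <- words (enum 'I_N) (size g))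
    \sum_(j <- words (enum 'I_M) ((size g).+1 * q))
      (draws q u (map X (i :: is_)) (a :: g) j)%:R) /
    (N%:R ^+ size g * M%:R ^+ ((size g).+1 * q)) =
    wt (X i) * colour_sum N row_freq (fun a k => atom_wt (row_tau k) a) (fun=> 0)
      [seq (c x.1, x.2) | x <- rcons u (X i, a)] g :> R.
  rewrite -IH//; last first.
    move=> r; rewrite /unzip1 map_rcons mem_rcons inE => /orP[/eqP ->|/ucl//].
    exact: memX.
  rewrite mulrA; transitivity
    ((\sum_(is_ <- words (enum 'I_N) (size g)) \sum_(j <- words (enum 'I_M) (size g * q))
      (draws q (rcons u (X i, a)) (map X is_) g j)%:R * (M%:R ^+ q * wt (X i))) /
      (N%:R ^+ size g * M%:R ^+ ((size g).+1 * q))); last first.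
    under eq_bigr do rewrite -mulr_suml; rewrite -mulr_suml mulSn exprD.
    by field; rewrite !expf_neq0// gt_eqF.
  congr (_ / _); apply: eq_bigr => is_ _.
  rewrite mulSn sum_words_cat exchange_big /=; apply: eq_bigr => j _.
  transitivity (\sum_(v <- words (enum 'I_M) q)
    (draws q (rcons u (X i, a)) (map X is_) g j)%:R *
      (if X i \in unzip1 u then (X i, a) \in u else map (X i) v == a)%:R : R).
    rewrite big_seq [RHS]big_seq; apply: eq_bigr => v vq.
    rewrite take_size_cat ?(size_words vq)// drop_size_cat ?(size_words vq)//.
    by rewrite -natrM mulnb andbC.
  rewrite -mulr_sumr; congr (_ * _); rewrite /wt; case: ifP => _.
    have cM := @card_words R 'I_M q; rewrite card_ord in cM.
    by rewrite -cM mulr_suml; apply: eq_bigr => v _; rewrite mul1r.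
  by have := avg_words_row (X i) a; rewrite aq.
transitivity (N%:R^-1 * \sum_(i : 'I_N) wt (X i) *
    colour_sum N row_freq (fun a k => atom_wt (row_tau k) a) (fun=> 0)
      [seq (c x.1, x.2) | x <- rcons u (X i, a)] g).
  rewrite sum_wordsS big_enum /= mulr_suml mulr_sumr; apply: eq_bigr => i _.
  by rewrite -step exprS; field; rewrite !expf_neq0// gt_eqF.
pose Phi r := wt r * colour_sum N row_freq (fun a k => atom_wt (row_tau k) a) (fun=> 0)
  [seq (c x.1, x.2) | x <- rcons u (r, a)] g.
rewrite -[X in _ * X]/(\sum_(i : 'I_N) Phi (X i)).
rewrite -(sum_row_freq Phi size_row_classes).
rewrite [LHS]big_seq_cond [RHS]big_seq_cond; apply: eq_bigr => k.
rewrite andbT mem_iota => /andP[k0 _].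
have [kc|kc] := leqP k (size row_classes); last first.
  by rewrite /row_freq [(k <= _)%N]leqNgt kc andbF !mul0r.
rewrite -mulrA; congr (_ * _); set r := nth r0 row_classes k.-1.
have kp : (k.-1 < size row_classes)%N by case: (k) k0 kc.
have rc : r \in row_classes by rewrite mem_nth.
have uc : uniq row_classes by rewrite (perm_uniq perm_row_classes) undup_uniq.
have crk : c r = k by rewrite /c index_uniq// prednK.
have cinj r1 r2 : r1 \in row_classes -> r2 \in row_classes -> c r1 = c r2 -> r1 = r2.
  by move=> h1 h2 [] /(congr1 (nth r0 row_classes)); rewrite !nth_index.
rewrite /Phi map_rcons /= crk; congr (_ * _).
rewrite /wt /colour_wt.
have -> : (k \in unzip1 [seq (c x.1, x.2) | x <- u]) = (r \in unzip1 u).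
  rewrite /unzip1 -map_comp; apply/mapP/mapP => [[x xu kE]|[x xu rE]]; exists x => //.
    by apply: cinj => //; [apply: ucl; exact: map_f|rewrite crk].
  by rewrite /= -rE crk.
have -> : ((k, a) \in [seq (c x.1, x.2) | x <- u]) = ((r, a) \in u).
  apply/mapP/idP => [[[r1 a1] xu [kE ->]]|ru]; last by exists (r, a); rewrite //= crk.
  by rewrite (cinj r r1)// ?crk//; apply: ucl; apply/mapP; exists (r1, a1).
by [].
Qed.

End TableParams.

Lemma index_Lq q i : (i < q)%N -> index i (undup (Lq q)) = i.
Proof.
by move=> iq; rewrite undup_Lq -[X in index X _](@nth_iota 0 0 q) // index_uniq ?iota_uniq ?size_iota.
Qed.

Lemma all2_map_eq (T : Type) (U : eqType) (f : T -> U) s t :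
  all2 (fun i a => f i == a) s t = (map f s == t).
Proof. by elim: s t => [|x s IH] [|y t] //=; rewrite IH eqseq_cons. Qed.

Section Marginal.
Variables (R : realType) (N M : nat) (W : fml -> R).
Hypotheses (pW : probfun (Lq M) W) (spW : SPxP (Lq M) W).
Local Notation row := {ffun 'I_M -> bool}.
Local Notation table := {ffun 'I_N -> row}.

Definition table_wt (X : table) : R := W (sd (Lq M) (table_seq X)).

Lemma table_wt_ge0 X : 0 <= table_wt X.
Proof. by apply: (probfun_ge0 pW); exact: sentence_sd. Qed.

Lemma table_seq_words (X : table) : table_seq X \in words (bitwords M) N.
Proof.
rewrite mem_words size_table_seq eqxx; apply/allP => s /mapP[i _ ->].
by rewrite [_ (row_seq _)]mem_bitwords size_row_seq.
Qed.

Lemma table_wf_sd (X : table) : wf_sd (Lq M) (table_seq X).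
Proof. by apply: (@words_wf_sd _ _ N); rewrite undup_Lq size_iota table_seq_words. Qed.

Lemma table_wt_spectrum X Y :
  same_spectrum (table_seq X) (table_seq Y) -> table_wt X = table_wt Y.
Proof. by apply: spW; rewrite ?table_wf_sd// !size_table_seq. Qed.

Lemma sum_words_tables (F : seq (seq bool) -> R) :
  \sum_(h <- words (bitwords M) N) F h = \sum_(X : table) F (table_seq X).
Proof.
rewrite -(big_map (@table_seq N M) xpredT F); apply: perm_big; rewrite perm_sym.
apply: uniq_perm; rewrite ?uniq_words ?map_inj_uniq ?index_enum_uniq//.
  move=> X Y XY; apply/ffunP => i; apply: (@row_seq_inj M).
  by rewrite -!nth_table_seq XY.
move=> s; apply/mapP/idP => [[X _ ->]|]; first exact: table_seq_words.
move=> sw; have ss := size_words sw.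
exists [ffun i : 'I_N => [ffun j : 'I_M => nth false (nth [::] s i) j]].
  exact: mem_index_enum.
apply: (@eq_from_nth _ [::]); first by rewrite size_table_seq.
move=> i; rewrite ss => iN; rewrite (nth_table_seq _ (Ordinal iN)) ffunE /=.
have si : size (nth [::] s i) = M.
  move: sw; rewrite mem_words => /andP[_ /allP]; move/(_ (nth [::] s i)).
  by rewrite mem_nth ?ss// inE mem_bitwords => /(_ isT)/eqP.
apply: (@eq_from_nth _ false); first by rewrite size_row_seq.
by move=> j; rewrite si => jM; rewrite (nth_row_seq _ (Ordinal jM)) ffunE.
Qed.

Lemma sum_table_wt : \sum_X table_wt X = 1.
Proof.
rewrite -(sum_words_tables (fun h => W (sd (Lq M) h))) -(probfun_sum_sd pW N).
by rewrite undup_Lq size_iota.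
Qed.

Lemma table_wt_marginal q m (g : seq (seq bool)) (i0 : seq 'I_N) (w : seq 'I_M) :
  (q <= M)%N -> (m <= N)%N -> g \in words (bitwords q) m ->
  map val i0 = iota 0 m -> map val w = iota 0 q ->
  W (sd (Lq q) g) =
  \sum_X table_wt X * (all2 (fun i a => map (X i) w == a) i0 g)%:R.
Proof.
move=> qM mN gw i0E wE; have sg := size_words gw.
have si0 : size i0 = m by rewrite -(size_map val) i0E size_iota.
have sw : size w = q by rewrite -(size_map val) wE size_iota.
have sM : sentence (Lq M) (sd (Lq q) g).
  apply: sentence_sub (sentence_sd _ _) => i; rewrite !mem_iota !add0n.
  by move=> iq; apply: leq_trans qM.
have wf : wf_sd (Lq q) g by apply: (@words_wf_sd _ _ m); rewrite undup_Lq size_iota.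
have cb : (const_bound (sd (Lq q) g) <= N)%N.
  by apply: leq_trans mN; rewrite -sg const_bound_sd.
rewrite (probfun_qfree pW (qfree_sd _ _) sM cb) undup_Lq size_iota big_mkcond.
rewrite (sum_words_tables (fun h => if table_sat (Lq M) h (sd (Lq q) g)
  then W (sd (Lq M) h) else 0)).
apply: eq_bigr => X _; rewrite -/(table_wt X) mulr_natr.
suff -> : table_sat (Lq M) (table_seq X) (sd (Lq q) g) =
  all2 (fun i a => map (X i) w == a) i0 g by case: ifP.
have -> : all2 (fun i a => map (X i) w == a) i0 g =
  ([seq [seq nth false (nth [::] (table_seq X) c) k | k <- iota 0 q] | c <- iota 0 m] == g).
  rewrite all2_map_eq -i0E -wE -!map_comp; congr (_ == g); apply: eq_map => i /=.
  by rewrite nth_table_seq -!map_comp; apply: eq_map => j /=; rewrite nth_row_seq.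
apply/asboolP/eqP; rewrite (sat_sd _ _ _ wf) /table_pred.
  move=> H; apply: (@eq_from_nth _ [::]) => [|c]; rewrite size_map size_iota ?sg// => cm.
  have sgc : size (nth [::] g c) = q.
    move: gw; rewrite mem_words => /andP[_ /allP/(_ (nth [::] g c))].
    by rewrite mem_nth ?sg// inE mem_bitwords => /(_ isT)/eqP.
  rewrite (nth_map 0%N) ?size_iota// nth_iota//; apply: (@eq_from_nth _ false) => [|k].
    by rewrite size_map size_iota.
  rewrite size_map size_iota => kq; rewrite (nth_map 0%N) ?size_iota// nth_iota// !add0n.
  have := H c k; rewrite sg cm mem_iota kq !index_Lq ?(leq_trans kq)// => /(_ isT isT).
  by move=> bb; apply/idP/idP => /bb.
move=> <- c k; rewrite size_map size_iota mem_iota add0n => cm /andP[_ kq].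
rewrite (nth_map 0%N) ?size_iota// (nth_map 0%N) ?size_iota ?index_Lq ?(leq_trans kq)//.
by rewrite !nth_iota.
Qed.

End Marginal.

Lemma ordinals_iota m N : (m <= N)%N -> exists i0 : seq 'I_N, map val i0 = iota 0 m.
Proof.
move=> mN; exists (take m (enum 'I_N)).
by rewrite map_take val_enum_ord take_iota (minn_idPl mN).
Qed.

(** Bad tables have weight of order N^2 over the number of predicates, so with N^3 predicates every
    error is at most a constant over [N]. *)
Lemma table_wt_cvg (R : realType) (W : seq nat -> fml -> R) q m (g : seq (seq bool)) :
  (forall L, probfun L (W L)) -> (forall L, SPxP L (W L)) ->
  (forall L L' f, {subset L <= L'} -> sentence L f -> W L' f = W L f) ->
  g \in words (bitwords q) m ->
  (fun N => \sum_(X : {ffun 'I_N -> {ffun 'I_(N ^ 3) -> bool}})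
     table_wt (W (Lq (N ^ 3))) X * avg_draws R q g X) @ \oo --> W (Lq q) (sd (Lq q) g).
Proof.
move=> pW spW W_sub gw; have sg := size_words gw.
(* [C] counts the columns touched by the swaps. In [D] the term [2 * C] comes from the bad tables,
   as N^3 - C is at least half of N^3, and the squares come from samples with repetitions. *)
pose C := (m.+1 * q)%N; pose D := (2 * C + m ^ 2 + (m * q) ^ 2)%N.
have D_cvg : (fun N => D%:R / N.+1%:R : R) @ \oo --> 0.
  rewrite -[X in _ --> X](mulr0 D%:R); apply: cvgM; first exact: cvg_cst.
  exact: cvg_harmonic.
apply/cvgrPdist_le => e e0; have /cvgr0Pnorm_le/(_ _ e0)[N0 _ HN0] := D_cvg.
exists (N0.+1 + 2 * C + m + 1)%N => //= N NC.
have [N0' C2N mN N0N] : [/\ (0 < N)%N, (2 * C <= N)%N, (m <= N)%N & (N0 <= N.-1)%N].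
  by move: NC; clear => /= NC; split; lia.
have NN3 : (N <= N ^ 3)%N by rewrite !expnS expn0 muln1 leq_pmulr// muln_gt0 N0'.
have qC : (q <= C)%N by rewrite /C mulSn leq_addr.
have CM : (C < N ^ 3)%N by apply: leq_trans NN3; clear -N0' C2N; clearbody C; lia.
have qM : (q <= N ^ 3)%N := leq_trans qC (ltnW CM).
have [i0 i0E] := ordinals_iota mN; have [w wE] := ordinals_iota qM.
have -> : W (Lq q) (sd (Lq q) g) = W (Lq (N ^ 3)) (sd (Lq q) g).
  apply/esym/W_sub; last exact: sentence_sd.
  by move=> i; rewrite !mem_iota !add0n => /leq_trans; apply.
rewrite (table_wt_marginal (pW _) qM mN gw i0E wE).
have si0 : size i0 = m by rewrite -(size_map val) i0E size_iota.
have ui0 : uniq i0 by apply: (@map_uniq _ _ val); rewrite i0E iota_uniq.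
apply: le_trans (window_avg_draws (table_wt_ge0 (pW _)) (sum_table_wt _ (pW _))
  (@table_wt_spectrum _ _ _ _ (spW _)) CM si0 N0' ui0 sg wE) _.
have HD : D%:R / N%:R <= e.
  have := HN0 N.-1; rewrite (ltn_predK N0') ger0_norm ?divr_ge0//; exact.
apply: le_trans HD; rewrite -/C.
have NR : (0 : R) < N%:R by rewrite ltr0n.
rewrite /D [(_ + (_ * _) ^ 2)%:R]natrD [(2 * C + _)%:R]natrD !mulrDl addrA; apply: lerD; first apply: lerD => //.
  rewrite ler_pdivrMr ?ltr0n ?subn_gt0// mulrAC ler_pdivlMr//.
  rewrite -!natrM ler_nat (_ : N ^ 2 * C * N = C * N ^ 3)%N; last first.
    by rewrite mulnAC mulnC -expnSr.
  rewrite [(2 * C)%N]mulnC -mulnA leq_mul2l; apply/orP; right.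
  by have := leq_trans C2N NN3; clear; clearbody C; lia.
rewrite ler_pM// ?invr_ge0// lef_pV2 ?posrE ?ltr0n ?ler_nat//.
exact: leq_trans NN3.
Qed.

(** * Coupling of finite random variables *)

Section StepMap.
Variables (R : realType) (T : finType) (P y : T -> R) (X0 : T).
Hypotheses (P_ge0 : forall X, 0 <= P X) (P_sum : \sum_X P X = 1).

Let s : seq T := sort (fun X Y => y X <= y Y) (enum T).
Let cum (j : nat) : R := \sum_(X <- take j s) P X.

Let cum_le i j : (i <= j)%N -> cum i <= cum j.
Proof.
move=> ij; rewrite /cum -[in leRHS](cat_take_drop i (take j s)) take_takel//.
by rewrite big_cat /= lerDl; exact: sumr_ge0.
Qed.

(** The last cell is not tested: when all tests fail, [find] returns the last index, so the map is
    defined on the whole line. *)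
Definition step_index (x : R) : nat :=
  find (fun j => x < cum j.+1) (iota 0 (size s).-1).

(** A quantile function: the elements of [T], listed by increasing [y], occupy consecutive cells of
    [0, 1[ of lengths [P]. *)
Definition step_map (x : R) : T := nth X0 s (step_index x).

Let s_gt0 : (0 < size s)%N.
Proof. by rewrite size_sort -cardE; apply/card_gt0P; exists X0. Qed.

Let cum_size : cum (size s) = 1.
Proof.
rewrite /cum take_size -P_sum -[in RHS]big_enum /=; apply: perm_big.
by rewrite perm_sort.
Qed.

Let step_index_lt x : (step_index x < size s)%N.
Proof.
apply: (@leq_ltn_trans (size s).-1); last by rewrite prednK.
by rewrite -[leqRHS](size_iota 0) find_size.
Qed.

Lemma step_index_le x x' : x <= x' -> (step_index x <= step_index x')%N.
Proof. by move=> xx'; apply: sub_find => j; exact: le_lt_trans. Qed.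

Lemma step_map_homo x x' : x <= x' -> y (step_map x) <= y (step_map x').
Proof.
move=> xx'; apply: (sorted_leq_nth (leT := fun X Y => y X <= y Y)).
- by move=> ? ? ?; exact: le_trans.
- by move=> X; exact: lexx.
- by apply: sort_sorted => X Y; exact: le_total.
- by rewrite inE step_index_lt.
- by rewrite inE step_index_lt.
exact: step_index_le.
Qed.

Lemma measurable_step_map (X : T) : measurable (step_map @^-1` [set X]).
Proof.
have us : uniq s by rewrite sort_uniq enum_uniq.
have -> : step_map @^-1` [set X] = [set x | step_index x = index X s].
  apply/seteqP; split=> x /=; last first.
    by rewrite /step_map => ->; rewrite nth_index// mem_sort mem_enum.
  by move=> <-; rewrite index_uniq.
apply: is_interval_measurable => a b /= ia ib z /andP[az zb].
by apply/eqP; rewrite eqn_leq -[X in (_ <= X)%N]ib -[X in _ && (X <= _)%N]ia !step_index_le.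
Qed.

Lemma unif_step_map (X : T) : unif (step_map @^-1` [set X]) = (P X)%:E.
Proof.
have us : uniq s by rewrite sort_uniq enum_uniq.
have Xs : X \in s by rewrite mem_sort mem_enum.
pose j := index X s; have js : (j < size s)%N by rewrite index_mem.
have cumS : cum j.+1 = cum j + P X.
  by rewrite /cum (take_nth X0)// -cats1 big_cat big_seq1 nth_index.
have cum_ge0 i : 0 <= cum i by exact: sumr_ge0.
have cum_le1 i : (i <= size s)%N -> cum i <= 1 by rewrite -cum_size; exact: cum_le.
rewrite (_ : P X = cum j.+1 - cum j); last by rewrite cumS addrC addKr.
rewrite -unif_itv ?cum_le1 ?cum_le//; apply: unif_ext => x /andP[x0 x1] /=.
set d := step_index x; have ds : (d < size s)%N := step_index_lt x.
have xd : cum d <= x < cum d.+1.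
  apply/andP; split.
    case E: d => [|d']; first by rewrite /cum take0 big_nil.
    have d'd : (d' < d)%N by rewrite E.
    have := before_find 0%N d'd; rewrite nth_iota ?add0n ?leNgt => [->//|].
    by rewrite -ltnS prednK// (leq_ltn_trans d'd).
  have [H|H] := boolP (has (fun j => x < cum j.+1) (iota 0 (size s).-1)).
    have := nth_find 0%N H; rewrite -/(step_index x) nth_iota//.
    by move: H; rewrite has_find size_iota.
  by rewrite /d /step_index hasNfind// size_iota prednK// cum_size.
rewrite in_itv /= /step_map -/d; split=> [E|/andP[jx xj]].
  by have -> : j = d by rewrite /j -E index_uniq.
suff -> : d = j by rewrite nth_index.
have [dx xd'] := andP xd; apply/eqP; rewrite eqn_leq; apply/andP.
split; rewrite leqNgt.
  by apply/negP => jd; have := le_trans (cum_le jd) dx; rewrite leNgt xj.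
by apply/negP => dj; have := le_trans (cum_le dj) jx; rewrite leNgt xd'.
Qed.

End StepMap.

Section Ternary.
Variable R : realType.

(** A Cantor-type code: digits 0 and 1 in base 3 keep all values in [0, 1/2], and the gaps force
    nearby codes to share a prefix, which fails in base 2. *)
Definition ternary (s : seq bool) : R := foldr (fun (b : bool) x => (b%:R + x) / 3) 0 s.

Lemma ternary_bounds s : 0 <= ternary s <= 2^-1.
Proof.
elim: s => [|b s /andP[IH0 IH1]] /=; first by rewrite lexx invr_ge0 ler0n.
by case: b; rewrite /=; lra.
Qed.

Lemma ternary_close J s s' : (J <= size s)%N -> (J <= size s')%N ->
  `|ternary s - ternary s'| < 3^-1 ^+ J / 2 -> take J s = take J s'.
Proof.
elim: J s s' => [|J IH] [|b s] [|b' s'] //= Js Js'.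
have t1 : (3^-1 : R) ^+ J <= 1 by rewrite exprn_ile1// ?invr_ge0 ?invf_le1 ?ler1n.
have := ternary_bounds s; have := ternary_bounds s'; rewrite exprS.
move: IH; set u := 3^-1 ^+ J in t1 *; move=> IH /andP[? ?] /andP[? ?] H.
have bb : b = b' by move: H; case: b; case: b' => //=; rewrite ltr_norml; lra.
rewrite bb (IH s s')//; move: H; rewrite bb !ltr_norml; lra.
Qed.

Lemma thresholds_close (l : nat) (x y : R) : 0 <= x <= 1 -> 0 <= y <= 1 ->
  (forall a : nat, (a <= l.+1)%N -> (a%:R / l.+1%:R <= x) = (a%:R / l.+1%:R <= y)) ->
  `|x - y| <= l.+1%:R^-1.
Proof.
wlog yx : x y / y <= x.
  move=> H x01 y01 E; have [|/ltW] := leP y x; first by move=> ?; exact: H.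
  by move=> ?; rewrite distrC; apply: H => // a al; rewrite E.
move=> /andP[x0 x1] /andP[y0 y1] E; rewrite ger0_norm ?subr_ge0//.
have l0 : (0 : R) < l.+1%:R by [].
have lx0 : 0 <= x * l.+1%:R by rewrite mulr_ge0.
have /andP[ax xa] := truncn_itv lx0; set a := Num.truncn _ in ax xa.
have al : (a <= l.+1)%N.
  by rewrite -(ler_nat R); apply: le_trans ax _; rewrite ler_piMl.
have : a%:R / l.+1%:R <= y by rewrite -E// ler_pdivrMr.
move: xa; rewrite -ltr_pdivlMr// -[a.+1%:R]natr1 mulrDl div1r.
by set v := l.+1%:R^-1; set u := a%:R * v; clearbody u v; clear; lra.
Qed.

End Ternary.

(** * Helly selection and the simultaneous coupling of countably many statistics *)

(** The functions lie in a product of copies of [0, 1], compact by Tychonoff. The k-th index is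
    chosen so that the function is near a cluster point at all rationals of code below k. The
    indices dominate the identity, which is what limits along them use. *)
Lemma ratr_cluster_subseq (R : realType) (f : nat -> rat -> R) :
  (forall n r, 0 <= f n r <= 1) ->
  exists (N : nat -> nat) (Y : rat -> R), (forall k, (k <= N k)%N) /\
    forall r, (fun k => f (N k) r) @ \oo --> Y r.
Proof.
move=> f01.
pose K : set (forall r : rat, R) := [set g | forall r, `[0, 1]%classic (g r)].
have cK : compact (K : set (prod_topology (fun _ : rat => R))).
  by apply: (@tychonoff rat (fun=> R) (fun=> `[0, 1]%classic)) => r; exact: segment_compact.
have [Y [_ clY]] : (K : set (prod_topology (fun _ : rat => R))) `&`
    cluster ((f : nat -> prod_topology (fun _ : rat => R)) @ \oo) !=set0.
  apply: cK; exists 0%N => // n _ r; rewrite /= in_itv /=; exact: f01.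
have step k : exists2 n, (k <= n)%N & forall r : rat, (pickle r < k)%N ->
    `|f n r - Y r| < k.+1%:R^-1.
  pose B (i : 'I_k) : set (prod_topology (fun _ : rat => R)) :=
    [set g | forall r : rat, pickle r = i -> `|g r - Y r| < k.+1%:R^-1].
  have nB : nbhs (Y : prod_topology (fun _ : rat => R)) [set g | forall i, B i g].
    apply: (@filter_forall _ _ B (nbhs (Y : prod_topology (fun _ : rat => R))) _) => i.
    case E : (@unpickle rat i) => [r|]; last first.
      by apply: nearW => g r ri; move: E; rewrite -ri pickleK.
    have nr : nbhs (proj r Y) [set z | `|z - Y r| < k.+1%:R^-1].
      apply/nbhs_ballP; exists k.+1%:R^-1; first by rewrite /= invr_gt0.
      by move=> z; rewrite /ball /= distrC.
    have nY : nbhs (Y : prod_topology (fun _ : rat => R))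
        [set g : rat -> R | `|g r - Y r| < k.+1%:R^-1].
      exact: (@proj_continuous _ (fun _ : rat => R) r Y _ nr).
    have sub : [set g : rat -> R | `|g r - Y r| < k.+1%:R^-1] `<=` B i.
      by move=> g /= gr r' r'i; move: E; rewrite -r'i pickleK => -[->].
    exact: (@filterS _ (nbhs (Y : prod_topology (fun _ : rat => R))) _ _ _ sub nY).
  have tail : ((f : nat -> prod_topology (fun _ : rat => R)) @ \oo) (f @` [set n | (k <= n)%N]).
    by exists k => // n kn; exists n.
  have [g [[n kn <-] Bn]] := clY _ _ tail nB.
  by exists n => // r rk; exact: (Bn (Ordinal rk)).
have /choice[N HN] : forall k, exists n, (k <= n)%N /\ forall r : rat, (pickle r < k)%N ->
    `|f n r - Y r| < k.+1%:R^-1.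
  by move=> k; have [n ? ?] := step k; exists n.
exists N, Y; split=> [k|r]; first by case: (HN k).
apply/cvgrPdist_lt => e e0.
have /cvgr0Pnorm_lt/(_ _ e0)[K0 _ HK0] := @cvg_harmonic R.
exists (maxn K0 (pickle r).+1) => // k /=; rewrite geq_max => /andP[kK rk].
rewrite distrC; have [_ /(_ r rk)/lt_trans] := HN k; apply.
by have := HK0 k kK; rewrite /= ger0_norm.
Qed.

(** Monotone functions that converge at the rationals converge at every point where the limit on the
    rationals does not jump. *)
Lemma monotone_subseq (R : realType) (f : nat -> R -> R) :
  (forall n x, 0 <= f n x <= 1) -> (forall n, {homo f n : x y / x <= y}) ->
  exists (N : nat -> nat) (l : R -> R) (A : set R),
    [/\ forall k, (k <= N k)%N, countable (~` A) &
        forall x, A x -> (fun k => f (N k) x) @ \oo --> l x].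
Proof.
move=> f01 f_homo.
have [N [Y [HN HY]]] := @ratr_cluster_subseq R (fun n r => f n (ratr r)) (fun n r => f01 n _).
(* The rational [c] lies inside a jump at [x]. Two points cannot share [c], as a rational between
   them would have a value both above and below [c]; hence the jumps are countable. *)
pose bad (c : rat) : set R := [set x | (forall r : rat, ratr r < x -> Y r < ratr c) /\
  (forall r : rat, x < ratr r -> ratr c < Y r)].
have Y01 r : 0 <= Y r <= 1.
  apply/andP; split.
    rewrite -(cvg_lim _ (HY r))//; apply: limr_ge; first by apply/cvg_ex; exists (Y r).
    by apply: nearW => k; case/andP: (f01 (N k) (ratr r)).
  rewrite -(cvg_lim _ (HY r))//; apply: limr_le; first by apply/cvg_ex; exists (Y r).
  by apply: nearW => k; case/andP: (f01 (N k) (ratr r)).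
pose l (x : R) := sup [set Y r | r in [set r : rat | ratr r < x]].
exists N, l, (~` \bigcup_c bad c); split=> //.
  rewrite setCK; apply: bigcup_countable => // c _.
  have bad1 x x' : bad c x -> bad c x' -> x < x' -> False.
    move=> [_ Hx] [Hx' _] /rat_in_itvoo[r]; rewrite in_itv /= => /andP[/Hx h /Hx'].
    by move=> /(lt_trans h); rewrite ltxx.
  have [[x bx]|nb] := EM (exists x, bad c x); last first.
    by apply: (@sub_countable _ _ _ set0) => //; apply: subset_card_le => x bx; apply: nb; exists x.
  apply: (@sub_countable _ _ _ [set x]) => //; apply: subset_card_le => x' bx' /=.
  by case: (ltgtP x' x) => // /bad1; [move/(_ bx' bx)|move/(_ bx bx')].
move=> x nbad.
have hs : has_sup [set Y r | r in [set r : rat | ratr r < x]].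
  split; last by exists 1 => _ [r _ <-]; case/andP: (Y01 r).
  have [r] := @rat_in_itvoo R (x - 1) x ltac:(by rewrite gtrBl).
  by rewrite in_itv /= => /andP[_ rx]; exists (Y r), r.
apply/cvgrPdist_lt => e e0.
have [_ [r rx <-] Yr] := sup_adherent e0 hs.
have [c] := @rat_in_itvoo R (l x) (l x + e) ltac:(by rewrite ltrDl).
rewrite in_itv /= => /andP[lc cl].
have [r' xr' Yr'] : exists2 r' : rat, x < ratr r' & Y r' <= ratr c.
  apply: contrapT => H; apply: nbad; exists c => //; split=> s sx.
    apply: le_lt_trans lc; apply: sup_upper_bound => //; by exists s.
  by rewrite ltNge; apply/negP => ?; apply: H; exists s.
have := HY r => /cvgr_gt/(_ _ Yr)[k1 _ H1].
have := HY r' => /cvgr_lt/(_ _ (le_lt_trans Yr' cl))[k2 _ H2].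
exists (maxn k1 k2) => // k /=; rewrite geq_max => /andP[/H1 /= h1 /H2 /= h2].
have := f_homo (N k) _ _ (ltW rx); have := f_homo (N k) _ _ (ltW xr').
rewrite ltr_norml -/(l x) in h1 *; lra.
Qed.

(** All statistics are coded in one real [y], so that along the quantile maps it is monotone and
    Helly selection applies. Convergence of the code stabilises every finite set of threshold
    comparisons, which makes each statistic a Cauchy sequence. *)
Lemma skorokhod_finite (R : realType) (T : nat -> finType) (P : forall n, T n -> R)
    (phi : forall n, nat -> T n -> R) :
  (forall n X, 0 <= P n X) -> (forall n, \sum_X P n X = 1) ->
  (forall n i X, 0 <= phi n i X <= 1) ->
  exists (N : nat -> nat) (t : forall k, R -> T (N k)),
    [/\ forall k, (k <= N k)%N,
        forall k X, measurable (t k @^-1` [set X]),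
        forall k X, unif (t k @^-1` [set X]) = (P (N k) X)%:E &
        forall i x, cvg ((fun k => phi (N k) i (t k x)) @ \oo)].
Proof.
move=> P0 P1 phi01.
have X0 n : T n.
  suff /cid[X _] : exists X : T n, True by exact: X.
  apply: contrapT => H; have := P1 n; rewrite big1 => [/esym/eqP|X _].
    by rewrite oner_eq0.
  by case: H; exists X.
(* Position [j] decodes to a statistic [i], a resolution [l] and a threshold a/(l+1). *)
pose bit n (X : T n) (j : nat) : bool :=
  if (unpickle j : option (nat * nat * nat)) is Some (i, l, a)
  then a%:R / l.+1%:R <= phi n i X else false.
pose y n (X : T n) := ternary R [seq bit n X j | j <- iota 0 n].
pose t n := step_map (P n) (y n) (X0 n).
have y01 n x : 0 <= y n (t n x) <= 1.
  have /andP[y0 y1] := ternary_bounds R [seq bit n (t n x) j | j <- iota 0 n].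
  by rewrite y0 (le_trans y1)// invf_le1 ?ler1n.
have [N [l [A [HN cA HA]]]] := monotone_subseq y01 (fun n => @step_map_homo R (T n) (P n) (y n) (X0 n)).
have mcA : measurable (~` A) by apply: countable_measurable => // r; exact: measurable_set1.
have A0 : unif (~` A) = 0%E.
  apply/eqP; rewrite eq_le measure_ge0 andbT -(countable_lebesgue_measure0 cA).
  by apply: le_measure; rewrite ?inE//; apply: measurableI => //; exact: measurable_itv.
have [x0 Ax0] : exists x0, A x0.
  apply: contrapT => H; have := A0; rewrite (_ : ~` A = setT).
    by rewrite probability_setT => /eqP; rewrite onee_eq0.
  by apply/seteqP; split=> // r _ Ar; apply: H; exists r.
(* Changing t on the null set ~` A makes the convergence hold everywhere. *)
pose s x := if x \in A then x else x0.
have As x : A (s x) by rewrite /s; case: ifP => // /set_mem.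
have preE k X : (fun x => t (N k) (s x)) @^-1` [set X] =
    (t (N k) @^-1` [set X] `\` ~` A) `|` (~` A `&` [set _ | t (N k) x0 = X]).
  apply/seteqP; split=> x /=; rewrite /s.
    by case: ifPn => [/set_mem Ax <-|/negP nA <-]; [left; split=> //; apply|
      right; split=> // Ax; apply: nA; exact: mem_set].
  by move=> [[<- /contrapT Ax]|[nA <-]]; [rewrite mem_set|rewrite memNset].
have mt k X : measurable (t (N k) @^-1` [set X]) by exact: measurable_step_map.
have mc k X : measurable (~` A `&` [set _ : R | t (N k) x0 = X]).
  have [E|E] := EM (t (N k) x0 = X).
    by rewrite (_ : [set _ | _] = setT) ?setIT//; apply/seteqP; split.
  by rewrite (_ : [set _ | _] = set0) ?setI0//; apply/seteqP; split.
exists N, (fun k x => t (N k) (s x)); split=> //.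
- by move=> k X; rewrite preE; apply: measurableU => //; exact: measurableD.
- move=> k X; rewrite preE measureU//; first last.
  + by rewrite -subset0 => x [[_ +] [nA _]]; apply.
  + exact: measurableD.
  rewrite [X in (_ + X)%E](subset_measure0 _ mcA _ A0) ?adde0; [|exact: mc|exact: subIsetl].
  rewrite -(unif_step_map (y (N k)) (X0 (N k)) (P0 (N k)) (P1 (N k))) -/(t (N k)).
  rewrite (measureDI _ (mt k X) mcA) [X in (_ + X)%E](subset_measure0 _ mcA _ A0) ?adde0//.
  exact: measurableI.
move=> i x'; move: (s x') (As x') => x Ax {x'}; apply: cauchy_cvg; apply: cauchy_exP => e e0.
have [L le] : exists L : nat, L.+1%:R^-1 < e.
  have /cvgr0Pnorm_lt/(_ _ e0)[L _ HL] := @cvg_harmonic R.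
  by exists L; have := HL L (leqnn L); rewrite /= ger0_norm.
(* Beyond the positions of all thresholds of [i] at resolution [L]. The code at index [N k] has
   [N k] bits, hence at least [J] once [k] reaches [J]. *)
pose J := (\max_(a < L.+2) (pickle (i, L, a : nat)).+1)%N.
have d0 : 0 < (3^-1 : R) ^+ J / 2 / 2 by rewrite !divr_gt0// exprn_gt0// invr_gt0.
have /cvgrPdist_lt/(_ _ d0)[k0 _ Hk0] := HA x Ax.
pose k1 := maxn k0 J.
exists (phi (N k1) i (t (N k1) x)).
exists k1 => // k /=; rewrite /k1 geq_max => /andP[kk0 kJ].
rewrite /ball /=; apply: le_lt_trans le; apply: thresholds_close => // a aL.
have JN k' : (J <= k')%N -> (J <= size [seq bit (N k') (t (N k') x) j | j <- iota 0 (N k')])%N.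
  by move=> Jk; rewrite size_map size_iota (leq_trans Jk).
have Jk1 : (J <= k1)%N by rewrite leq_maxr.
have bits : take J [seq bit (N k1) (t (N k1) x) j | j <- iota 0 (N k1)] =
            take J [seq bit (N k) (t (N k) x) j | j <- iota 0 (N k)].
  apply: (@ternary_close R); rewrite ?JN//.
  have := Hk0 k1 (leq_maxl _ _); have := Hk0 k kk0; rewrite /y /=.
  set u := ternary _ _; set v := ternary _ _; set d := 3^-1 ^+ J / 2.
  by rewrite !ltr_norml; clearbody u v d; clear; lra.
have aJ : (pickle (i, L, a) < J)%N.
  by rewrite /J (bigD1 (Ordinal (aL : (a < L.+2)%N)))//= leq_maxl.
have := congr1 (nth false ^~ (pickle (i, L, a))) bits.
rewrite !nth_take// !(nth_map 0%N) ?size_iota ?(leq_trans aJ) ?(leq_trans _ (HN _))//.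
rewrite !nth_iota ?(leq_trans aJ) ?(leq_trans _ (HN _))//.
by rewrite !add0n /bit pickleK.
Qed.

(** * Limits of frequencies *)

Lemma atom_wt_lipschitz (R : realType) (a : seq bool) (x y : R) :
  0 <= x <= 1 -> 0 <= y <= 1 ->
  `|atom_wt x a - atom_wt y a| <= (size a)%:R * `|x - y|.
Proof.
move=> x01 y01; rewrite !atom_wt_prod; elim: a => [|b a IH].
  by rewrite !big_nil subrr normr0 mul0r.
rewrite !big_cons; have := atom_wt_bounds a x01; rewrite atom_wt_prod.
move: IH; set u := \prod_(_ <- _) _; set v := \prod_(_ <- _) _ => IH /andP[u0 u1].
set bx := if b then _ else _; set by_ := if b then _ else _.
have by01 : `|by_| <= 1 by rewrite /by_ ler_norml; case: (b); lra.
have bxy : `|bx - by_| = `|x - y|.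
  by rewrite /bx /by_; case: (b) => //; rewrite distrC; congr `|_|; ring.
have -> : bx * u - by_ * v = (bx - by_) * u + by_ * (u - v) by ring.
apply: le_trans (ler_normD _ _) _; rewrite !normrM bxy /= -natr1 mulrDl mul1r addrC.
apply: lerD; first by apply: le_trans IH; rewrite ler_piMl.
by rewrite ler_piMr// ger0_norm.
Qed.

(* The sum is f 1 minus the increments of f over the cells j with c j, hence
   telescopes to f at the first grid point satisfying c. *)
Lemma grid_step (R : realType) (f : R -> R) (C z : R) (l : nat) (c : nat -> bool) :
  0 <= C -> (forall x y, 0 <= x <= 1 -> 0 <= y <= 1 -> `|f x - f y| <= C * `|x - y|) ->
  0 <= z <= 1 -> c l.+1 ->
  (forall j, (j <= l.+1)%N -> c j -> z <= j%:R / l.+1%:R) ->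
  (forall j, (j <= l.+1)%N -> ~~ c j -> j%:R / l.+1%:R <= z) ->
  {homo c : i j / (i <= j)%N >-> i ==> j} ->
  `|f z - (f 1 - \sum_(j < l.+1)
     (f (j.+1%:R / l.+1%:R) - f (j%:R / l.+1%:R)) * (c j)%:R)| <= C / l.+1%:R.
Proof.
move=> C0 f_lip z01 cl cz ncz c_homo.
have l0 : (0 : R) < l.+1%:R by [].
pose g (j : nat) := f (j%:R / l.+1%:R).
have [j0 cj0 minj] : exists2 j0, c j0 & forall j, c j -> (j0 <= j)%N.
  have ex : exists j, c j by exists l.+1.
  by case: (ex_minnP ex) => j cj min; exists j.
have j0l : (j0 <= l.+1)%N := minj _ cl.
have sumE : forall m, (j0 <= m)%N -> \sum_(j < m) (g j.+1 - g j) * (c j)%:R = g m - g j0.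
  elim=> [|m IH]; first by rewrite leqn0 big_ord0 => /eqP ->; rewrite subrr.
  rewrite big_ord_recr /= leq_eqVlt => /orP[/eqP E|]; last first.
    rewrite ltnS => j0m; rewrite IH// (_ : c m) ?mulr1 ?addrA; first ring.
    by have := c_homo _ _ j0m; rewrite cj0.
  rewrite E subrr big1 ?add0r => [|j _]; last first.
    case cj : (c j); rewrite ?mulr0//; have := minj _ cj.
    by rewrite E leqNgt ltnS ltnW.
  case cm : (c m); rewrite ?mulr0//; have := minj _ cm.
  by rewrite E ltnn.
rewrite (sumE _ j0l) {1}/g divff ?gt_eqF// subKr.
have jz : 0 <= (j0%:R / l.+1%:R : R) <= 1.
  by rewrite divr_ge0//= ler_pdivrMr// mul1r ler_nat.
apply: le_trans (f_lip _ _ z01 jz) _; apply: ler_wpM2l => //.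
have := cz _ j0l cj0; case: j0 minj {cj0 sumE jz} j0l => [|j] minj jl zj.
  by rewrite mul0r subr0 ger0_norm ?(le_trans zj) ?mul0r//; case/andP: z01.
have : ~~ c j by apply/negP => /minj; rewrite ltnn.
move/(ncz _ (ltnW jl)) => jz; rewrite ler0_norm ?subr_le0// opprB lerBlDr.
by apply: le_trans (lerD (lexx _) jz); rewrite -[j.+1%:R]natr1 mulrDl div1r addrC.
Qed.

Section ColourSumLimits.
Variables (R : realType) (T : eqType).
Implicit Types (u : seq (nat * T)) (a : T) (h : seq T).

Lemma colour_sum_ext K (p p' : nat -> R) (beta beta' : T -> nat -> R) (d d' : T -> R) u h :
  (forall i, (0 < i)%N -> p i = p' i) ->
  (forall a i, a \in h -> (0 < i)%N -> beta a i = beta' a i) ->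
  (forall a, a \in h -> d a = d' a) ->
  colour_sum K p beta d u h = colour_sum K p' beta' d' u h.
Proof.
move=> Ep; elim: h u => //= a h IH u Eb Ed.
have {}IH v : colour_sum K p beta d v h = colour_sum K p' beta' d' v h.
  by apply: IH => [b i bh|b bh]; [apply: Eb|apply: Ed]; rewrite inE bh orbT.
rewrite Ed ?mem_head// IH; congr (_ + _).
rewrite [LHS]big_seq_cond [RHS]big_seq_cond; apply: eq_bigr => i.
rewrite andbT mem_iota => /andP[i0 _]; by rewrite IH /colour_wt Ep// Eb ?mem_head.
Qed.

Lemma colour_sum_cvg K (p : nat -> nat -> R) (beta : nat -> T -> nat -> R) (d : nat -> T -> R)
    (p' : nat -> R) (beta' : T -> nat -> R) (d' : T -> R) u h :
  (forall i, p ^~ i @ \oo --> p' i) ->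
  (forall a i, (fun k => beta k a i) @ \oo --> beta' a i) ->
  (forall a, d ^~ a @ \oo --> d' a) ->
  (fun k => colour_sum K (p k) (beta k) (d k) u h) @ \oo --> colour_sum K p' beta' d' u h.
Proof.
move=> Hp Hb Hd; elim: h u => [|a h IH] u /=; first exact: cvg_cst.
apply: cvgD; first by apply: cvgM.
apply: cvg_sumr => i _; apply: cvgM => //; apply: cvgM => //.
by rewrite /colour_wt; case: ifP => _; [exact: cvg_cst|exact: Hb].
Qed.

End ColourSumLimits.

(** The first [i] terms are all at least [p j], and their sum is at most 1. *)
Lemma decr_le_inv (R : realType) (p : nat -> R) (i : nat) : (forall k, 0 <= p k) ->
  (forall k, (0 < k)%N -> p k.+1 <= p k) -> \sum_(k <- iota 1 i) p k <= 1 ->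
  forall j, (i <= j)%N -> (0 < i)%N -> p j <= i%:R^-1.
Proof.
move=> p0 p_decr p1 j ij i0; have dj k k' : (0 < k <= k')%N -> p k' <= p k.
  elim: k' => [|k' IH]; first by case: k.
  rewrite [(k <= _)%N]leq_eqVlt => /andP[k0 /orP[/eqP ->//|kk']].
  rewrite ltnS in kk'; apply: le_trans (p_decr _ (leq_trans k0 kk')) (IH _).
  by rewrite k0.
rewrite -[leRHS]mul1r ler_pdivlMr ?ltr0n//; apply: le_trans p1.
have -> : p j * i%:R = \sum_(k <- iota 1 i) p j.
  by rewrite big_const_seq count_predT size_iota iter_addr_0 mulr_natr.
rewrite big_seq [leRHS]big_seq; apply: ler_sum => k; rewrite mem_iota add1n ltnS.
by move=> /andP[k0 ki]; apply: dj; rewrite k0 (leq_trans ki).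
Qed.

(** Rational, because distribution functions are followed only at rational arguments. *)
Definition grid_pt (l j : nat) : rat := j%:R / l.+1%:R.

Lemma ratr_grid_pt (R : realType) l j : ratr (grid_pt l j) = j%:R / l.+1%:R :> R.
Proof. by rewrite /grid_pt fmorph_div !rmorph_nat. Qed.

Section GridSum.
Variables (R : realType) (f : R -> R) (l : nat).

(** Summation by parts: an approximate integral of [f] against a measure on [0, 1] with distribution
    function [c], linear in [c] and using finitely many of its values. *)
Definition grid_sum (c : rat -> R) : R :=
  f 1 * c 1 - \sum_(j < l.+1)
    (f (ratr (grid_pt l j.+1)) - f (ratr (grid_pt l j))) * c (grid_pt l j).

Lemma grid_sum_linear (I : Type) (s : seq I) (w : I -> R) (c : I -> rat -> R) :
  grid_sum (fun r => \sum_(i <- s) w i * c i r) = \sum_(i <- s) w i * grid_sum (c i).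
Proof.
rewrite /grid_sum mulr_sumr; under [X in _ - X]eq_bigr do rewrite mulr_sumr.
rewrite exchange_big -sumrB; apply: eq_bigr => i _; rewrite mulrBr mulrCA; congr (_ - _).
by rewrite mulr_sumr; apply: eq_bigr => j _; rewrite mulrCA.
Qed.

Lemma grid_sum_cvg (c : nat -> rat -> R) (c' : rat -> R) :
  (forall r, c ^~ r @ \oo --> c' r) -> (fun k => grid_sum (c k)) @ \oo --> grid_sum c'.
Proof.
move=> Hc; apply: cvgB; first by apply: cvgM => //; exact: cvg_cst.
by apply: cvg_sumr => j _; apply: cvgM => //; exact: cvg_cst.
Qed.

Lemma grid_sum_step (C z : R) (c : rat -> bool) : 0 <= C ->
  (forall x y, 0 <= x <= 1 -> 0 <= y <= 1 -> `|f x - f y| <= C * `|x - y|) ->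
  0 <= z <= 1 -> c 1 -> (forall r, 0 <= r <= 1 -> c r -> z <= ratr r) ->
  (forall r, 0 <= r <= 1 -> ~~ c r -> ratr r <= z) ->
  (forall r r', r <= r' -> c r -> c r') ->
  `|f z - grid_sum (fun r => (c r)%:R)| <= C / l.+1%:R.
Proof.
move=> C0 f_lip z01 c1 cz ncz c_homo.
have g01 j : (j <= l.+1)%N -> 0 <= grid_pt l j <= 1.
  by move=> jl; rewrite /grid_pt divr_ge0//= ler_pdivrMr ?mul1r ?ler_nat// ltr0n.
have := @grid_step R f C z l (fun j => c (grid_pt l j)) C0 f_lip z01.
rewrite /grid_sum c1 mulr1; under [in X in _ -> X]eq_bigr do rewrite !ratr_grid_pt.
apply.
- by rewrite /grid_pt divff// pnatr_eq0.
- by move=> j jl cj; rewrite -ratr_grid_pt; apply: cz => //; exact: g01.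
- by move=> j jl cj; rewrite -ratr_grid_pt; apply: ncz => //; exact: g01.
move=> i j ij; apply/implyP/c_homo; rewrite /grid_pt ler_pM2r ?ler_nat//.
Qed.

End GridSum.

Section Clamp.
Variable R : realType.

(** The uniform measure is defined on the whole line; points outside [0, 1[ are sent to 0, so that
    the bounds hold everywhere. *)
Definition clamp (u : R) : R := u * \1_(`[0, 1[%classic : set R) u.

Lemma clampE u : 0 <= u < 1 -> clamp u = u.
Proof. by move=> u01; rewrite /clamp indicE mem_set ?mulr1//= in_itv. Qed.

Lemma clamp_bounds u : 0 <= clamp u < 1.
Proof.
have [u01|nu01] := boolP (0 <= u < 1); first by rewrite clampE.
by rewrite /clamp indicE memNset ?mulr0 ?lexx//= in_itv; apply/negP.
Qed.

Lemma measurable_clamp : measurable_fun setT clamp.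
Proof. by apply: measurable_funM => //; apply: measurable_indic. Qed.

End Clamp.

(** * Expectations of bounded functions *)

Section Means.
Variables (d : measure_display) (T : measurableType d) (R : realType) (U : probability T R).
Implicit Types (f g : T -> R).
Local Notation "'mean' f" := (Rintegral U setT f) (at level 10).

Lemma integrable_bounded f C : measurable_fun setT f -> (forall x, `|f x| <= C) ->
  U.-integrable setT (EFin \o f).
Proof.
move=> mf fC; apply: measurable_bounded_integrable => //.
  by rewrite /= probability_setT ltry.
by exists C; split; [exact: num_real|move=> M CM x _ /=]; apply: le_trans (fC x) (ltW CM).
Qed.

Lemma mean_cst c : mean (fun=> c) = c.
Proof. by rewrite Rintegral_cst//= probability_setT mulr1. Qed.

Lemma mean_dist f g C : U.-integrable setT (EFin \o f) -> U.-integrable setT (EFin \o g) ->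
  (forall x, `|f x - g x| <= C) -> `|mean f - mean g| <= C.
Proof.
move=> intf intg fgC; rewrite -RintegralB//.
have int_fg : U.-integrable setT (EFin \o (fun x => f x - g x)).
  by have := integrableB measurableT intf intg; congr (integrable _ _ _).
apply: le_trans (le_normr_Rintegral measurableT int_fg) _.
rewrite -[leRHS]mean_cst; apply: le_Rintegral => //; first exact: integrable_norm.
exact: finite_measure_integrable_cst.
Qed.

Lemma integrable_bool (c : T -> bool) : measurable [set x | c x] ->
  U.-integrable setT (EFin \o (fun x => (c x)%:R)).
Proof.
move=> mc; have := @integrable_indic _ _ _ U _ mc; congr (integrable _ _ _).
by apply/funext => x /=; rewrite indicE; case cx : (c x); [rewrite mem_set|rewrite memNset//= cx].
Qed.

Lemma mean_bool (c : T -> bool) : measurable [set x | c x] ->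
  mean (fun x => (c x)%:R) = fine (U [set x | c x]).
Proof.
move=> mc; rewrite /Rintegral -[X in _ = fine (U X)]setIT -integral_indic//; congr fine.
apply: eq_integral => x _; rewrite indicE.
by case cx : (c x); [rewrite mem_set|rewrite memNset//= cx].
Qed.

Lemma integrable_linear (I : Type) (s : seq I) (w : I -> R) (F : I -> T -> R) :
  (forall i, U.-integrable setT (EFin \o F i)) ->
  U.-integrable setT (EFin \o (fun x => \sum_(i <- s) w i * F i x)).
Proof.
move=> intF; rewrite (_ : _ \o _ = fun x => (\sum_(i <- s) (w i)%:E * (EFin \o F i) x)%E).
  by apply: integrable_sum => // i _; exact: integrableZl.
by apply/funext => x /=; rewrite -sumEFin; apply: eq_bigr => i _; rewrite EFinM.
Qed.

Lemma mean_linear (I : Type) (s : seq I) (w : I -> R) (F : I -> T -> R) :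
  (forall i, U.-integrable setT (EFin \o F i)) ->
  mean (fun x => \sum_(i <- s) w i * F i x) = \sum_(i <- s) w i * mean (F i).
Proof.
move=> intF; elim: s => [|i s IH].
  by rewrite big_nil -[RHS]mean_cst; apply: eq_Rintegral => x _; rewrite big_nil.
rewrite big_cons -IH -RintegralZl// -RintegralD//; last exact: integrable_linear.
- by apply: eq_Rintegral => x _; rewrite big_cons.
have := @integrable_linear _ [:: i] w F intF; congr (integrable _ _ _).
by apply/funext => x /=; rewrite big_seq1.
Qed.

Lemma mean_grid_sum l (c : T -> rat -> bool) (h : R -> R) :
  (forall r, measurable [set x | c x r]) ->
  U.-integrable setT (EFin \o (fun x => grid_sum h l (fun r => (c x r)%:R))) /\
  mean (fun x => grid_sum h l (fun r => (c x r)%:R)) =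
  grid_sum h l (fun r => fine (U [set x | c x r])).
Proof.
move=> mc; have int1 r := integrable_bool (mc r).
have E (v : rat -> R) : grid_sum h l v = \sum_(j <- None :: map Some (index_enum 'I_l.+1))
    (if j is Some j then
       - (h (ratr (grid_pt l j.+1)) - h (ratr (grid_pt l j))) else h 1) *
    v (if j is Some j then grid_pt l j else 1).
  rewrite big_cons big_map /grid_sum; congr (_ + _); rewrite -sumrN.
  by apply: eq_bigr => j _; rewrite mulNr.
have -> : (fun x => grid_sum h l (fun r => (c x r)%:R)) = (fun x =>
    \sum_(j <- None :: map Some (index_enum 'I_l.+1))
    (if j is Some j then
       - (h (ratr (grid_pt l j.+1)) - h (ratr (grid_pt l j))) else h 1) *
    (c x (if j is Some j then grid_pt l j else 1))%:R).
  by apply/funext => x; rewrite E.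
split; first exact: integrable_linear.
by rewrite mean_linear// E; apply: eq_bigr => j _; rewrite mean_bool.
Qed.

End Means.

Lemma cvg_atom_wt (R : realType) (x : nat -> R) (y : R) a :
  x @ \oo --> y -> (fun k => atom_wt (x k) a) @ \oo --> atom_wt y a.
Proof.
move=> xy; have H (m : nat) (z : nat -> R) (l : R) : z @ \oo --> l ->
    (fun k => z k ^+ m) @ \oo --> l ^+ m.
  move=> zl; elim: m => [|m IH]; first by rewrite expr0; under eq_fun do rewrite expr0; exact: cvg_cst.
  by rewrite exprS; under eq_fun do rewrite exprS; exact: cvgM.
by apply: cvgM; apply: H => //; apply: cvgB => //; exact: cvg_cst.
Qed.

Lemma dist_chain (R : realType) (x y u v c e : R) : c < e / 4 -> `|x - u| <= c ->
  `|y - v| <= c -> `|u - v| < e / 4 -> `|x - y| < e.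
Proof. by rewrite !ler_norml !ltr_norml; lra. Qed.

Lemma dist_chain4 (R : realType) (m e e' c A B V V' L : R) : 0 <= m -> 0 < e -> 0 <= c ->
  c <= e' -> e' * (m + 1) ^+ 2 = e / 8 -> `|A - B| <= m * (m * c + 0) ->
  `|V - B| < e / 4 -> `|V' - V| <= m * (m * c + e') -> `|L - V'| < e / 4 -> `|L - A| < e.
Proof.
move=> m0 e0 c0 ce' E; have H1 : m * (m * c) <= e / 8 by rewrite -E; nra.
have H2 : m * (m * c + e') <= e / 8 by rewrite -E; nra.
by rewrite addr0 !ler_norml !ltr_norml; lra.
Qed.

(** * Convergent frequencies and negation rates at one sample point *)

Section SequenceLimits.
Variables (R : realType) (n : nat -> nat) (p t : nat -> nat -> R).
Variables (P Tau : nat -> R) (M : seq bool -> R) (F : nat -> rat -> R) (p0 : R) (G : rat -> R).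
Hypothesis n_ge : forall k, (k <= n k)%N.
Hypothesis p_ge0 : forall k i, 0 <= p k i.
Hypothesis p_decr : forall k i, (0 < i)%N -> p k i.+1 <= p k i.
Hypothesis p_le1 : forall k K, \sum_(i <- iota 1 K) p k i <= 1.
Hypothesis p_sum : forall k, \sum_(i <- iota 1 (n k)) p k i = 1.
Hypothesis t01 : forall k i, 0 <= t k i <= 1.
Hypothesis cvg_p : forall i, p ^~ i @ \oo --> P i.
Hypothesis cvg_t : forall i, t ^~ i @ \oo --> Tau i.
Hypothesis cvg_M : forall a,
  (fun k => \sum_(i <- iota 1 (n k)) p k i * atom_wt (t k i) a) @ \oo --> M a.
Hypothesis cvg_F : forall K r,
  (fun k => \sum_(i <- iota K.+1 (n k - K)) p k i * (t k i <= ratr r)%R%:R) @ \oo --> F K r.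
Hypothesis cvg_p0 : (fun K => 1 - \sum_(i <- iota 1 K) P i) @ \oo --> p0.
Hypothesis cvg_G : forall r, F ^~ r @ \oo --> G r.

Let iota_split K k : (K <= n k)%N -> iota 1 (n k) = iota 1 K ++ iota K.+1 (n k - K).
Proof. by move=> Kn; rewrite -{1}(subnKC Kn) iotaD add1n. Qed.

Let near_n K : \forall k \near \oo, (K <= n k)%N.
Proof. by exists K => // k /= Kk; apply: leq_trans (n_ge k). Qed.

Lemma lim_p_ge0 i : 0 <= P i.
Proof. by apply: (cvgr_to_ge (@cvg_p i)); exact: nearW. Qed.

Lemma lim_p_decr i : (0 < i)%N -> P i.+1 <= P i.
Proof.
move=> i0; apply: (ler_cvg_to (@cvg_p i.+1) (@cvg_p i)).
by apply: nearW => k; exact: p_decr.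
Qed.

Lemma lim_t01 i : 0 <= Tau i <= 1.
Proof.
by apply/andP; split; [apply: (cvgr_to_ge (@cvg_t i))|apply: (cvgr_to_le (@cvg_t i))];
  apply: nearW => k; case/andP: (t01 k i).
Qed.

Let cvg_sum_p K : (fun k => \sum_(i <- iota 1 K) p k i) @ \oo --> \sum_(i <- iota 1 K) P i.
Proof. by apply: cvg_sumr. Qed.

Lemma lim_p_le1 K : \sum_(i <- iota 1 K) P i <= 1.
Proof. by apply: (cvgr_to_le (@cvg_sum_p K)); exact: nearW. Qed.

Lemma lim_p0_bounds : 0 <= p0 <= 1.
Proof.
apply/andP; split.
  by apply: (cvgr_to_ge (@cvg_p0)); apply: nearW => K; rewrite subr_ge0 lim_p_le1.
apply: (cvgr_to_le (@cvg_p0)); apply: nearW => K; rewrite gerBl; apply: sumr_ge0 => i _.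
exact: lim_p_ge0.
Qed.

Let F_le K r r' : r <= r' -> F K r <= F K r'.
Proof.
move=> rr'; apply: (ler_cvg_to (@cvg_F K r) (@cvg_F K r')).
apply: nearW => k; apply: ler_sum => i _; apply: ler_wpM2l => //; rewrite ler_nat.
by case: (leP (t k i) (ratr r)) => // /le_trans ->//; rewrite ler_rat.
Qed.

(** Negation rates never exceed 1, so at such [r] the whole tail is counted: all the mass that the
    first [K] classes leave. *)
Let F_one K r : 1 <= r -> F K r = 1 - \sum_(i <- iota 1 K) P i.
Proof.
move=> r1; apply: (@cvg_unique _ (@Rhausdorff R) _ _ _ _ (@cvg_F K r)).
have H : (fun k => 1 - \sum_(i <- iota 1 K) p k i) @ \oo --> 1 - \sum_(i <- iota 1 K) P i.
  by apply: cvgB; [exact: cvg_cst|exact: cvg_sum_p].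
apply: cvg_trans H; apply: near_eq_cvg; near=> k.
have Kn : (K <= n k)%N by near: k; exact: near_n.
have := p_sum k; rewrite (iota_split Kn) big_cat /= => E.
rewrite -[X in X - _]E [X in X - _]addrC addrK.
apply: eq_bigr => i _; have /andP[_ ti] := t01 k i.
by rewrite (le_trans ti) ?mulr1//; rewrite -(rmorph1 (@ratr R)) ler_rat.
Unshelve. all: end_near.
Qed.

Lemma lim_F_ge0 K r : 0 <= F K r.
Proof.
apply: (cvgr_to_ge (@cvg_F K r)).
by apply: nearW => k; apply: sumr_ge0 => i _; rewrite mulr_ge0.
Qed.

Lemma lim_F_decr K r : F K.+1 r <= F K r.
Proof.
apply: (ler_cvg_to (@cvg_F K.+1 r) (@cvg_F K r)); near=> k.
have Kn : (K.+1 <= n k)%N by near: k; exact: near_n.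
by rewrite -[(n k - K)%N]subSS subSn//= big_cons lerDr mulr_ge0.
Unshelve. all: end_near.
Qed.

Lemma lim_F_cvg r : cvgn (F ^~ r).
Proof.
apply: nonincreasing_is_cvgn; first by apply/nonincreasing_seqP => K; exact: lim_F_decr.
by exists 0 => _ [K _ <-]; exact: lim_F_ge0.
Qed.

Lemma lim_p0_cvg : cvgn (fun K => 1 - \sum_(i <- iota 1 K) P i).
Proof.
apply: nonincreasing_is_cvgn.
  apply/nonincreasing_seqP => K; rewrite lerB// -[K.+1]addn1 iotaD big_cat /= lerDl.
  by rewrite big_seq1 lim_p_ge0.
by exists 0 => _ [K _ <-]; rewrite subr_ge0 lim_p_le1.
Qed.

Lemma lim_G_le r r' : r <= r' -> G r <= G r'.
Proof.
move=> rr'; apply: (ler_cvg_to (@cvg_G r) (@cvg_G r')).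
by apply: nearW => K; exact: F_le.
Qed.

Lemma lim_G_one r : 1 <= r -> G r = p0.
Proof.
move=> r1; apply: (@cvg_unique _ (@Rhausdorff R) _ _ _ _ (@cvg_G r)).
have -> : F ^~ r = (fun K => 1 - \sum_(i <- iota 1 K) P i).
  by apply/funext => K; exact: F_one.
exact: cvg_p0.
Qed.

Lemma lim_G_bounds r : 0 <= G r <= p0.
Proof.
apply/andP; split; last first.
  have [r1|/ltW r1] := leP r 1; first by rewrite -(lim_G_one (lexx 1)) lim_G_le.
  by rewrite lim_G_one.
by apply: (cvgr_to_ge (@cvg_G r)); apply: nearW => K; exact: lim_F_ge0.
Qed.

(** The tail of a moment is an average of a Lipschitz function, recovered from the tail distribution
    function by [grid_sum]. The error does not depend on [K], so [K] may go to infinity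
    afterwards. *)
Lemma lim_tail_grid K a l :
  `|M a - \sum_(i <- iota 1 K) P i * atom_wt (Tau i) a -
    grid_sum (fun x => atom_wt x a) l (F K)| <= (size a)%:R / l.+1%:R.
Proof.
have cw i : (fun k => p k i * atom_wt (t k i) a) @ \oo --> P i * atom_wt (Tau i) a.
  by apply: cvgM => //; exact: cvg_atom_wt.
have cl : (fun k => `|\sum_(i <- iota 1 (n k)) p k i * atom_wt (t k i) a -
    \sum_(i <- iota 1 K) p k i * atom_wt (t k i) a -
    grid_sum (fun x => atom_wt x a) l (fun r => \sum_(i <- iota K.+1 (n k - K))
      p k i * (t k i <= ratr r)%R%:R)|) @ \oo -->
  `|M a - \sum_(i <- iota 1 K) P i * atom_wt (Tau i) a -
    grid_sum (fun x => atom_wt x a) l (F K)|.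
  apply: cvg_norm; apply: cvgB; first by apply: cvgB => //; exact: cvg_sumr.
  by apply: grid_sum_cvg => r; exact: cvg_F.
apply: (cvgr_to_le cl); near=> k; have Kn : (K <= n k)%N by near: k; exact: near_n.
have -> : \sum_(i <- iota 1 (n k)) p k i * atom_wt (t k i) a =
    \sum_(i <- iota 1 K) p k i * atom_wt (t k i) a +
    \sum_(i <- iota K.+1 (n k - K)) p k i * atom_wt (t k i) a.
  by rewrite (iota_split Kn) big_cat.
rewrite [X in X - _ - _]addrC addrK grid_sum_linear -sumrB.
apply: le_trans (ler_norm_sum _ _ _) _.
apply: (@le_trans _ _ (\sum_(i <- iota K.+1 (n k - K)) p k i * ((size a)%:R / l.+1%:R))).
  apply: ler_sum => i _; rewrite -mulrBr normrM ger0_norm//; apply: ler_wpM2l => //.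
  apply: (@grid_sum_step R (fun x => atom_wt x a) l _ _ (fun r => t k i <= ratr r)) => //.
  - by move=> x y; exact: atom_wt_lipschitz.
  - by rewrite rmorph1; case/andP: (t01 k i).
  - by move=> r _; rewrite -ltNge => /ltW.
  - by move=> r r' rr' /le_trans; apply; rewrite ler_rat.
rewrite -mulr_suml ler_piMl ?divr_ge0//.
rewrite -[leRHS](p_sum k) (iota_split Kn) big_cat /= lerDr; exact: sumr_ge0.
Unshelve. all: end_near.
Qed.

Let iota_sum_le (c : nat -> R) K K' : (forall i, 0 <= c i) -> (K <= K')%N ->
  \sum_(i <- iota 1 K) c i <= \sum_(i <- iota 1 K') c i.
Proof.
move=> c0 /subnKC <-; rewrite iotaD big_cat /= lerDl; exact: sumr_ge0.
Qed.

Lemma lim_p0_le K : p0 + \sum_(i <- iota 1 K) P i <= 1.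
Proof.
rewrite -lerBrDr; apply: (cvgr_to_le (@cvg_p0)); exists K => // K' /= KK'.
by apply: lerB => //; apply: iota_sum_le => //; exact: lim_p_ge0.
Qed.

Section Dust.
(** A quantile function of G / p0, described by two inequalities multiplied by [p0] so that [p0] may
    vanish. *)
Variable Z : R -> R.
Hypothesis measurable_Z : measurable_fun setT Z.
Hypothesis Z01 : forall u, 0 <= Z u <= 1.
Hypothesis Z_le : forall u r, 0 <= r <= 1 -> p0 * clamp u < G r -> Z u <= ratr r.
Hypothesis Z_ge : forall u r, 0 <= r <= 1 -> G r <= p0 * clamp u -> ratr r <= Z u.

Let measurable_G r : measurable [set u | p0 * clamp u < G r].
Proof.
have m1 : measurable_fun setT (fun u : R => p0 * clamp u).
  by apply: measurable_funM => //; exact: measurable_clamp.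
have := measurable_fun_ltr m1 (measurable_cst (G r)) measurableT (Y := [set true]).
by rewrite setTI; apply.
Qed.

Definition dust_mean a : R := Rintegral (@unif R) setT (fun u => atom_wt (Z u) a).

Let measurable_atom_Z a : measurable_fun setT (fun u => atom_wt (Z u) a).
Proof. exact: (measurableT_comp (@measurable_atom_wt R a) measurable_Z). Qed.

Let integrable_atom_Z a : (@unif R).-integrable setT (EFin \o (fun u => atom_wt (Z u) a)).
Proof.
apply: (@integrable_bounded _ _ _ _ _ 1) => // u.
by have /andP[a0 a1] := atom_wt_bounds a (Z01 u); rewrite ger0_norm.
Qed.

Lemma dust_mean_bounds a : 0 <= dust_mean a <= 1.
Proof.
have B u := atom_wt_bounds a (Z01 u).
apply/andP; split; first by apply: Rintegral_ge0 => u _; case/andP: (B u).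
apply: (@le_trans _ _ (Rintegral (@unif R) setT (fun=> 1 : R))); last by rewrite mean_cst.
apply: le_Rintegral => //.
  exact: finite_measure_integrable_cst.
by move=> u _; case/andP: (B u).
Qed.

(** If [p0] is 0, so is [G], and both terms vanish. Otherwise the event p0 u < G r has probability G
    r / p0, and the grid sum of [G] is [p0] times the expected grid sum of the step functions
    belonging to [Z]. *)
Lemma dust_mean_grid a l :
  `|p0 * dust_mean a - grid_sum (fun x => atom_wt x a) l G| <= (size a)%:R / l.+1%:R.
Proof.
have /andP[p0_ge0 p0_le1] := lim_p0_bounds.
move: p0_ge0; rewrite le_eqVlt => /predU1P[p00|p0_gt0].
  have G0 r : G r = 0.
    by apply/eqP; rewrite eq_le; have := lim_G_bounds r; rewrite -p00 andbC.
  rewrite /grid_sum big1 => [|j _]; last by rewrite G0 mulr0.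
  by rewrite -p00 mul0r G0 mulr0 !subr0 normr0 divr_ge0.
have [intJ meanJ] := mean_grid_sum (@unif R) l (fun x : R => atom_wt x a) measurable_G.
have Gp r : fine (unif [set u | p0 * clamp u < G r]) = p0^-1 * G r.
  have /andP[G0 Gp0] := lim_G_bounds r.
  have -> : unif [set u | p0 * clamp u < G r] = unif `[0, G r / p0[%classic.
    apply: unif_ext => u u01; rewrite /= in_itv /= clampE//.
    by case/andP: u01 => -> _ /=; rewrite ltr_pdivlMr// mulrC.
  have Gp0' : G r / p0 <= 1 by rewrite ler_pdivrMr// mul1r.
  have Gp0'' : 0 <= G r / p0 by rewrite divr_ge0// ltW.
  by rewrite (unif_itv (lexx 0) Gp0'' Gp0') /= subr0 mulrC.
have -> : grid_sum (fun x => atom_wt x a) l G =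
    p0 * grid_sum (fun x => atom_wt x a) l (fun r => fine (unif [set u | p0 * clamp u < G r])).
  have := @grid_sum_linear R (fun x => atom_wt x a) l _ [:: tt] (fun=> p0)
    (fun _ r => fine (unif [set u | p0 * clamp u < G r])).
  rewrite big_seq1 => <-; congr grid_sum; apply/funext => r.
  by rewrite big_seq1 Gp mulrA mulfV ?mul1r// gt_eqF.
rewrite -meanJ -mulrBr normrM gtr0_norm// -[leRHS]mul1r.
apply: (ler_pM (ltW p0_gt0) (normr_ge0 _) p0_le1).
apply: mean_dist => // u; apply: (@grid_sum_step R (fun x => atom_wt x a) l) => //.
- by move=> x y; exact: atom_wt_lipschitz.
- rewrite lim_G_one// gtr_pMr//; by case/andP: (clamp_bounds u).
- by move=> r r01; exact: Z_le.
- by move=> r r01; rewrite -leNgt; exact: Z_ge.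
- by move=> r r' rr' /lt_le_trans; apply; exact: lim_G_le.
Qed.

(** Both sides are within a fixed grid error of the grid sums of [F K] and of [G], and these
    converge to each other since only finitely many values enter. *)
Lemma dust_mean_cvg a :
  (fun K => M a - \sum_(i <- iota 1 K) P i * atom_wt (Tau i) a) @ \oo --> p0 * dust_mean a.
Proof.
apply/cvgrPdist_lt => e e0; have e4 : 0 < e / 4 by lra.
have [l Hl] : exists l : nat, (size a)%:R / l.+1%:R < e / 4.
  have H : (fun l => (size a)%:R / l.+1%:R : R) @ \oo --> 0.
    rewrite -[X in _ --> X](mulr0 (size a)%:R); apply: cvgM; first exact: cvg_cst.
    exact: cvg_harmonic.
  have [l _ /(_ l (leqnn l)) ?] := @cvgr_lt _ _ _ _ _ _ H _ e4; by exists l.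
have := @grid_sum_cvg R (fun x => atom_wt x a) l _ _ (@cvg_G).
move=> /cvgrPdist_lt/(_ _ e4)[K0 _ HK0]; exists K0 => // K /= /HK0 /=.
exact: dist_chain Hl (dust_mean_grid a l) (lim_tail_grid K a l).
Qed.

End Dust.

(** An exchange of the limits in [k] and in [K]. Cutting at [K] costs an error of order 1/K
    uniformly in [k], because decreasing frequencies of total at most 1 are below 1/K from [K]
    on. *)
Lemma colour_sum_limit (D : seq bool -> R) (h : seq (seq bool)) (L : R) :
  (forall a, (fun K => M a - \sum_(i <- iota 1 K) P i * atom_wt (Tau i) a) @ \oo --> D a) ->
  (forall a, 0 <= D a <= p0) ->
  (fun K => colour_sum K P (fun a i => atom_wt (Tau i) a) D [::] h) @ \oo --> L ->
  (fun k => colour_sum (n k) (p k) (fun a i => atom_wt (t k i) a) (fun=> 0) [::] h) @ \oo --> L.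
Proof.
move=> cD D_bounds cL; pose m : R := (size h)%:R.
apply/cvgrPdist_lt => e e0.
(* Chosen so that m (m e' + e') is at most e/8. *)
pose e' := e / 8 / (m + 1) ^+ 2; have m0 : 0 <= m by rewrite ler0n.
have m10 : 0 < (m + 1) ^+ 2 by rewrite exprn_gt0// ltr_wpDl.
have e'0 : 0 < e' by rewrite !divr_gt0.
have e'E : e' * (m + 1) ^+ 2 = e / 8 by rewrite divfK ?gt_eqF.
have e4 : 0 < e / 4 by lra.
have near_h : exists K1, forall K, (K1 <= K)%N -> forall a, a \in h ->
    `|D a - (M a - \sum_(i <- iota 1 K) P i * atom_wt (Tau i) a)| < e'.
  elim: (h) => [|a s [K1 IH]]; first by exists 0%N.
  have /cvgrPdist_lt/(_ _ e'0)[K2 _ HK2] := cD a.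
  exists (maxn K1 K2) => K; rewrite geq_max => /andP[KK1 KK2] b.
  by rewrite inE => /orP[/eqP ->|bs]; [exact: HK2|exact: IH].
have [K [K0 KD KL Kh]] : exists K, [/\ (0 < K)%N, K%:R^-1 < e',
    `|L - colour_sum K P (fun a i => atom_wt (Tau i) a) D [::] h| < e / 4 &
    forall a, a \in h ->
    `|D a - (M a - \sum_(i <- iota 1 K) P i * atom_wt (Tau i) a)| < e'].
  move/cvgrPdist_lt : cL => /(_ _ e4)[K1 _ H1].
  have [K2 H2] := near_h.
  have /cvgr0Pnorm_lt/(_ _ e'0)[K3 _ H3] := @cvg_harmonic R.
  exists (K1 + K2 + K3).+1; split => //.
  - have := H3 (K1 + K2 + K3)%N; rewrite /= ger0_norm//; apply; exact: leq_addl.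
  - by apply: H1; rewrite /=; lia.
  - by apply: H2; lia.
pose dK a := M a - \sum_(i <- iota 1 K) P i * atom_wt (Tau i) a.
pose d k a := \sum_(i <- iota K.+1 (n k - K)) p k i * atom_wt (t k i) a.
have cw i a : (fun k => p k i * atom_wt (t k i) a) @ \oo --> P i * atom_wt (Tau i) a.
  by apply: cvgM => //; exact: cvg_atom_wt.
have t_wt k i a := atom_wt_bounds a (t01 k i).
have cd a : d ^~ a @ \oo --> dK a.
  have H : (fun k => \sum_(i <- iota 1 (n k)) p k i * atom_wt (t k i) a -
      \sum_(i <- iota 1 K) p k i * atom_wt (t k i) a) @ \oo --> dK a.
    by apply: cvgB => //; exact: cvg_sumr.
  apply: cvg_trans H; apply: near_eq_cvg; near=> k.
  have Kn : (K <= n k)%N by near: k; exact: near_n.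
  by rewrite (iota_split Kn) big_cat /= [X in X - _]addrC addrK.
have d_ge0 k a : 0 <= d k a.
  by apply: sumr_ge0 => i _; rewrite mulr_ge0//; case/andP: (t_wt k i a).
have d_le k a : (K <= n k)%N -> d k a + \sum_(i <- iota 1 K) p k i <= 1.
  move=> Kn; rewrite -[leRHS](p_sum k) (iota_split Kn) big_cat /= [leRHS]addrC lerD2r.
  apply: ler_sum => i _; rewrite ler_piMr//; by case/andP: (t_wt k i a).
have dK_ge0 a : 0 <= dK a by apply: (cvgr_to_ge (@cd a)); exact: nearW.
have dK_le a : dK a + \sum_(i <- iota 1 K) P i <= 1.
  have H : (fun k => d k a + \sum_(i <- iota 1 K) p k i) @ \oo -->
      dK a + \sum_(i <- iota 1 K) P i by apply: cvgD => //; exact: cvg_sum_p.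
  apply: (cvgr_to_le H); near=> k; apply: d_le; near: k; exact: near_n.
have cB : (fun k => colour_sum K (p k) (fun a i => atom_wt (t k i) a) (d k) [::] h) @ \oo -->
    colour_sum K P (fun a i => atom_wt (Tau i) a) dK [::] h.
  by apply: colour_sum_cvg => // a i; exact: cvg_atom_wt.
have limK : `|colour_sum K P (fun a i => atom_wt (Tau i) a) D [::] h -
    colour_sum K P (fun a i => atom_wt (Tau i) a) dK [::] h| <= m * (m * K%:R^-1 + e').
  (* [dK] is known to be close to [D] only on the letters of [h], while the truncation bound
     compares dust weights on all letters; elsewhere [D] is put on both sides. With equal numbers of
     colours that bound compares just the two dusts. *)
  pose dh a := if a \in h then dK a else D a.
  rewrite (@colour_sum_ext _ _ K P P _ (fun a i => atom_wt (Tau i) a) dK dh) //; last first.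
    by move=> a ah; rewrite /dh ah.
  apply: (@colour_sum_trunc R _ K K P (fun a i => atom_wt (Tau i) a) dh D K%:R^-1 e').
  - exact: leqnn.
  - exact: lim_p_ge0.
  - by move=> a i; exact/atom_wt_bounds/lim_t01.
  - by move=> a; rewrite /dh; case: ifP => // _; case/andP: (D_bounds a).
  - by move=> a; case/andP: (D_bounds a).
  - move=> a; rewrite /dh; case: ifP => // _; apply: le_trans (lim_p0_le K).
    by rewrite lerD2r; case/andP: (D_bounds a).
  - move=> a; apply: le_trans (lim_p0_le K).
    by rewrite lerD2r; case/andP: (D_bounds a).
  - move=> i Ki; apply: (decr_le_inv lim_p_ge0 lim_p_decr (lim_p_le1 K)) => //.
    exact: ltnW.
  - move=> a; rewrite subnn big_nil addr0 /dh; case: ifP => [ah|_].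
      exact/ltW/Kh.
    by rewrite subrr normr0 ltW.
move/cvgrPdist_lt : cB => /(_ _ e4) [k0 _ Hk0].
exists (k0 + K)%N => // k /= k0k; have Kn : (K <= n k)%N.
  by apply: leq_trans (n_ge k); apply: leq_trans k0k; exact: leq_addl.
have distA : `|colour_sum (n k) (p k) (fun a i => atom_wt (t k i) a) (fun=> 0) [::] h -
    colour_sum K (p k) (fun a i => atom_wt (t k i) a) (d k) [::] h| <= m * (m * K%:R^-1 + 0).
  apply: (@colour_sum_trunc R _ K (n k) (p k) (fun a i => atom_wt (t k i) a) (d k)
    (fun=> 0) K%:R^-1 0) => //.
  - by move=> a; exact: d_le.
  - by move=> a; rewrite add0r.
  - by move=> i Ki; apply: (decr_le_inv (p_ge0 k) (@p_decr k) (p_le1 k K)) => //; exact: ltnW.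
  - by move=> a; rewrite add0r subrr normr0.
have := Hk0 k (leq_trans (leq_addr _ _) k0k) => /= distB.
have KD0 : 0 <= K%:R^-1 :> R by rewrite invr_ge0.
exact: (dist_chain4 m0 e0 KD0 (ltW KD) e'E distA distB limK KL).
Unshelve. all: end_near.
Qed.

End SequenceLimits.

(** * The dust measure *)

Section DustFamily.
Variables (R : realType) (p0 : R -> R) (G : rat -> R -> R).
Hypothesis measurable_p0 : measurable_fun setT p0.
Hypothesis measurable_G : forall r, measurable_fun setT (G r).

(* The grid value r = 1 is always allowed, so that the infimum is not taken over
   the empty set (where inf is 0). *)
Definition dust_range (xu : R * R) : set R :=
  [set ratr r | r in [set r : rat | 0 <= r <= 1 /\
    (r = 1 \/ p0 xu.1 * clamp xu.2 < G r xu.1)]].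

(** Generalised inverse of the distribution function of the dust, taken over rationals so as to be
    jointly measurable in the sample point and the quantile level. *)
Definition dust_value (xu : R * R) : R := inf (dust_range xu).

Lemma dust_range_has_inf xu : has_inf (dust_range xu).
Proof.
split; first by exists 1, 1; [split; [rewrite ler01 lexx|left]|rewrite rmorph1].
by exists 0 => _ [r [/andP[r0 _] _] <-]; rewrite ler0q.
Qed.

Lemma dust_value_le x u r : 0 <= r <= 1 -> p0 x * clamp u < G r x ->
  dust_value (x, u) <= ratr r.
Proof.
move=> r01 H; apply: ge_inf; first by case: (dust_range_has_inf (x, u)).
by exists r => //; split=> //; right.
Qed.

Lemma dust_value_ge x u r : (forall s s', s <= s' -> G s x <= G s' x) ->
  0 <= r <= 1 -> G r x <= p0 x * clamp u -> ratr r <= dust_value (x, u).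
Proof.
move=> G_le r01 H; apply: lb_le_inf; first by case: (dust_range_has_inf (x, u)).
move=> _ [s [s01 [->|Hs]] <-]; rewrite ler_rat; first by case/andP: r01.
rewrite leNgt; apply/negP => /ltW/G_le sr.
by have := lt_le_trans Hs (le_trans sr H); rewrite ltxx.
Qed.

Lemma dust_value_bounds xu : 0 <= dust_value xu <= 1.
Proof.
have [H0 H1] := dust_range_has_inf xu; apply/andP; split.
  by apply: lb_le_inf => // _ [r [/andP[r0 _] _] <-]; rewrite ler0q.
apply: ge_inf => //; exists 1; last by rewrite rmorph1.
by split; [rewrite ler01 lexx|left].
Qed.

(** The infimum is below [a] exactly when some admissible rational is, which is a countable union of
    measurable conditions. *)
Lemma measurable_dust_value : measurable_fun setT dust_value.
Proof.
apply: (measurability _ (RGenInftyO.measurableE R)) => _ [_ [a ->] <-]; rewrite setTI.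
pose B (r : rat) : set (R * R) := if (0 <= r <= 1) && (ratr r < a) then
  (if r == 1 then setT else [set xu | p0 xu.1 * clamp xu.2 < G r xu.1]) else set0.
have -> : dust_value @^-1` `]-oo, a[ = \bigcup_r B r.
  apply/seteqP; split=> xu /=; rewrite in_itv /=.
    move=> /inf_lt - /(_ (dust_range_has_inf xu).1) [_ [r [r01 H] <-] ra].
    exists r => //; rewrite /B r01 ra /=; case: eqP => // r1; by case: H.
  move=> [r _]; rewrite /B; case: ifP => // /andP[r01 ra] H; apply: le_lt_trans ra.
  apply: ge_inf; first by case: (dust_range_has_inf xu).
  by exists r => //; split=> //; move: H; case: eqP => [->|_ H]; [left|right].
apply: bigcupT_measurable_rat => r; rewrite /B; case: ifP => // _; case: ifP => // _.
have m1 : measurable_fun setT (fun xu : R * R => p0 xu.1 * clamp xu.2).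
  apply: measurable_funM; first by apply: measurableT_comp.
  by apply: measurableT_comp => //; exact: measurable_clamp.
have m2 : measurable_fun setT (fun xu : R * R => G r xu.1) by apply: measurableT_comp.
have := measurable_fun_ltr m1 m2 measurableT (Y := [set true]).
by rewrite setTI; apply.
Qed.

Definition dust_section (x u : R) : R := dust_value (x, u).

Lemma measurable_dust_section x : measurable_fun setT (dust_section x).
Proof. exact: measurableT_comp measurable_dust_value (pair1_measurable x). Qed.

HB.instance Definition _ x := @isMeasurableFun.Build _ _ R R
  (dust_section x) (measurable_dust_section x).

(** A probability measure for every [x], also where [p0 x = 0] and the dust has weight zero. *)
Definition dust_law (x : R) : probability R R :=
  distribution (@unif R) (dust_section x).

Lemma measurable_dust_law E : measurable E -> measurable_fun setT (fun x => dust_law x E).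
Proof.
move=> mE; have mA : measurable (dust_value @^-1` E).
  by have := measurable_dust_value measurableT mE; rewrite setTI.
have := measurable_fun_xsection (@unif R) mA; congr (measurable_fun _ _).
by apply/funext => x /=; rewrite /dust_law /= /pushforward xsectionE.
Qed.

Lemma dust_law_itv x : dust_law x `[0, 1]%classic = 1%E.
Proof.
rewrite /dust_law /= /distribution /pushforward -(@probability_setT _ _ _ (@unif R)); congr unif.
by apply/seteqP; split=> u // _; rewrite /= in_itv /= dust_value_bounds.
Qed.

Lemma dust_law_integral x a : (\int[dust_law x]_(y in `[0%R, 1%R]) (atom_wt y a)%:E)%E =
  (dust_mean (dust_section x) a)%:E.
Proof.
have B y : `[0, 1]%classic y -> 0 <= atom_wt y a <= 1.
  by rewrite /= in_itv /= => /(atom_wt_bounds a).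
have ms := measurable_dust_section x.
rewrite ge0_integral_pushforward//=; first last.
- by move=> y /set_mem /B/andP[y0 _]; rewrite lee_fin.
- by apply/measurable_EFinP/measurable_funTS; exact: measurable_atom_wt.
have -> : dust_section x @^-1` `[0, 1] = setT.
  by apply/seteqP; split=> u // _; rewrite /= in_itv /= dust_value_bounds.
rewrite /dust_mean /Rintegral fineK//; apply: integrable_fin_num => //.
apply: (@integrable_bounded _ _ _ _ _ 1).
  exact: measurableT_comp (@measurable_atom_wt R a) ms.
by move=> u; have /andP[a0 a1] := atom_wt_bounds a (dust_value_bounds (x, u)); rewrite ger0_norm.
Qed.

End DustFamily.

(** * Statistics of random tables and their limit parameters *)

Lemma measurable_finite_comp (R : realType) (T : finType) (t : R -> T) (F : T -> R) :
  (forall X, measurable (t @^-1` [set X])) -> measurable_fun setT (F \o t).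
Proof.
move=> mt; have -> : F \o t = fun x => \sum_X F X * (t x == X)%:R.
  apply/funext => x; rewrite (bigD1 (t x))//= eqxx mulr1 big1 ?addr0// => X /negbTE.
  by rewrite eq_sym => ->; rewrite mulr0.
apply: measurable_sum => X; apply: measurable_funM => //.
have -> : (fun x => (t x == X)%:R) = \1_(t @^-1` [set X]) :> (R -> R).
  apply/funext => x; rewrite indicE; case: eqP => tX; [rewrite mem_set|rewrite memNset] => //.
exact: measurable_indic.
Qed.

Lemma mean_finite_comp (R : realType) (U : probability R R) (T : finType) (t : R -> T) (F P : T -> R) :
  (forall X, measurable (t @^-1` [set X])) -> (forall X, U (t @^-1` [set X]) = (P X)%:E) ->
  Rintegral U setT (F \o t) = \sum_X P X * F X.
Proof.
move=> mt PE; have tE X : [set x | t x == X] = t @^-1` [set X].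
  by apply/seteqP; split=> x /= /eqP.
have -> : F \o t = fun x => \sum_X F X * (t x == X)%:R.
  apply/funext => x; rewrite (bigD1 (t x))//= eqxx mulr1 big1 ?addr0// => X /negbTE.
  by rewrite eq_sym => ->; rewrite mulr0.
rewrite mean_linear => [|X]; last by apply: integrable_bool; rewrite tE.
by apply: eq_bigr => X _; rewrite mean_bool ?tE// PE mulrC.
Qed.

(** A countable type: through [pickle], one application of the coupling makes all the statistics
    converge together. *)
Definition coord : Type := ((nat + nat) + (seq bool + nat * rat))%type.

Definition table_coord (R : realType) (N M : nat) (X : {ffun 'I_N -> {ffun 'I_M -> bool}})
    (c : coord) : R :=
  match c with
  | inl (inl i) => row_freq R X i
  | inl (inr i) => row_tau R X i
  | inr (inl a) => \sum_(i <- iota 1 N) row_freq R X i * atom_wt (row_tau R X i) a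
  | inr (inr (K, r)) =>
      \sum_(i <- iota K.+1 (N - K)) row_freq R X i * (row_tau R X i <= ratr r)%R%:R
  end.

Lemma table_coord_bounds (R : realType) (N M : nat) (X : {ffun 'I_N -> {ffun 'I_M -> bool}}) c :
  (0 < N)%N -> (0 < M)%N -> 0 <= table_coord R X c <= 1.
Proof.
move=> N0 M0.
have p_ge0 := row_freq_ge0 R X; have p_le1 := sum_row_freq_le1 R X N0.
have avg (s : seq nat) (w : nat -> R) : \sum_(i <- s) row_freq R X i <= 1 ->
    (forall i, 0 <= w i <= 1) -> 0 <= \sum_(i <- s) row_freq R X i * w i <= 1.
  move=> s1 w01; apply/andP; split.
    by apply: sumr_ge0 => i _; rewrite mulr_ge0//; case/andP: (w01 i).
  by apply: le_trans s1; apply: ler_sum => i _; rewrite ler_piMr//; case/andP: (w01 i).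
case: c => [[i|i]|[a|[K r]]] /=.
- rewrite p_ge0 /=; case: i => [|i]; first by rewrite /row_freq.
  apply: le_trans (p_le1 i.+1); rewrite -[i.+1]addn1 iotaD big_cat /= big_seq1 add1n addn1.
  by rewrite lerDr; apply: sumr_ge0.
- exact: row_tau_bounds.
- by apply: avg => [|i]; [exact: p_le1|exact/atom_wt_bounds/row_tau_bounds].
apply: avg => [|i]; last by rewrite ler0n lern1 leq_b1.
apply: le_trans (p_le1 (K + (N - K))%N); rewrite iotaD add1n big_cat /= lerDr.
exact: sumr_ge0.
Qed.

Section RandomB.
Variables (R : realType) (p tau : nat -> R -> R) (p0 : R -> R) (G : rat -> R -> R).
Hypothesis measurable_p : forall i, measurable_fun setT (p i).
Hypothesis measurable_tau : forall i, measurable_fun setT (tau i).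
Hypothesis measurable_p0 : measurable_fun setT p0.
Hypothesis measurable_G : forall r, measurable_fun setT (G r).

Definition random_B (x : R) : Bmeas R :=
  mkB (fun i => if i is 0%N then p0 x else p i x) (fun i => tau i x)
    (dust_law measurable_p0 measurable_G x).

Lemma measurable_random_B : measurable_fun setT random_B.
Proof.
apply: measurable_to_Bmeas => [[|i]|i|E mE] //=; exact: measurable_dust_law.
Qed.

End RandomB.

(** At each sample point the limits of the statistics form a parameter in B, and [avg_draws]
    converges to its [vsd]. Bounded convergence identifies the integral of [vsd] with the limit of
    the expected averages, which is [W] by [table_wt_cvg]. *)
Lemma random_B_exists (R : realType) (W : seq nat -> fml -> R) :
  (forall L, probfun L (W L)) -> (forall L, SPxP L (W L)) ->
  (forall L L' f, {subset L <= L'} -> sentence L f -> W L' f = W L f) ->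
  exists b : R -> Bmeas R, [/\ measurable_fun setT b, forall x, inB (b x) &
    forall q m g, g \in words (bitwords q) m ->
      (\int[@unif R]_x (vsd q (b x) g)%:E)%E = (W (Lq q) (sd (Lq q) g))%:E].
Proof.
move=> pW spW W_sub; pose M n := (n.+1 ^ 3)%N.
have M0 n : (0 < M n)%N by rewrite expn_gt0.
(* Index [n] stands for [n + 1] constants, so that no table is empty and frequencies are defined. *)
pose T n : finType := {ffun 'I_n.+1 -> {ffun 'I_(M n) -> bool}}.
pose Pn n (X : T n) : R := table_wt (W (Lq (M n))) X.
pose phi n i (X : T n) : R :=
  if (unpickle i : option coord) is Some c then table_coord R X c else 0.
have phi01 n i X : 0 <= phi n i X <= 1.
  by rewrite /phi; case: unpickle => [c|]; [exact: table_coord_bounds|rewrite lexx ler01].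
have [N [t [HN mt ut cvg_t]]] := @skorokhod_finite R T Pn phi
  (fun n => table_wt_ge0 (pW _)) (fun n => sum_table_wt _ (pW _)) phi01.
pose n k := (N k).+1; have n_ge k : (k <= n k)%N by exact: leqW.
have cvg_c c x : cvgn (fun k => table_coord R (t k x) c).
  by have := cvg_t (pickle c) x; rewrite /phi pickleK.
pose lim c x : R := limn (fun k => table_coord R (t k x) c).
have limP c x : (fun k => table_coord R (t k x) c) @ \oo --> lim c x by exact: cvg_c.
have mlim c : measurable_fun setT (lim c).
  apply: (@measurable_fun_cvg _ _ R setT (fun k x => table_coord R (t k x) c)) => [k|x _].
    exact: (@measurable_finite_comp R (T (N k)) (t k) (fun X => table_coord R X c) (mt k)).
  exact: limP.
pose p x k i := row_freq R (t k x) i; pose tau x k i := row_tau R (t k x) i.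
pose P i x := lim (inl (inl i)) x; pose Tau i x := lim (inl (inr i)) x.
pose Mo a x := lim (inr (inl a)) x; pose F K r x := lim (inr (inr (K, r))) x.
have p_ge0 x k i : 0 <= p x k i by exact: row_freq_ge0.
have p_decr x k i : (0 < i)%N -> p x k i.+1 <= p x k i by exact: row_freq_decr.
have p_le1 x k K : \sum_(i <- iota 1 K) p x k i <= 1 by exact: sum_row_freq_le1.
have p_sum x k : \sum_(i <- iota 1 (n k)) p x k i = 1 by exact: sum_row_freq1.
have t01 x k i : 0 <= tau x k i <= 1 by exact: row_tau_bounds.
have cP x i : (p x) ^~ i @ \oo --> P i x by exact: limP.
have cT x i : (tau x) ^~ i @ \oo --> Tau i x by exact: limP.
have cM x a : (fun k => \sum_(i <- iota 1 (n k)) p x k i * atom_wt (tau x k i) a) @ \oo -->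
    Mo a x by exact: limP.
have cF x K r : (fun k => \sum_(i <- iota K.+1 (n k - K))
    p x k i * (tau x k i <= ratr r)%R%:R) @ \oo --> F K r x by exact: limP.
pose p0 x : R := limn (fun K => 1 - \sum_(i <- iota 1 K) P i x).
pose G r x : R := limn (fun K => F K r x).
have cp0 x : (fun K => 1 - \sum_(i <- iota 1 K) P i x) @ \oo --> p0 x.
  exact: (lim_p0_cvg (p_ge0 x) (p_le1 x) (cP x)).
have cG x r : (fun K => F K r x) @ \oo --> G r x.
  exact: (@lim_F_cvg R n (p x) (tau x) (fun K r => F K r x) n_ge (p_ge0 x) (cF x) r).
have mp0 : measurable_fun setT p0.
  apply: (@measurable_fun_cvg _ _ R setT (fun K x => 1 - \sum_(i <- iota 1 K) P i x)) => [K|x _].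
    by apply: measurable_funB => //; apply: measurable_sum => i; exact: mlim.
  exact: cp0.
have mG r : measurable_fun setT (G r).
  apply: (@measurable_fun_cvg _ _ R setT (fun K x => F K r x)) => [K|x _]; last exact: cG.
  exact: mlim.
pose b := random_B P Tau mp0 mG.
have mb : measurable_fun setT b by apply: measurable_random_B => i; exact: mlim.
have P_ge0 x i : 0 <= P i x by exact: (lim_p_ge0 (p_ge0 x) (cP x)).
have p0_bounds x : 0 <= p0 x <= 1.
  exact: (lim_p0_bounds (p_ge0 x) (p_le1 x) (cP x) (cp0 x)).
have bB x : inB (b x).
  split=> /=.
  - by case=> [|i]; [case/andP: (p0_bounds x)|exact: P_ge0].
  - by case=> // i _; exact: (lim_p_decr (p_decr x) (cP x)).
  - rewrite -(cvg_shiftS _) /=.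
    have H : (fun K => p0 x + 1 - (1 - \sum_(i <- iota 1 K) P i x)) @ \oo --> p0 x + 1 - p0 x.
      by apply: cvgB => //; exact: cvg_cst.
    rewrite (_ : p0 x + 1 - p0 x = 1) in H; last by ring.
    apply: cvg_trans H; apply: near_eq_cvg; apply: nearW => K.
    rewrite big_ord_recl (iotaDl 1 0) big_map -[X in iota 0 X](subn0 K) -/(index_iota 0 K).
    rewrite big_mkord -[X in _ = _ + X]/(\sum_(i < K) P (1 + i)%N x).
    by move: (\sum_(i < K) _) => S; ring.
  - by move=> i _; exact: (lim_t01 (t01 x) (cT x)).
  - exact: dust_law_itv.
exists b; split=> // q m g gw.
have gq : all (fun a => size a == q) g.
  move: gw; rewrite mem_words => /andP[_ gA]; apply: sub_all gA => a.
  by rewrite inE mem_bitwords.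
have sq a : a \in g -> size a = q by move/(allP gq)/eqP.
have avgE k x : avg_draws R q g (t k x) =
    colour_sum (n k) (p x k) (fun a i => atom_wt (tau x k i) a) (fun=> 0) [::] g.
  by rewrite avg_draws_colour_sum.
have avg_cvg x : (fun k => avg_draws R q g (t k x)) @ \oo --> vsd q (b x) g.
  under eq_fun do rewrite avgE.
  have mZ := measurable_dust_section mp0 mG x.
  have Z01 u : 0 <= dust_section p0 G x u <= 1 by exact: dust_value_bounds.
  pose D a := p0 x * dust_mean (dust_section p0 G x) a.
  have vpartE K : vpart q (b x) K g =
      colour_sum K (fun i => P i x) (fun a i => atom_wt (Tau i x) a) D [::] g.
    apply: colour_sum_ext; first by case.
      by move=> a i ag i0; rewrite (bcoefSE _ i0 (sq a ag)).
    move=> a ag; congr (_ * _); apply: EFin_inj; rewrite (bcoef0E (bB x) (sq a ag)).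
    exact: dust_law_integral.
  apply: (colour_sum_limit n_ge (p_ge0 x) (p_decr x) (p_le1 x) (p_sum x) (t01 x)
    (cP x) (cT x) (cM x) (cp0 x) (D := D)).
  - move=> a; apply: (dust_mean_cvg n_ge (p_ge0 x) (p_le1 x) (p_sum x) (t01 x)
      (cP x) (cT x) (cM x) (cF x) (cp0 x) (cG x) mZ Z01).
      by move=> u r r01; exact: dust_value_le.
    move=> u r r01; apply: dust_value_ge => // s s'.
    exact: (lim_G_le (p_ge0 x) (cF x) (cG x)).
  - move=> a; have /andP[p00 p01] := p0_bounds x.
    have /andP[d0 d1] := dust_mean_bounds mZ Z01 a.
    by rewrite /D mulr_ge0//= ler_piMr.
  by under eq_fun do rewrite -vpartE; exact: vpart_cvg.
have avg01 k x : 0 <= avg_draws R q g (t k x) <= 1.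
  have wt01 a i := atom_wt_bounds a (t01 x k i).
  rewrite avgE; apply/andP; split; [apply: colour_sum_ge0|apply: colour_sum_le1] => //.
    by move=> a i; case/andP: (wt01 a i).
  by move=> a; rewrite add0r.
have mavg k : measurable_fun setT (fun x => avg_draws R q g (t k x)).
  exact: (@measurable_finite_comp R (T (N k)) (t k) (fun X => avg_draws R q g X) (mt k)).
have mv : measurable_fun setT (fun x => vsd q (b x) g).
  by apply: (@measurable_fun_cvg _ _ R setT (fun k x => avg_draws R q g (t k x))).
have mfE (f : R -> R) : measurable_fun setT f -> measurable_fun setT (fun x => (f x)%:E).
  by move=> mf; apply/measurable_EFinP.
have ae_cvg : \forall x \ae @unif R, setT x ->
    (fun k => (avg_draws R q g (t k x))%:E) @ \oo --> (vsd q (b x) g)%:E.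
  by apply: aeW => x _; apply: cvg_EFin; [exact: nearW|exact: avg_cvg].
have ae_le : \forall x \ae @unif R, forall k, setT x ->
    (`|(avg_draws R q g (t k x))%:E| <= cst 1%:E x)%E.
  by apply: aeW => x k _; have /andP[a0 a1] := avg01 k x; rewrite /= lee_fin ger0_norm.
have [_ _ conv] := @dominated_convergence _ _ R (@unif R) setT measurableT _ _ _
  (fun k => mfE _ (mavg k)) (mfE _ mv) ae_cvg
  (finite_measure_integrable_cst _ 1 measurableT) ae_le.
have intE k : (\int[@unif R]_x (avg_draws R q g (t k x))%:E)%E =
    (\sum_X Pn (N k) X * avg_draws R q g X)%:E.
  rewrite -(@mean_finite_comp R (@unif R) (T (N k)) (t k) (fun X => avg_draws R q g X)
    (@Pn (N k)) (mt k) (ut k)) /Rintegral fineK//.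
  apply: integrable_fin_num => //; apply: (@integrable_bounded _ _ _ _ _ 1); first exact: mavg.
  by move=> x; have /andP[a0 a1] := avg01 k x; rewrite /= ger0_norm.
have cW : (fun k => \int[@unif R]_x (avg_draws R q g (t k x))%:E)%E @ \oo -->
    (W (Lq q) (sd (Lq q) g))%:E.
  rewrite (funext intE); apply: cvg_EFin; first exact: nearW.
  (* The coupling provides sizes with [k <= n k], which is what composing the limit along them
     takes. *)
  have := table_wt_cvg pW spW W_sub gw => cW A /cW[K _ HK]; exists K => // k /= Kk.
  exact: HK (leq_trans Kk (n_ge k)).
exact: (cvg_unique _ conv cW).
Qed.

Theorem theorem2 (R : realType) (q : nat) (w : fml -> R) :
  (0 < q)%N -> probfun (Lq q) w -> ExP (Lq q) w ->
  (ULi_SPx q w <->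
   exists mu : probability (Bmeas R) R,
     mu [set b | inB b]%classic = 1%E /\
     forall f, sentence (Lq q) f ->
       (w f)%:E = (\int[mu]_b (vfun q b f)%:E)%E).
Proof.
move=> _ pw _; split=> [[W [HW Wq W_sub]]|[mu [muB wE]]]; last exact: ULi_of_mixture muB wE.
have pW L : probfun L (W L) by case: (HW L).
have spW L : SPxP L (W L) by case: (HW L).
have [b [mb bB int_b]] := random_B_exists pW spW W_sub.
pose bf : {mfun R >-> Bmeas R} := mfun_Sub (mem_set mb).
pose mu : probability (Bmeas R) R := distribution (@unif R) bf.
have muB : mu (@inBset R) = 1%E.
  rewrite /mu /= /distribution /pushforward -(@probability_setT _ _ _ (@unif R)); congr unif.
  by apply/seteqP; split=> x // _; exact: bB.
have muB0 : mu (~` @inBset R) = 0%E.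
  by rewrite probability_setC ?muB ?subee//; exact: measurable_inB.
exists mu; split=> // f sf.
(* [vfun] and [law] agree on B, which carries all the mass of [mu]. *)
have -> : (\int[mu]_b (vfun q b f)%:E)%E = (mixture mu (Lq q) f)%:E.
  rewrite mixtureE; apply: (integral_eq_off_null (@measurable_inB R) muB0) => c hc.
  by rewrite vfun_law.
(* The mixture is itself a probability function, so agreement on state descriptions is enough. *)
congr EFin; apply: (probfun_unique pw (mixture_probfun mu (Lq q) (Lq q))) => // h wf.
have sQ : size (undup (Lq q)) = q by rewrite undup_Lq size_iota.
have hw : h \in words (bitwords q) (size h).
  rewrite mem_words eqxx; apply/allP => a /(allP wf).
  by rewrite sQ /= mem_bitwords.
apply: EFin_inj; rewrite -Wq ?sentence_sd// -(int_b _ _ _ hw) mixtureE.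
rewrite [RHS]ge0_integral_pushforward//=; first last.
- by move=> c _; rewrite lee_fin law_sd// vsd_ge0//; exact: to_B_inB.
- exact: measurable_law.
by apply: eq_integral => x _ /=; rewrite law_sd// sQ to_B_id.
Qed.
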